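(* Let $n\ge 1$ be an integer. Let $0<\alpha<n$, $1<q_j\le p_j<\infty$ for $j=1,2$, $0<q\le p<\infty$ and $0<t\le 1\le s$ be such that $$\frac1p=\frac1{p_1}+\frac1{p_2},\quad \frac1q=\frac1{q_1}+\frac1{q_2},\quad \frac1s=\frac1p-\frac{\alpha}{n},\quad \frac qp=\frac ts,\quad s<\min(q_1,q_2).$$ Then there is a constant $C>0$, depending only on $n,\alpha,p_1,p_2,q_1,q_2,p,q,s,t$, such that $$\|\mathcal{J}_\alpha[f_1,f_2]\|_{\mathcal{M}^s_t}\le C\,\|f_1\|_{\mathcal{M}^{p_1}_{q_1}}\|f_2\|_{\mathcal{M}^{p_2}_{q_2}}$$ for all $f_1\in\mathcal{M}^{p_1}_{q_1}(\mathbb{R}^n)$ and all $f_2\in\mathcal{M}^{p_2}_{q_2}(\mathbb{R}^n)$.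
   Context: Dyadic cubes: for $j\in\mathbb{Z}$ and $k=(k_1,\dots,k_n)\in\mathbb{Z}^n$ let $Q_{jk}=\prod_{i=1}^n[k_i2^{-j},(k_i+1)2^{-j})$, and let $\mathcal{D}=\{Q_{jk}: j\in\mathbb{Z},\,k\in\mathbb{Z}^n\}$ be the family of all dyadic cubes in $\mathbb{R}^n$. $|Q|$ denotes Lebesgue measure. Morrey space: for $0<q\le p<\infty$, $\mathcal{M}^p_q(\mathbb{R}^n)$ is the set of all measurable functions $f$ on $\mathbb{R}^n$ (identified when equal a.e.) such that $$\|f\|_{\mathcal{M}^p_q}=\sup_{Q\in\mathcal{D}}|Q|^{\frac1p-\frac1q}\left(\int_Q|f(x)|^q\,dx\right)^{\frac1q}<\infty.$$ Bilinear fractional integral operator (of Grafakos type): for $0<\alpha<n$ and measurable functions $f_1,f_2$ on $\mathbb{R}^n$, $$\mathcal{J}_\alpha[f_1,f_2](x)=\int_{\mathbb{R}^n}\frac{f_1(x+y)f_2(x-y)}{|y|^{n-\alpha}}\,dy,\quad x\in\mathbb{R}^n,$$ where for non-negative $f_1,f_2$ the integral is $[0,\infty]$-valued, and for complex-valued $f_1,f_2$ it is understood as an absolutely convergent integral. *)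

(* Defs.v *)
From HB Require Import structures.
From mathcomp Require Import all_boot all_order all_algebra.
From mathcomp Require Import complex.
From mathcomp Require Import all_classical all_reals all_analysis.
From mathcomp Require Import measurable_realfun.

Set Implicit Arguments.
Unset Strict Implicit.
Unset Printing Implicit Defensive.

Import Order.TTheory GRing.Theory Num.Theory.
Import numFieldNormedType.Exports.

Local Open Scope classical_set_scope.
Local Open Scope ring_scope.
Local Open Scope complex_scope.

(* MathComp-Analysis has Lebesgue measure on the line only.  On R^n it is built
   here in two steps: the iterated product measure on the Borel sets of
   n.-tuple R, then its completion. *)

Section tuple_product.
Context {R : realType} (n : nat).
Local Notation mR := (measurableTypeR R).
Variable m : {sigma_finite_measure set (n.-tuple mR) -> \bar R}.

Definition tuple_cons (z : mR * n.-tuple mR) : n.+1.-tuple mR :=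
  [the n.+1.-tuple mR of z.1 :: z.2].

Lemma measurable_tuple_cons : measurable_fun [set: mR * n.-tuple mR] tuple_cons.
Proof.
exact: (measurable_cons (f := fst) (g := snd) measurable_fst measurable_snd).
Qed.

Definition cons_measure : set (n.+1.-tuple mR) -> \bar R :=
  pushforward (@lebesgue_measure R \x m)%E tuple_cons.

Let cons_measure0 : cons_measure set0 = 0%E.
Proof. by rewrite /cons_measure /pushforward preimage_set0 measure0. Qed.

Let cons_measure_ge0 A : (0 <= cons_measure A)%E.
Proof. by apply: integral_ge0 => x _; apply: measure_ge0. Qed.

Let cons_measure_sigma_additive : semi_sigma_additive cons_measure.
Proof.
pose nu : {measure set (mR * n.-tuple mR)%type -> \bar R} :=
  (@lebesgue_measure R \x m)%E.
move=> F mF tF mUF; rewrite /cons_measure /pushforward preimage_bigcup.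
have mpre A : measurable A -> measurable (tuple_cons @^-1` A).
  by move=> mA; rewrite -[X in measurable X]setTI; exact: measurable_tuple_cons.
apply: (@measure_semi_sigma_additive _ _ _ nu (fun k => tuple_cons @^-1` F k)).
- by move=> k; exact: mpre.
- apply/trivIsetP => /= i j _ _ ij; rewrite -preimage_setI.
  by move/trivIsetP : tF => /(_ _ _ _ _ ij) ->//; rewrite preimage_set0.
- by rewrite -preimage_bigcup; exact: mpre.
Qed.

HB.instance Definition _ := isMeasure.Build _ _ _ cons_measure
  cons_measure0 cons_measure_ge0 cons_measure_sigma_additive.

Let cons_measure_sigma_finite : sigma_finite setT cons_measure.
Proof.
have /sigma_finiteP[F [FT ndF Foo]] := sigma_finiteT (@lebesgue_measure R).
have /sigma_finiteP[G [GT ndG Goo]] := sigma_finiteT m.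
pose H k : set (n.+1.-tuple mR) :=
  [set v : n.+1.-tuple mR | F k (thead v)] `&`
  [set v : n.+1.-tuple mR | G k [tuple of behead v]].
have consH k : tuple_cons @^-1` H k = F k `*` G k.
  apply/seteqP; split => -[x v]; rewrite /H /tuple_cons/=.
    by move=> [Fx Gv]; split => //=; move: Gv; congr (G k _); exact/val_inj.
  by move=> [Fx Gv]; split => //=; move: Gv; congr (G k _); exact/val_inj.
exists H.
  apply/esym; rewrite -subTset => v _.
  have [i _ Fi] : (\bigcup_i F i) (thead v) by rewrite -FT.
  have [j _ Gj] : (\bigcup_j G j) [tuple of behead v] by rewrite -GT.
  exists (maxn i j) => //; split.
  - by move/subsetPset: (ndF _ _ (leq_maxl i j)); exact.
  - by move/subsetPset: (ndG _ _ (leq_maxr i j)); exact.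
move=> k; have [mF Fk] := Foo k; have [mG Gk] := Goo k; split.
  apply: measurableI.
  - rewrite -[X in measurable X]setTI.
    exact: (measurable_tnth ord0 measurableT mF).
  - rewrite -[X in measurable X]setTI.
    exact: (@measurable_behead _ mR n measurableT _ mG).
rewrite /= /cons_measure /pushforward consH product_measure1E//.
by rewrite lte_mul_pinfty// ge0_fin_numE.
Qed.

HB.instance Definition _ := Measure_isSigmaFinite.Build _ _ _
  cons_measure cons_measure_sigma_finite.

End tuple_product.

Fixpoint borel_lebesgue (R : realType) (n : nat) :
    {sigma_finite_measure set (n.-tuple (measurableTypeR R)) -> \bar R} :=
  match n with
  | 0%N => dirac [tuple]
  | n'.+1 => cons_measure (borel_lebesgue R n')
  end.

(* Rn is a separate constant so that it carries the Lebesgue sigma-algebra; the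
   canonical one on n.-tuple R is the Borel sigma-algebra. *)
Definition Rn (R : realType) (n : nat) : Type := n.-tuple R.

HB.instance Definition _ (R : realType) (n : nat) :=
  Measurable.copy (Rn R n) (caratheodory_type (borel_lebesgue R n)^*%mu).

Definition lebesgue (R : realType) (n : nat) : {measure set Rn R n -> \bar R} :=
  @completed_measure_extension _ _ _ (borel_lebesgue R n).

Section boxes.
Context (R : realType).
Local Notation mR := (measurableTypeR R).

Lemma borel_box n (I : 'I_n -> set mR) : (forall i, measurable (I i)) ->
  measurable [set x : n.-tuple mR | forall i, I i (tnth x i)] /\
  borel_lebesgue R n [set x | forall i, I i (tnth x i)] =
    (\prod_(i < n) lebesgue_measure (I i))%E.
Proof.
elim: n I => [|n IH] I mI.
  have -> : [set x : 0.-tuple mR | forall i, I i (tnth x i)] = setT.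
    by apply/seteqP; split => // x _ [].
  by split => //; rewrite big_ord0/= diracT.
have mbox : measurable [set x : n.+1.-tuple mR | forall i, I i (tnth x i)].
  rewrite (_ : mkset _ =
      \bigcap_(i in [set: 'I_n.+1]) [set x | I i (tnth x i)]); last first.
    by apply/seteqP; split => x /= H i; [move=> _; exact: H|exact: H].
  apply: fin_bigcap_measurable => // i _; rewrite -[X in measurable X]setTI.
  exact: (measurable_tnth i measurableT (mI i)).
split => //.
have [mB IH'] := IH (fun i => I (lift ord0 i)) (fun i => mI _).
rewrite big_ord_recl/= /cons_measure /pushforward -IH'.
rewrite -product_measure1E//; congr (_ _).
apply/seteqP; split => [[x v]|[x v]]; rewrite /tuple_cons/=.
  move=> H; split => [|i]; first exact: (H ord0).
  by have := H (lift ord0 i); rewrite tnthS.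
move=> [Hx Hv] i; case: (unliftP ord0 i) => [j ->|->] //.
by rewrite tnthS; exact: Hv.
Qed.

Lemma borel_measurable n (A : set (n.-tuple mR)) :
  measurable A -> measurable (A : set (Rn R n)).
Proof. by move=> mA; exact: caratheodory_measurable_mu_ext. Qed.

Lemma lebesgue_box n (I : 'I_n -> set mR) : (forall i, measurable (I i)) ->
  lebesgue R n [set x | forall i, I i (tnth (x : n.-tuple R) i)] =
    (\prod_(i < n) lebesgue_measure (I i))%E.
Proof.
move=> /borel_box[mB <-].
by rewrite /lebesgue/= /completed_measure_extension measurable_mu_extE.
Qed.

End boxes.

Section morrey.
Context {R : realType} {n : nat}.
Implicit Types (x y : Rn R n) (p q alpha : R).
Local Notation mu := (lebesgue R n).

Definition Rn_coord x (i : 'I_n) : R := tnth (x : n.-tuple R) i.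

Definition Rn_add x y : Rn R n := [tuple Rn_coord x i + Rn_coord y i | i < n].

Definition Rn_sub x y : Rn R n := [tuple Rn_coord x i - Rn_coord y i | i < n].

Definition Rn_norm x : R := Num.sqrt (\sum_(i < n) Rn_coord x i ^+ 2).

Definition dyadic_cube (j : int) (k : 'I_n -> int) : set (Rn R n) :=
  [set x | forall i : 'I_n,
     (k i)%:~R * 2 ^ (- j) <= Rn_coord x i < (k i + 1)%:~R * 2 ^ (- j)].

Definition dyadic_cubes : set (set (Rn R n)) :=
  [set Q | exists j k, Q = dyadic_cube j k].

Definition morrey_norm p q (f : Rn R n -> \bar R) : \bar R :=
  ereal_sup [set (mu Q `^ (p^-1 - q^-1)
                  * (\int[mu]_(x in Q) (`|f x| `^ q)) `^ q^-1)%E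
            | Q in dyadic_cubes].

Definition morrey p q : set (Rn R n -> \bar R) :=
  [set f : Rn R n -> \bar R |
     measurable_fun setT f /\ (morrey_norm p q f < +oo)%E].

Definition cmorrey_norm p q (f : Rn R n -> R[i]) : \bar R :=
  morrey_norm p q (fun x => (ComplexField.Normc.normc (f x))%:E).

Definition cmorrey p q : set (Rn R n -> R[i]) :=
  [set f : Rn R n -> R[i] |
     [/\ measurable_fun setT (fun x => complex.Re (f x)),
         measurable_fun setT (fun x => complex.Im (f x)) &
         (cmorrey_norm p q f < +oo)%E]].

(* As 0^-1 = 0, the kernel is 0 instead of +oo at y = 0, which is a null set
   for 0 < n. *)
Definition riesz_kernel alpha y : R := (Rn_norm y `^ (n%:R - alpha))^-1.

(* For nonnegative f1 and f2, with values in [0, +oo]. *)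
Definition J alpha (f1 f2 : Rn R n -> \bar R) x : \bar R :=
  (\int[mu]_y (f1 (Rn_add x y) * f2 (Rn_sub x y)
                * (riesz_kernel alpha y)%:E))%E.

Definition cJ_integrand alpha (f1 f2 : Rn R n -> R[i]) x y : R[i] :=
  f1 (Rn_add x y) * f2 (Rn_sub x y) * (riesz_kernel alpha y)%:C.

Definition cJ_converges alpha (f1 f2 : Rn R n -> R[i]) x : Prop :=
  mu.-integrable setT
    (fun y => (complex.Re (cJ_integrand alpha f1 f2 x y))%:E) /\
  mu.-integrable setT
    (fun y => (complex.Im (cJ_integrand alpha f1 f2 x y))%:E).

(* Meaningful at the points x where cJ_converges holds. *)
Definition cJ alpha (f1 f2 : Rn R n -> R[i]) x : R[i] :=
  (\int[mu]_y complex.Re (cJ_integrand alpha f1 f2 x y)) +i*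
  (\int[mu]_y complex.Im (cJ_integrand alpha f1 f2 x y)).

End morrey.

(* Main.v *)
Require Import Defs.
From HB Require Import structures.
From mathcomp Require Import all_boot all_order all_algebra.
From mathcomp Require Import complex ring lra zify.
From mathcomp Require Import all_classical all_reals all_analysis.
From mathcomp Require Import measurable_realfun.

Set Implicit Arguments.
Unset Strict Implicit.
Unset Printing Implicit Defensive.

Import Order.TTheory GRing.Theory Num.Theory.
Import numFieldNormedType.Exports.

Local Open Scope classical_set_scope.
Local Open Scope ring_scope.

(** The operator is cut into dyadic scales, and the scales finer and coarser
    than a given cube are treated by different arguments.

    Write B(r) for the cube of all y with |y_i| < r for every i.  A Riesz kernel
    is bounded by 2^n times the sum over r = 2^-i of r^(alpha - n) 1_B(r)
    ([riesz_kernel_le]), so J_alpha[f1, f2] is bounded by the sum of the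
    r^(alpha - n) D_r, where D_r(x) is the integral of f1(x + y) f2(x - y) over
    y in B(r) ([bilinear_average], [borel_J_le]).  Fix a dyadic cube Q of side
    l, and normalize both Morrey norms to 1: the integral of J^t over Q has to be
    at most C l^(n - n t / s).

    Scales r <= l.  Integrating D_r(z + e) over e in B(r) and substituting
    u = x + y, v = x - y decouples the two functions: the result is at most
    A_1(z) A_2(z), where A_i(z) is the integral of f_i over z + B(2r)
    ([average_bilinear_average]).  Since t <= 1, concavity bounds the integral of
    D_r^t over Q by that of the t-th powers of these means over a slightly larger
    cube ([integral_bilinear_average_powR]); this is what makes an exponent
    t below 1 available without any bound on a bilinear maximal function.
    With a_i = A_i / r^n, Young's inequality with the conjugate exponents q_1/q
    and q_2/q splits r^(alpha t) (a_1 a_2)^t into a sum of two terms, a power of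
    r times a_i^(q_i s / p) each, and the relations between the exponents make
    the powers of r and l come out right ([young_scaled]).  The sum over r of
    each of the terms is controlled by Adams' argument ([adams_estimate]): the
    Morrey condition gives a_i <= K r^(-n / p_i), and splitting f_i at the height
    r^(-n / p_i), the power a_i^tau with tau = q_i s / p is at most a multiple of a
    mean of a function of f_i alone.  For a fixed value of f_i the contributions
    of the scales form two geometric series, because 1 < q_i < tau, and they add
    up to a multiple of f_i^q_i.  As t <= 1, the t-th power of the sum over r is at most the sum of
    the t-th powers, and the scales can be put together
    ([fine_scales_estimate]).

    Scales r > l.  Concavity now reduces the t-th power to the first power, and the
    integral of D_r over Q is at most the integral of f1 over a box of size r
    times the largest integral of f2 over a box of size l
    ([integral_bilinear_average_large]).  The Morrey bounds leave a geometric
    series in r of ratio 2^-(n / p_1 - alpha), which converges because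
    n / p_1 - alpha = n (1/s - 1/p_2) is positive, as s < q_2 <= p_2
    ([coarse_scales_estimate]).

    It remains to pass from Borel functions to Lebesgue measurable ones and to
    complex values.  A Lebesgue measurable function agrees with a Borel one off
    a null set, and y |-> x + y and y |-> x - y preserve null sets, so J_alpha is
    the same at every point x for both ([borel_J_eq]).  For complex functions the
    real and imaginary parts of the integrand are dominated by the integrand of
    J_alpha[|f1|, |f2|], which is finite almost everywhere because it is in a
    Morrey space ([morrey_ae_fin]). *)

(** * Affine changes of variables *)

Section affine1.
Context {R : realType}.
Local Notation mR := (measurableTypeR R).
Local Notation lam := (@lebesgue_measure R).
Implicit Types (a b : R).

Lemma measurable_affine1 a b :
  measurable_fun [set: mR] (fun x : mR => a * x + b : mR).
Proof.
apply: (@measurable_funD _ mR R setT (fun x => a * x) (cst b)) => //.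
exact: (@measurable_funM _ mR R setT (cst a) (fun x => x)).
Qed.

Let image_lam a b : {measure set mR -> \bar R} :=
  measure_function_pushforward__canonical__measure_function_Measure lam
    (measurable_affine1 a b).

(** The right-hand side is a measure in A which agrees with Lebesgue measure on
    intervals, so uniqueness of Lebesgue measure applies. *)
Lemma lebesgue_measure_affine a b (A : set mR) : a != 0 -> measurable A ->
  (lam A = `|a|%:E * lam ((fun x : mR => (a * x + b)%R : mR) @^-1` A))%E.
Proof.
move=> a0 mA.
suff : lam A = mscale (NngNum (normr_ge0 a)) (image_lam a b) A by [].
apply: lebesgue_measure_unique => //= X [[c d]] _ <-.
rewrite /mscale/= /pushforward.
have [cd|dc] := ltP c d; last first.
  by rewrite set_itv_ge ?preimage_set0 ?measure0 ?mule0// bnd_simp -leNgt.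
rewrite lebesgue_measure_itv/= lte_fin cd.
have [ap|an|a00] := ltgtP 0 a; last by rewrite a00 eqxx in a0.
- rewrite (_ : _ @^-1` _ = `](c - b) / a, (d - b) / a]%classic); last first.
    apply/seteqP; split => x /=; rewrite !in_itv/= ltr_pdivrMr// ler_pdivlMr//;
    by move=> /andP[h1 h2]; apply/andP; split; nra.
  rewrite lebesgue_measure_itv/= lte_fin ltr_pM2r ?invr_gt0// ltrD2r cd gtr0_norm//.
  by rewrite -!EFinD -EFinM; congr (_%:E); field.
- rewrite (_ : _ @^-1` _ = `[(d - b) / a, (c - b) / a[%classic); last first.
    apply/seteqP; split => x /=; rewrite !in_itv/= ltr_ndivlMr// ler_ndivrMr//;
    by move=> /andP[h1 h2]; apply/andP; split; nra.
  rewrite lebesgue_measure_itv/= lte_fin ltr_nM2r ?invr_lt0// ltrD2r cd ltr0_norm//.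
  by rewrite -!EFinD -EFinM; congr (_%:E); field.
Qed.

Lemma integral_affine1 a b (f : mR -> \bar R) : a != 0 ->
  measurable_fun setT f -> (forall x, 0 <= f x)%E ->
  (\int[lam]_x f x = `|a|%:E * \int[lam]_x f ((a * x + b)%R : mR))%E.
Proof.
move=> a0 mf f0.
have -> : (\int[lam]_x f ((a * x + b)%R : mR) = \int[image_lam a b]_x f x)%E.
  by rewrite (ge0_integral_pushforward (measurable_affine1 a b))//= ?preimage_setT.
transitivity (\int[mscale (NngNum (normr_ge0 a)) (image_lam a b)]_x f x)%E.
  apply: eq_measure_integral => A mA _; exact: lebesgue_measure_affine.
by rewrite ge0_integral_mscale.
Qed.

End affine1.

Section tuples.
Context {R : realType}.
Local Notation mR := (measurableTypeR R).

(** Tonelli's theorem for the first coordinate: it is what allows inductions on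
    the dimension. *)
Lemma integral_cons n (f : n.+1.-tuple mR -> \bar R) :
  measurable_fun setT f -> (forall x, 0 <= f x)%E ->
  (\int[borel_lebesgue R n.+1]_x f x =
   \int[@lebesgue_measure R]_x \int[borel_lebesgue R n]_v f (tuple_cons (x, v)))%E.
Proof.
move=> mf f0.
rewrite /= /cons_measure.
rewrite [LHS](@ge0_integral_pushforward _ _ _ _ _ _ (@measurable_tuple_cons R n)
   (@lebesgue_measure R \x borel_lebesgue R n)%E setT f measurableT mf)//.
rewrite preimage_setT fubini_tonelli1//; last by move=> x; exact: f0.
exact: (measurableT_comp mf (@measurable_tuple_cons R n)).
Qed.

(** The point a x + b.  The translation part comes first, so that [affine a b] is a
    map of R^n, and the points x + y and x - y are [affine 1 x y] and
    [affine (-1) x y] as functions of y. *)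
Definition affine n (a : R) (b x : n.-tuple mR) : n.-tuple mR :=
  [tuple a * tnth x i + tnth b i : mR | i < n].

Lemma measurable_affine n d (X : measurableType d) a (g h : X -> n.-tuple mR) :
  measurable_fun setT g -> measurable_fun setT h ->
  measurable_fun setT (fun x => affine a (g x) (h x)).
Proof.
move=> mg mh; apply/measurable_fun_tnthP => i.
have -> : (fun x => tnth (x : n.-tuple mR) i) \o (fun x => affine a (g x) (h x)) =
   (fun x => a * tnth (h x) i + tnth (g x) i).
  by apply/funext => x; rewrite /= /affine tnth_mktuple.
apply: (@measurable_funD _ X R setT); last exact: measurableT_comp (measurable_tnth i) mg.
apply: (@measurable_funM _ X R setT (cst a)) => //.
exact: measurableT_comp (measurable_tnth i) mh.
Qed.

Lemma affine_cons n a (b : n.+1.-tuple mR) (x : mR) (v : n.-tuple mR) :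
  affine a b (tuple_cons (x, v)) =
  tuple_cons ((a * x + thead b : mR), affine a [tuple of behead b] v).
Proof.
apply: eq_from_tnth => i; rewrite /affine tnth_mktuple /tuple_cons /=.
case: (unliftP ord0 i) => [j ->|->] //.
by rewrite !tnthS tnth_mktuple tnth_behead; congr (_ + tnth b _); apply: val_inj;
  rewrite /= inordK //= ltnS.
Qed.

(** The linear part is a homothety, so only the one-dimensional rule and Tonelli's
    theorem are needed, one coordinate at a time. *)
Lemma integral_affine n a b (f : n.-tuple mR -> \bar R) : a != 0 ->
  measurable_fun setT f -> (forall x, 0 <= f x)%E ->
  (\int[borel_lebesgue R n]_x f x =
   (`|a| ^+ n)%:E * \int[borel_lebesgue R n]_x f (affine a b x))%E.
Proof.
move=> a0; elim: n b f => [|n IH] b f mf f0.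
  rewrite expr0 mul1e; apply: eq_integral => x _; congr f.
  by apply: eq_from_tnth => -[].
have mfa : measurable_fun setT (fun x => f (affine a b x)).
  by apply: measurableT_comp mf _; exact: measurable_affine.
rewrite integral_cons// [in RHS]integral_cons//.
have mfc : measurable_fun setT (f \o (@tuple_cons R n)).
  exact: measurableT_comp mf (@measurable_tuple_cons R n).
(* The induction hypothesis acts on the last n coordinates, the rule on the
   line on the first one. *)
pose b' := [tuple of behead b].
have mg x : measurable_fun setT (fun v => f (tuple_cons (x, v))).
  exact: (measurableT_comp mfc (measurable_pair1 _)).
under eq_integral => x _ do rewrite (IH b')//.
pose G (x : mR) := (\int[borel_lebesgue R n]_v f (tuple_cons (x, affine a b' v)))%E.
have mG : measurable_fun setT G.
  apply: (@measurable_fun_fubini_tonelli_F _ _ _ _ _ (borel_lebesgue R n)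
    (fun z : mR * n.-tuple mR => f (tuple_cons (z.1, affine a b' z.2)))) => //.
  have mh : measurable_fun setT
      (fun z : mR * n.-tuple mR => (z.1, affine a b' z.2)).
    apply/measurable_fun_pairP; split; first exact: measurable_fst.
    exact: (measurable_affine a (measurable_cst b') measurable_snd).
  exact: measurableT_comp mfc mh.
have G0 x : (0 <= G x)%E by exact: integral_ge0.
transitivity (\int[@lebesgue_measure R]_x ((`|a| ^+ n)%:E * G x))%E => //.
rewrite (ge0_integralZl_EFin _ measurableT (fun x _ => G0 x) mG); last exact: exprn_ge0.
rewrite (integral_affine1 (thead b) a0 mG)//.
rewrite muleA -EFinM -exprSr; congr (_ * _)%E.
apply: eq_integral => x _; apply: eq_integral => v _.
by rewrite affine_cons.
Qed.

End tuples.

(** * Lebesgue and Borel measurability *)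

Section transfer.
Context {R : realType} (n : nat).
Local Notation mR := (measurableTypeR R).
Local Notation T := (n.-tuple mR).
Local Notation bl := (borel_lebesgue R n).
Local Notation mu := (lebesgue R n).

(** On Borel sets the completion has the same values; together with the
    measurability of Borel sets this reduces integrals over the completed space
    to iterated integrals. *)
Lemma lebesgue_borel (A : set T) : measurable A -> mu A = bl A.
Proof. by move=> mA; exact: measurable_mu_extE. Qed.

Lemma measurable_Rn_borel : measurable_fun setT (id : Rn R n -> T).
Proof. by move=> _ A mA; rewrite setTI; exact: borel_measurable. Qed.

Lemma borel_measurable_fun d (Y : measurableType d) (f : T -> Y) :
  measurable_fun setT f -> measurable_fun setT (f : Rn R n -> Y).
Proof. by move=> mf; exact: measurableT_comp mf measurable_Rn_borel. Qed.

Lemma integral_lebesgue_borel (D : set T) (f : T -> \bar R) :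
  measurable D -> measurable_fun D f -> (forall x, 0 <= f x)%E ->
  (\int[mu]_(x in D) f x = \int[bl]_(x in D) f x)%E.
Proof.
move=> mD mf f0.
transitivity (\int[measure_function_pushforward__canonical__measure_function_Measure mu
    measurable_Rn_borel]_(x in D) f x)%E.
  by rewrite (ge0_integral_pushforward measurable_Rn_borel).
by apply: eq_measure_integral => A mA _; exact: lebesgue_borel.
Qed.

(** Lebesgue measure is built from an outer measure, an infimum over countable
    Borel covers: intersect covers that are optimal up to 1/k. *)
Lemma borel_hull (E : set T) : (mu_ext bl E < +oo)%E ->
  exists F : set T, [/\ measurable F, E `<=` F & bl F = mu_ext bl E].
Proof.
move=> Eoo.
have inv0 k : 0 < k.+1%:R^-1 :> R by rewrite invr_gt0.
have cover k : exists A, @measurable_cover _ T E A /\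
    (\sum_(0 <= i <oo) bl (A i) < mu_ext bl E + k.+1%:R^-1%:E)%E.
  have : mu_ext bl E \is a fin_num by rewrite ge0_fin_numE// mu_ext_ge0.
  by move/lb_ereal_inf_adherent => /(_ _ (inv0 k))[_/= [A EA] <-] ?; exists A.
pose A k := projT1 (cid (cover k)).
have cA k : @measurable_cover _ T E (A k).
  by rewrite /A; case: cid => //= ? [].
have sA k : (\sum_(0 <= i <oo) bl (A k i) < mu_ext bl E + k.+1%:R^-1%:E)%E.
  by rewrite /A; case: cid => //= ? [].
have mA k i : measurable (A k i) by exact: cover_measurable (cA k) i.
pose F_ k := \bigcup_i A k i.
have mF_ k : measurable (F_ k) by exact: bigcupT_measurable.
have mF : measurable (\bigcap_k F_ k) by exact: bigcapT_measurable.
have EF : E `<=` \bigcap_k F_ k by move=> x Ex k _; exact: cover_subset (cA k) _ Ex.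
exists (\bigcap_k F_ k); split => //.
apply/eqP; rewrite eq_le; apply/andP; split; last first.
  by rewrite -(measurable_mu_extE bl)//; exact: le_mu_ext.
apply/lee_addgt0Pr => _/posnumP[e].
have [k ke] : exists k : nat, k.+1%:R^-1 < e%:num.
  have [k _ hk] := near_infty_natSinv_lt e.
  exists k; exact: (hk k (leqnn _)).
apply: (@le_trans _ _ (bl (F_ k))).
  by apply: le_measure; rewrite ?inE//; exact: bigcap_inf.
apply: (@le_trans _ _ (\sum_(0 <= i <oo) bl (A k i))%E).
  apply: measure_sigma_subadditive => //; exact: mA.
by rewrite (le_trans (ltW (sA k)))// leeD2l// lee_fin ltW.
Qed.

Lemma null_borel_hull (N : set T) : mu_ext bl N = 0%E ->
  exists F : set T, [/\ measurable F, N `<=` F & bl F = 0%E].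
Proof.
by move=> N0; have [|F] := @borel_hull N; rewrite N0// => -[? ? ?]; exists F.
Qed.

(** A set of finite measure differs from its Borel hull by a null set, which has a
    Borel null hull itself; the general case follows by cutting the space into
    countably many pieces of finite measure. *)
Lemma lebesgue_measurable_borel (E : set (Rn R n)) : measurable E ->
  exists F G : set T, [/\ measurable F, measurable G, bl G = 0%E, E `<=` F &
    F `\` E `<=` G].
Proof.
move=> mE.
have fin (D : set (Rn R n)) : measurable D -> (mu D < +oo)%E -> exists FG : set T * set T,
    [/\ measurable FG.1, measurable FG.2, bl FG.2 = 0%E, D `<=` FG.1 & FG.1 `\` D `<=` FG.2].
  move=> mD Doo.
  have [F [mF DF FD]] := @borel_hull D Doo.
  have : mu (F `\` D) = 0%E.
    rewrite measureD//=; [|exact: borel_measurable|by rewrite lebesgue_borel// FD].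
    rewrite setIidr// lebesgue_borel// FD subee//.
    have D0 : (0 <= mu_ext bl D)%E by exact: mu_ext_ge0.
    by rewrite (ge0_fin_numE D0); exact: Doo.
  by move=> /null_borel_hull[G [mG FDG G0]]; exists (F, G).
have /sigma_finiteP[S [ST ndS mS]] := sigma_finiteT bl.
have mES i : measurable (E `&` S i : set (Rn R n)).
  by apply: measurableI => //; apply: borel_measurable; exact: (mS i).1.
have ESoo i : (mu (E `&` S i : set (Rn R n)) < +oo)%E.
  apply: (@le_lt_trans _ _ (mu (S i))).
    exact: (le_mu_ext bl (@subIsetr _ _ _)).
  by rewrite lebesgue_borel; [exact: (mS i).2|exact: (mS i).1].
have /choice[FG hFG] := fun i => fin _ (mES i) (ESoo i).
exists (\bigcup_i (FG i).1), (\bigcup_i (FG i).2); split.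
- by apply: bigcupT_measurable => i; have [] := hFG i.
- by apply: bigcupT_measurable => i; have [] := hFG i.
- apply/eqP; rewrite eq_le measure_ge0 andbT.
  apply: (@le_trans _ _ (\sum_(0 <= i <oo) bl (FG i).2)%E).
    apply: measure_sigma_subadditive => //.
    + by move=> i; have [] := hFG i.
    + by apply: bigcupT_measurable => i; have [] := hFG i.
  by rewrite eseries0// => i _ _; have [] := hFG i.
- move=> x Ex; have [i _ Si] : (\bigcup_i S i) x by rewrite -ST.
  by exists i => //; have [_ _ _ h _] := hFG i; apply: h.
- move=> x [[i _ Fi] nE]; exists i => //; have [_ _ _ _ h] := hFG i; apply: h.
  by split => // -[].
Qed.

(** The Borel function is f with the value 0 on a Borel null set N.  The sets
    f > r with r rational have Borel hulls that are exact up to null sets, N is the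
    union of the latter, and the sets f > a with a real are unions of those. *)
Lemma borel_representative (f : Rn R n -> R) : measurable_fun setT f ->
  exists (g : T -> R) (N : set T), [/\ measurable_fun setT g, measurable N,
    bl N = 0%E, (forall x, N x -> g x = 0) & (forall x, ~ N x -> g x = f x)].
Proof.
move=> mf.
(* An enumeration of the rational numbers. *)
pose r k : R := ratr (odflt 0 (unpickle k)).
have mE k : measurable ([set x | r k < f x] : set (Rn R n)).
  rewrite (_ : [set x | _] = f @^-1` `]r k, +oo[%classic); last first.
    by apply/seteqP; split => x /=; rewrite in_itv/= andbT.
  by rewrite -[X in measurable X]setTI; exact: mf.
have /choice[F /choice[G hFG]] := fun k => lebesgue_measurable_borel (mE k).
pose N : set T := \bigcup_k G k.
have mN : measurable N by apply: bigcupT_measurable => k; have [] := hFG k.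
exists (fun x => if x \in N then 0 else f x), N; split => //.
- apply: (measurability _ (RGenOInfty.measurableE R)).
  move=> _ [_ [a ->] <-]; rewrite setTI.
  rewrite (_ : _ @^-1` _ = (\bigcup_(k in [set k | a < r k]) (F k `\` N)) `|`
      (if a < 0 then N else set0)); last first.
    apply/seteqP; split => x /=; rewrite in_itv/= andbT.
      case: ifPn => [|nNx afx]; first by rewrite inE => Nx a0; right; rewrite a0.
      have [q] := rat_in_itvoo afx; rewrite in_itv/= => /andP[aq qf].
      have rq : r (pickle q) = ratr q by rewrite /r pickleK.
      left; exists (pickle q); first by rewrite /= rq.
      split; last by move=> Nx; rewrite mem_set in nNx.
      by have [_ _ _ h _] := hFG (pickle q); apply: h; rewrite /= rq.
    move=> [[k /= ak [Fk nNx]]|]; last by case: ifPn => // a0 Nx; rewrite mem_set.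
    rewrite memNset// (lt_trans ak)//.
    have [_ _ _ _ h] := hFG k; apply: contrapT => nE; apply: nNx.
    by exists k => //; apply: h.
  apply: measurableU; last by case: ifPn.
  apply: bigcup_measurable => k _; apply: measurableD => //.
  by have [] := hFG k.
- apply/eqP; rewrite eq_le measure_ge0 andbT.
  apply: (@le_trans _ _ (\sum_(0 <= i <oo) bl (G i))%E).
    apply: measure_sigma_subadditive => //.
    by move=> i; have [] := hFG i.
  by rewrite eseries0// => i _ _; have [] := hFG i.
- by move=> x Nx; rewrite mem_set.
- by move=> x Nx; rewrite memNset.
Qed.

Lemma measurable_affine_preimage a b (N : set T) :
  measurable N -> measurable (affine a b @^-1` N).
Proof.
move=> mN; rewrite -[X in measurable X]setTI.
suff h : measurable_fun setT (affine a b) by exact: (h measurableT N mN).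
by apply: measurable_affine; [exact: measurable_cst|exact: measurable_id].
Qed.

Lemma null_affine a b (N : set T) : a != 0 -> measurable N -> bl N = 0%E ->
  bl (affine a b @^-1` N) = 0%E.
Proof.
move=> a0 mN N0.
have mA : measurable (affine a b @^-1` N).
  exact: measurable_affine_preimage.
have mI : measurable_fun setT (fun x : T => (\1_N x)%:E : \bar R).
  by apply/measurable_EFinP; exact: measurable_indic.
have I0 x : (0 <= (\1_N x)%:E :> \bar R)%E by rewrite lee_fin.
have := integral_affine b a0 mI I0.
have -> : (\int[bl]_x (\1_N x)%:E = 0)%E by rewrite integral_indic// setIT.
have -> : (\int[bl]_x (\1_N (affine a b x))%:E = bl (affine a b @^-1` N))%E.
  by rewrite -(setIT (affine a b @^-1` N)) -integral_indic.
move=> /esym/eqP; rewrite mule_eq0 => /orP[|/eqP//].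
by rewrite eqe expf_eq0 normr_eq0 (negbTE a0) andbF.
Qed.

(** Substituting x + y or x - y in a property that holds almost everywhere is
    legitimate for every fixed x, not only for almost every x. *)
Lemma ae_affine a b (P : Rn R n -> Prop) : a != 0 ->
  {ae mu, forall x, P x} -> {ae mu, forall x, P (affine a b x)}.
Proof.
move=> a0 [B [mB B0 PB]].
have [F [mF BF F0]] := null_borel_hull B0.
exists (affine a b @^-1` F : set (Rn R n)).
have mA : measurable (affine a b @^-1` F).
  exact: measurable_affine_preimage.
split; first exact: borel_measurable.
- by rewrite lebesgue_borel// null_affine.
- by move=> x nP; apply: BF; exact: PB.
Qed.

End transfer.

(** * Inequalities for powers, and geometric sums *)

Section elementary.
Context {R : realType}.
Implicit Types (x y h l a b t k rho : R).

(** The first term dominates when h <= l, the second when h > l.  It serves as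
    the tangent line of the concave power at l, with cruder constants, and turns
    a bound for an integral into a bound for the integral of a t-th power. *)
Lemma powR_le_affine l h t : 0 < l -> 0 <= h -> t <= 1 -> 0 < t ->
  h `^ t <= l `^ t + l `^ (t - 1) * h.
Proof.
move=> l0 h0 t1 t0; have [hl|lh] := leP h l.
  apply: (@le_trans _ _ (l `^ t)); first by apply: ge0_ler_powR; rewrite ?nnegrE// ltW.
  by rewrite lerDl mulr_ge0// powR_ge0.
apply: (@le_trans _ _ (l `^ (t - 1) * h)); last by rewrite lerDr powR_ge0.
have hp : 0 < h by exact: lt_trans lh.
rewrite -(mulr_powRB1 h0 t0) mulrC ler_wpM2r//.
rewrite -opprB !powRN lef_pV2 ?posrE ?powR_gt0//.
by apply: ge0_ler_powR; rewrite ?nnegrE ?subr_ge0// ltW.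
Qed.

(** Same dichotomy for exponents at least 1: this replaces Hölder's inequality,
    with l free to be optimized. *)
Lemma le_affine_powR l h k : 0 < l -> 0 <= h -> 1 <= k ->
  h <= l + l `^ (1 - k) * h `^ k.
Proof.
move=> l0 h0 k1; have [hl|lh] := leP h l.
  by rewrite (le_trans hl)// lerDl mulr_ge0// powR_ge0.
apply: (@le_trans _ _ (l `^ (1 - k) * h `^ k)); last by rewrite lerDr ltW.
have hp : 0 < h by exact: lt_trans lh.
rewrite -(mulr_powRB1 h0 (lt_le_trans ltr01 k1)) -opprB powRN mulrCA ler_peMr//.
rewrite ler_pdivlMl ?powR_gt0// mulr1.
by apply: ge0_ler_powR; rewrite ?nnegrE ?subr_ge0// ltW.
Qed.

(** A weighted arithmetic-geometric inequality, up to the weights: both factors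
    are bounded by the larger of x and y. *)
Lemma powR_geomean x y a b : 0 <= x -> 0 <= y -> 0 <= a -> 0 <= b -> a + b = 1 ->
  x `^ a * y `^ b <= x + y.
Proof.
(* x^a y^b <= y^a y^b = y when x <= y. *)
wlog xy : x y a b / x <= y.
  move=> H x0 y0 a0 b0 ab; have [xy|/ltW yx] := leP x y; first exact: H.
  by rewrite mulrC addrC; apply: H => //; rewrite addrC.
move=> x0 y0 a0 b0 ab; apply: (@le_trans _ _ (y `^ a * y `^ b)).
  by rewrite ler_wpM2r ?powR_ge0//; apply: ge0_ler_powR.
have [->|yn0] := eqVneq y 0.
  have [a00|an0] := eqVneq a 0.
    have -> : b = 1 by rewrite -ab a00 add0r.
    by rewrite powRr1// mulr0 addr0.
  by rewrite powR0// mul0r addr0.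
rewrite -powRD ?yn0 ?implybT// ab powRr1//; lra.
Qed.

Lemma powR_sub_add x y t : 0 <= x -> 0 <= y -> 0 < t -> t <= 1 ->
  (x + y) `^ t <= x `^ t + y `^ t.
Proof.
move=> x0 y0 t0 t1; have [s0|] := eqVneq (x + y) 0.
  by rewrite s0 powR0 ?gt_eqF// addr_ge0// powR_ge0.
move=> sn0; have sp : 0 < x + y by rewrite lt_neqAle eq_sym sn0 addr_ge0.
(* Since t - 1 <= 0, each of x and y times (x + y)^(t - 1) is at most its t-th
   power. *)
have key z : 0 <= z -> z <= x + y -> z * (x + y) `^ (t - 1) <= z `^ t.
  move=> z0 zs; have [->|zn0] := eqVneq z 0; first by rewrite mul0r powR_ge0.
  have zp : 0 < z by rewrite lt_neqAle eq_sym zn0.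
  rewrite -(mulr_powRB1 z0 t0) ler_wpM2l// -opprB !powRN lef_pV2 ?posrE ?powR_gt0//.
  by apply: ge0_ler_powR; rewrite ?nnegrE ?subr_ge0// ltW.
rewrite -{1}(mulr_powRB1 (ltW sp) t0) mulrDl lerD// key//; lra.
Qed.

Lemma gt1_powR rho a : 1 < rho -> 0 < a -> 1 < rho `^ a.
Proof.
move=> r1 a0; have -> : 1 = 1 `^ a :> R by rewrite powR1.
by apply: gt0_ltr_powR; rewrite ?nnegrE// ltW// (lt_trans _ r1).
Qed.

Lemma geometric_sum_le (z : R) N : 0 <= z -> z < 1 ->
  \sum_(m < N) z ^+ m <= (1 - z)^-1.
Proof.
move=> z0 z1; have zp : 0 < 1 - z by rewrite subr_gt0.
elim: N => [|N IH]; first by rewrite big_ord0 invr_ge0 ltW.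
rewrite big_ord_recl expr0; under eq_bigr do rewrite lift0 exprS.
rewrite -mulr_sumr; apply: (@le_trans _ _ (1 + z * (1 - z)^-1)).
  by rewrite lerD2l ler_wpM2l.
by rewrite le_eqVlt; apply/orP; left; apply/eqP; field; rewrite gt_eqF.
Qed.

Lemma powR_geometric c rho a m : 0 < c -> 0 < rho ->
  (c * rho ^+ m) `^ a = c `^ a * (rho `^ a) ^+ m.
Proof.
move=> c0 r0; rewrite powRM ?exprn_ge0 ?ltW//; congr (_ * _).
by rewrite -(powR_mulrn m (ltW r0)) -(powR_mulrn m (powR_ge0 _ _)) -!powRrM mulrC.
Qed.

(** The terms vanish until c rho^m reaches x, so the first one that counts is at
    most x^(-a), and it dominates the geometric series. *)
Lemma geometric_tail_sum c rho a x N : 0 < c -> 1 < rho -> 0 < a -> 0 < x ->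
  \sum_(m < N) (x <= c * rho ^+ m)%R%:R * (c * rho ^+ m) `^ (- a)
    <= (1 - rho `^ (- a))^-1 * x `^ (- a).
Proof.
move=> c0 r1 a0 x0.
have r0 : 0 < rho by exact: lt_trans r1.
have q1 : rho `^ (- a) < 1 by rewrite powRN invf_lt1 ?powR_gt0// gt1_powR.
elim: N c c0 => [|N IH] c c0.
  by rewrite big_ord0 mulr_ge0 ?powR_ge0// invr_ge0 ltW// subr_gt0.
have [xc|cx] := leP x c; last first.
  rewrite big_ord_recl expr0 mulr1 (leNgt x c) cx mul0r add0r.
  apply: le_trans (IH (c * rho) _); last exact: mulr_gt0.
  by apply: ler_sum => i _; rewrite lift0 exprS mulrA.
apply: (@le_trans _ _ ((1 - rho `^ (- a))^-1 * c `^ (- a))); last first.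
  rewrite ler_wpM2l ?invr_ge0 ?subr_ge0 ?(ltW q1)// !powRN lef_pV2 ?posrE ?powR_gt0//.
  by apply: ge0_ler_powR; rewrite ?nnegrE// ltW.
apply: (@le_trans _ _ (\sum_(m < N.+1) c `^ (-a) * (rho `^ (- a)) ^+ m)).
  apply: ler_sum => i _; rewrite powR_geometric//.
  by case: (x <= _); rewrite ?mul1r// mul0r mulr_ge0 ?exprn_ge0 ?powR_ge0.
by rewrite -mulr_sumr mulrC ler_wpM2r ?powR_ge0// geometric_sum_le ?powR_ge0.
Qed.

(** The terms grow geometrically until c rho^m reaches x, and the last one is at
    most x^b. *)
Lemma geometric_head_sum c rho b x N : 0 < c -> 1 < rho -> 0 < b -> 0 < x ->
  \sum_(m < N) (c * rho ^+ m < x)%R%:R * (c * rho ^+ m) `^ b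
    <= (1 - rho `^ (- b))^-1 * x `^ b.
Proof.
move=> c0 r1 b0 x0.
have r0 : 0 < rho by exact: lt_trans r1.
have q1 : 1 < rho `^ b by exact: gt1_powR.
have qp : 0 < rho `^ b - 1 by rewrite subr_gt0.
(* Without the cut at x the partial sums are at most a multiple of the last
   term; it is applied to the largest index that the cut allows. *)
pose S M := \sum_(m < M) (c * rho ^+ m < x)%R%:R * (c * rho ^+ m) `^ b.
have S1 M : S M <= (rho `^ b - 1)^-1 * (c `^ b * (rho `^ b) ^+ M).
  elim: M => [|M IH]; rewrite /S.
    by rewrite big_ord0 mulr_ge0 ?mulr_ge0 ?exprn_ge0 ?powR_ge0// invr_ge0 ltW.
  rewrite big_ord_recr/= powR_geometric//.
  apply: (@le_trans _ _ ((rho `^ b - 1)^-1 * (c `^ b * (rho `^ b) ^+ M) +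
      c `^ b * (rho `^ b) ^+ M)).
    apply: lerD => //; case: (_ < _); rewrite ?mul1r// mul0r.
    by rewrite mulr_ge0 ?exprn_ge0 ?powR_ge0.
  rewrite exprS le_eqVlt; apply/orP; left; apply/eqP; field.
  by rewrite gt_eqF.
have -> : (1 - rho `^ (- b))^-1 = rho `^ b * (rho `^ b - 1)^-1.
  by rewrite powRN; field; rewrite !gt_eqF ?powR_gt0//; apply: lt_trans q1.
rewrite -/(S N); elim: N => [|N IH].
  rewrite /S big_ord0 mulr_ge0 ?powR_ge0// mulr_ge0 ?powR_ge0// invr_ge0.
  exact: ltW.
rewrite /S big_ord_recr/= -/(S N); have [cx|_] := ltP; last by rewrite mul0r addr0.
apply: (@le_trans _ _ ((rho `^ b - 1)^-1 * (c * rho ^+ N) `^ b + (c * rho ^+ N) `^ b)).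
  by rewrite mul1r lerD2r powR_geometric.
apply: (@le_trans _ _ (rho `^ b * (rho `^ b - 1)^-1 * (c * rho ^+ N) `^ b)).
  rewrite le_eqVlt; apply/orP; left; apply/eqP; field.
  by rewrite gt_eqF.
rewrite ler_wpM2l ?mulr_ge0 ?powR_ge0 ?invr_ge0 ?(ltW qp)//.
by apply: ge0_ler_powR; rewrite ?nnegrE ?mulr_ge0 ?exprn_ge0 ?ltW.
Qed.

Local Open Scope ereal_scope.

Lemma nneseries_le_bound (u : nat -> \bar R) (B : \bar R) : (forall m, 0 <= u m) ->
  (forall N, \sum_(m < N) u m <= B) -> \sum_(0 <= m <oo) u m <= B.
Proof.
move=> u0 uB; apply: lime_le; first by apply: is_cvg_nneseries => *.
by apply: nearW => N; rewrite big_mkord.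
Qed.

Lemma poweR_sub_add (x y : \bar R) (t : R) : 0 <= x -> 0 <= y -> (0 < t)%R -> (t <= 1)%R ->
  (x + y) `^ t <= x `^ t + y `^ t.
Proof.
move=> x0 y0 t0 t1; have tn0 : t != 0%R by rewrite gt_eqF.
have nNy (z : \bar R) : 0 <= z -> z != -oo by case: z.
case: x x0 => [x| |]// x0; last first.
  rewrite (poweRyr tn0) [leRHS]addye ?leey//; apply: nNy; exact: poweR_ge0.
case: y y0 => [y| |]// y0; last first.
  rewrite (poweRyr tn0) [leRHS]addey ?leey//; apply: nNy; exact: poweR_ge0.
by rewrite -EFinD !poweR_EFin -EFinD lee_fin powR_sub_add.
Qed.

(** Subadditivity of the concave power for finite sums, passed to the limit. *)
Lemma poweR_nneseries_le (u : nat -> \bar R) (t : R) : (forall m, 0 <= u m) ->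
  (0 < t)%R -> (t <= 1)%R ->
  (\sum_(0 <= m <oo) u m) `^ t <= \sum_(0 <= m <oo) (u m `^ t).
Proof.
move=> u0 t0 t1; set U := \sum_(0 <= m <oo) (_ `^ _).
have tn0 : t != 0%R by rewrite gt_eqF.
have ut0 m : 0 <= u m `^ t by exact: poweR_ge0.
have U0 : 0 <= U by apply: nneseries_ge0 => *.
have fin N : (\sum_(m < N) u m) `^ t <= \sum_(m < N) (u m `^ t).
  elim: N => [|N IH]; first by rewrite !big_ord0 poweR0r.
  rewrite !big_ord_recr/= (le_trans (poweR_sub_add _ _ t0 t1))//; first exact: sume_ge0.
  by rewrite leeD2r.
have UN N : \sum_(m < N) (u m `^ t) <= U.
  by rewrite -(big_mkord xpredT (fun m => u m `^ t)); apply: nneseries_lim_ge => *.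
have tK (x : \bar R) : 0 <= x -> (x `^ t) `^ t^-1 = x.
  by move=> x0; rewrite -poweRrM mulfV// poweRe1.
have tK' (x : \bar R) : 0 <= x -> (x `^ t^-1) `^ t = x.
  by move=> x0; rewrite -poweRrM mulVf// poweRe1.
(* After taking the power 1/t it is enough to bound the partial sums of u. *)
rewrite -(tK' U U0); apply: gt0_ler_poweR; rewrite ?in_itv/= ?leey ?andbT ?poweR_ge0 ?(ltW t0)//.
  by apply: nneseries_ge0 => *.
apply: nneseries_le_bound => // N; rewrite -[leLHS]tK ?sume_ge0//.
apply: gt0_ler_poweR; rewrite ?in_itv/= ?leey ?andbT ?poweR_ge0 ?invr_ge0 ?(ltW t0)//.
exact: le_trans (fin N) (UN N).
Qed.

Lemma measurable_poweR_comp d (X : measurableType d) (D : set X) (f : X -> \bar R) b :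
  measurable_fun D f -> measurable_fun D (fun x : X => f x `^ b).
Proof.
move=> mf; apply: (@measurableT_comp _ _ _ _ _ _ (fun x : \bar R => x `^ b)) => //.
exact: measurable_poweR.
Qed.

Lemma measurable_powR_comp d (X : measurableType d) (D : set X) (f : X -> R) b :
  measurable_fun D f -> measurable_fun D (fun x : X => f x `^ b)%R.
Proof. by move=> mf; apply: (@measurableT_comp _ _ _ _ _ _ (fun x : R => x `^ b)%R). Qed.

End elementary.

Section jensen.
Context d (X : measurableType d) (R : realType) (mu : {measure set X -> \bar R}).
Variables (E : set X) (mE : measurable E) (V : R) (EV : (mu E <= V%:E)%E).
Local Open Scope ereal_scope.

(** Jensen's inequality for the concave power, with the constant 2: integrate
    [powR_le_affine] taken at the level l.  At l = 0 the function vanishes almost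
    everywhere. *)
Lemma concave_integral_le (h : X -> \bar R) (l t : R) :
  measurable_fun E h -> (forall x, 0 <= h x) ->
  (0 <= l)%R -> (0 < t)%R -> (t <= 1)%R ->
  \int[mu]_(x in E) h x <= (l * V)%:E ->
  \int[mu]_(x in E) (h x `^ t) <= (2 * l `^ t * V)%:E.
Proof.
move=> mh h0 l0 t0 t1 hlV.
have tn0 : t != 0%R by rewrite gt_eqF.
have V0 : (0 <= V)%R by rewrite -lee_fin (le_trans _ EV).
have mht : measurable_fun E (fun x => h x `^ t) by exact: measurable_poweR_comp.
have [l00|ln0] := eqVneq l 0%R.
  rewrite l00 mul0r in hlV.
  have : ae_eq mu E h (cst 0).
    apply/(ae_eq_integral_abs mu mE mh)/eqP; rewrite eq_le integral_ge0// andbT.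
    by under eq_integral do rewrite gee0_abs//.
  move=> h00; rewrite (ae_eq_integral (cst 0))//.
    by rewrite integral0 lee_fin mulr_ge0// mulr_ge0 ?powR_ge0.
  by move: h00; apply: filterS => x hx Ex; rewrite hx// poweR0r.
have lp : (0 < l)%R by rewrite lt_neqAle eq_sym ln0.
apply: (@le_trans _ _ (\int[mu]_(x in E) ((l `^ t)%:E + (l `^ (t - 1))%:E * h x))).
  apply: ge0_le_integral => //.
  - by move=> x _; exact: poweR_ge0.
  - by apply: emeasurable_funD => //; apply: measurable_funeM.
  - move=> x _; have := h0 x; case: (h x) => [y| |] // y0.
      by rewrite poweR_EFin -EFinM -EFinD lee_fin powR_le_affine.
    by rewrite poweRyr// gt0_muley ?lte_fin ?powR_gt0// addey// leey.
rewrite ge0_integralD//; last 3 first.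
- by move=> x _; rewrite lee_fin powR_ge0.
- by move=> x _; rewrite mule_ge0 ?lee_fin ?powR_ge0.
- by apply: measurable_funeM.
rewrite integral_cst// ge0_integralZl_EFin ?powR_ge0//.
apply: (@le_trans _ _ ((l `^ t)%:E * V%:E + (l `^ (t - 1))%:E * (l * V)%:E)).
  by apply: leeD; rewrite lee_pmul2l ?lte_fin ?powR_gt0//.
rewrite -!EFinM -EFinD lee_fin -(mulr_powRB1 (ltW lp) t0) le_eqVlt; apply/orP; left; apply/eqP.
ring.
Qed.

Lemma integral_le_powR (f : X -> R) (l k : R) :
  measurable_fun E f -> (forall x, 0 <= f x)%R ->
  (0 < l)%R -> (1 <= k)%R ->
  \int[mu]_(x in E) (f x)%:E <=
    (l * V)%:E + (l `^ (1 - k))%:E * \int[mu]_(x in E) (f x `^ k)%:E.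
Proof.
move=> mf f0 l0 k1.
have mfk : measurable_fun E (fun x => (f x `^ k)%:E).
  by apply/measurable_EFinP; exact: measurable_powR_comp.
apply: (@le_trans _ _ (\int[mu]_(x in E) (l%:E + (l `^ (1 - k))%:E * (f x `^ k)%:E))).
  apply: ge0_le_integral => //.
  - by move=> x _; rewrite lee_fin.
  - exact/measurable_EFinP.
  - by apply: emeasurable_funD => //; apply: measurable_funeM.
  - by move=> x _; rewrite -EFinM -EFinD lee_fin le_affine_powR.
rewrite ge0_integralD//; last 3 first.
- by move=> x _; rewrite lee_fin ltW.
- by move=> x _; rewrite mule_ge0 ?lee_fin ?powR_ge0.
- by apply: measurable_funeM.
rewrite integral_cst// ge0_integralZl_EFin ?powR_ge0//; last first.
  by move=> x _; rewrite lee_fin powR_ge0.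
by rewrite leeD2r// EFinM lee_pmul2l.
Qed.

End jensen.

(** * Integrals over boxes *)

Section boxes.
Context {R : realType} (n : nat).
Local Notation mR := (measurableTypeR R).
Local Notation T := (n.-tuple mR).
Local Notation bl := (borel_lebesgue R n).
Implicit Types (f : T -> \bar R) (r l : R).
Local Open Scope ereal_scope.

Definition box (r : R) : set T := [set u | forall i, (`|tnth u i| < r)%R].

Lemma box_itv (r : R) : box r = [set u : T | forall i, (`](- r)%R, r[%classic : set mR) (tnth u i)].
Proof.
by apply/seteqP; split => u ur i; have := ur i; rewrite /= in_itv/= ltr_norml.
Qed.

Lemma measurable_box r : measurable (box r).
Proof.
rewrite box_itv; have [] := @borel_box R n (fun=> `](- r)%R, r[%classic) => //.
Qed.

Lemma borel_lebesgue_box r : (0 <= r)%R -> bl (box r) = ((2 * r) ^+ n)%:E.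
Proof.
move=> r0; rewrite box_itv.
have [|_ ->] := @borel_box R n (fun=> `](- r)%R, r[%classic); first by [].
have -> : lebesgue_measure (`](- r)%R, r[%classic : set mR) = (2 * r)%:E.
  rewrite lebesgue_measure_itv/= lte_fin; case: ltP => [rr|rr].
    by rewrite opprK -EFinD; congr (_%:E); ring.
  by have -> : r = 0%R; [lra|rewrite mulr0].
elim: n => [|k IH]; first by rewrite big_ord0 expr0.
by rewrite big_ord_recl IH -EFinM exprS.
Qed.

(** The point -x.  Together with [affine] it expresses every substitution that is
    made below, for instance 2 x - u is [affine 2 (neg u) x]. *)
Definition neg (x : T) : T := affine (-1) [tuple (0%R : mR) | i < n] x.

Lemma integral_shift (b : T) f : measurable_fun setT f -> (forall x, 0 <= f x) ->
  \int[bl]_x f x = \int[bl]_x f (affine 1 b x).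
Proof.
by move=> mf f0; rewrite (integral_affine b (oner_neq0 R) mf f0) normr1 expr1n mul1e.
Qed.

Lemma measurable_comp_affine d (X : measurableType d) a f (g h : X -> T) :
  measurable_fun setT f -> measurable_fun setT g -> measurable_fun setT h ->
  measurable_fun setT (fun x => f (affine a (g x) (h x))).
Proof.
by move=> mf mg mh; apply: (measurableT_comp mf); exact: measurable_affine.
Qed.

Lemma integral_swap (F : T * T -> \bar R) : measurable_fun setT F -> (forall z, 0 <= F z) ->
  \int[bl]_x \int[bl]_y F (x, y) = \int[bl]_y \int[bl]_x F (x, y).
Proof. by move=> mF F0; rewrite fubini_tonelli. Qed.

Lemma measurable_integral2 (F : T * T -> \bar R) : measurable_fun setT F -> (forall z, 0 <= F z) ->
  measurable_fun setT (fun x => \int[bl]_y F (x, y)).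
Proof. by move=> mF F0; exact: measurable_fun_fubini_tonelli_F. Qed.

Lemma measurable_neg : measurable_fun setT neg.
Proof.
apply: measurable_affine; [exact: measurable_cst|exact: measurable_id].
Qed.

(** In the inner integral put y - e for y, then exchange the integrals: e - y
    becomes 2 e - y, and the integral of h2 over e gains a factor 2^-n, which is
    bounded by 1. *)
Lemma convolution_product_le (h1 h2 : T -> \bar R) :
  measurable_fun setT h1 -> (forall x, 0 <= h1 x) ->
  measurable_fun setT h2 -> (forall x, 0 <= h2 x) ->
  \int[bl]_e \int[bl]_y (h1 (affine 1 e y) * h2 (affine (-1) e y)) <=
  (\int[bl]_x h1 x) * \int[bl]_x h2 x.
Proof.
move=> mh1 h10 mh2 h20.
apply: (@le_trans _ _ (\int[bl]_e \int[bl]_y (h1 y * h2 (affine 2 (neg y) e)))).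
  rewrite le_eqVlt; apply/orP; left; apply/eqP.
  apply: eq_integral => e _.
  rewrite (integral_shift (neg e)).
  - apply: eq_integral => y _; congr (h1 _ * h2 _); apply: eq_from_tnth => i;
    rewrite !tnth_mktuple; ring.
  - by apply: emeasurable_funM; apply: measurable_comp_affine => //; exact: measurable_cst.
  - by move=> y; exact: mule_ge0.
rewrite (integral_swap (F := fun z => h1 z.2 * h2 (affine 2 (neg z.2) z.1))); last 2 first.
- apply: emeasurable_funM; first exact: measurableT_comp mh1 measurable_snd.
  apply: measurable_comp_affine => //.
  exact: measurableT_comp measurable_neg measurable_snd.
- by move=> z; exact: mule_ge0.
apply: (@le_trans _ _ (\int[bl]_y (h1 y * (\int[bl]_x h2 x)))).
  apply: ge0_le_integral => //.
  - by move=> y _; apply: integral_ge0 => e _; exact: mule_ge0.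
  - apply: (@measurable_integral2 (fun z => h1 z.1 * h2 (affine 2 (neg z.1) z.2))).
      apply: emeasurable_funM; first exact: measurableT_comp mh1 measurable_fst.
      apply: measurable_comp_affine => //.
      exact: measurableT_comp measurable_neg measurable_fst.
    by move=> z; exact: mule_ge0.
  - by apply: emeasurable_funM => //; exact: measurable_cst.
  - move=> y _ /=; rewrite ge0_integralZl//; last first.
      by apply: measurable_comp_affine => //; exact: measurable_cst.
    apply: lee_wpmul2l => //.
    rewrite (integral_affine (neg y) (_ : 2 != 0)%R mh2 h20) ?pnatr_eq0//.
    rewrite -[leLHS]mul1e lee_wpmul2r ?integral_ge0// lee_fin normr_nat.
    by rewrite exprn_ege1// ler1n.
rewrite ge0_integralZr// integral_ge0//.
Qed.

Definition box_integral r f z := \int[bl]_u ((\1_(box r) u)%:E * f (affine 1 z u)).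

Lemma measurable_box_indic r : measurable_fun setT (fun u : T => (\1_(box r) u)%:E : \bar R).
Proof. by apply/measurable_EFinP; apply: measurable_indic; exact: measurable_box. Qed.

Lemma box_indic_ge0 r u : 0 <= (\1_(box r) u)%:E :> \bar R.
Proof. by rewrite lee_fin. Qed.

Lemma measurable_box_integral r f : measurable_fun setT f -> (forall x, 0 <= f x) ->
  measurable_fun setT (box_integral r f).
Proof.
move=> mf f0; apply: (@measurable_integral2 (fun z => (\1_(box r) z.2)%:E * f (affine 1 z.1 z.2))).
  apply: emeasurable_funM; first exact: measurableT_comp (measurable_box_indic r) measurable_snd.
  by apply: measurable_comp_affine.
by move=> z; rewrite mule_ge0// box_indic_ge0.
Qed.

Lemma box_integral_ge0 r f z : (forall x, 0 <= f x) -> 0 <= box_integral r f z.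
Proof. by move=> f0; apply: integral_ge0 => u _; rewrite mule_ge0// box_indic_ge0. Qed.

(** Integrating the integral of f over z + B(r) counts each point with the volume
    of B(r). *)
Lemma integral_box_integral r f : (0 <= r)%R -> measurable_fun setT f -> (forall x, 0 <= f x) ->
  \int[bl]_z box_integral r f z = ((2 * r) ^+ n)%:E * \int[bl]_x f x.
Proof.
move=> r0 mf f0.
rewrite (integral_swap (F := fun z => (\1_(box r) z.2)%:E * f (affine 1 z.1 z.2))); last 2 first.
- apply: emeasurable_funM; first exact: measurableT_comp (measurable_box_indic r) measurable_snd.
  by apply: measurable_comp_affine.
- by move=> z; rewrite mule_ge0// box_indic_ge0.
transitivity (\int[bl]_u ((\1_(box r) u)%:E * \int[bl]_x f x)).
  apply: eq_integral => u _ /=.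
  rewrite ge0_integralZl ?box_indic_ge0//; last first.
    by apply: measurable_comp_affine => //; exact: measurable_cst.
  congr (_ * _); rewrite [RHS](integral_shift u)//.
  apply: eq_integral => z _; congr f; apply: eq_from_tnth => i.
  by rewrite !tnth_mktuple; ring.
rewrite ge0_integralZr//; [|exact: measurable_box_indic|by rewrite integral_ge0].
rewrite integral_indic//; last exact: measurable_box.
by congr (_ * _); rewrite setIT; exact: borel_lebesgue_box.
Qed.

End boxes.

(** * Bilinear integrals at one scale *)

Section bilinear.
Context {R : realType} (n : nat).
Local Notation mR := (measurableTypeR R).
Local Notation T := (n.-tuple mR).
Local Notation bl := (borel_lebesgue R n).
Implicit Types (f : T -> \bar R) (r l : R).
Local Open Scope ereal_scope.

Lemma integral_indicM d (X : measurableType d) (mu : {measure set X -> \bar R})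
    (D : set X) (f : X -> \bar R) :
  \int[mu]_(x in D) f x = \int[mu]_x ((\1_D x)%:E * f x).
Proof.
rewrite integral_mkcond epatch_indic.
by apply: eq_integral => x _; rewrite /= muleC.
Qed.

Lemma indic_in (X : Type) (D : set X) (x : X) : D x -> (\1_D x)%:E = 1 :> \bar R.
Proof. by move=> Dx; rewrite indicE mem_set. Qed.

Lemma indic_notin (X : Type) (D : set X) (x : X) : ~ D x -> (\1_D x)%:E = 0 :> \bar R.
Proof. by move=> Dx; rewrite indicE memNset. Qed.

Lemma indic_le1 (X : Type) (D : set X) (x : X) : (\1_D x)%:E <= 1 :> \bar R.
Proof. by rewrite lee_fin indicE; case: (_ \in _). Qed.

Definition cbox (c : T) (l : R) : set T :=
  [set x | forall i, (`|tnth x i - tnth c i : R| < l)%R].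

Lemma cboxE c l : cbox c l = affine 1 (neg c) @^-1` box l.
Proof.
apply/seteqP; split => x /= h i; have := h i; rewrite !tnth_mktuple.
- by rewrite mul1r mulN1r addr0.
- by rewrite mul1r mulN1r addr0.
Qed.

Lemma measurable_cbox c l : measurable (cbox c l).
Proof. by rewrite cboxE; apply: measurable_affine_preimage; exact: measurable_box. Qed.

Definition bilinear_average r (f1 f2 : T -> \bar R) (x : T) :=
  \int[bl]_y ((\1_(box r) y)%:E * (f1 (affine 1 x y) * f2 (affine (-1) x y))).

Section fixed_functions.
Variables (f1 f2 : T -> \bar R).
Hypotheses (mf1 : measurable_fun setT f1) (f10 : forall x, 0 <= f1 x).
Hypotheses (mf2 : measurable_fun setT f2) (f20 : forall x, 0 <= f2 x).

Let measurable_integrand r : measurable_fun setT (fun z : T * T =>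
  (\1_(box r) z.2)%:E * (f1 (affine 1 z.1 z.2) * f2 (affine (-1) z.1 z.2))).
Proof.
apply: emeasurable_funM; first exact: measurableT_comp (measurable_box_indic r) measurable_snd.
by apply: emeasurable_funM; apply: measurable_comp_affine.
Qed.

Let integrand_ge0 r (z : T * T) :
  0 <= (\1_(box r) z.2)%:E * (f1 (affine 1 z.1 z.2) * f2 (affine (-1) z.1 z.2)).
Proof. by rewrite mule_ge0 ?box_indic_ge0// mule_ge0. Qed.

Lemma measurable_bilinear_average r : measurable_fun setT (bilinear_average r f1 f2).
Proof. exact: (measurable_integral2 (measurable_integrand r) (integrand_ge0 r)). Qed.

Lemma bilinear_average_ge0 r x : 0 <= bilinear_average r f1 f2 x.
Proof. by apply: integral_ge0 => y _; exact: (integrand_ge0 r (x, y)). Qed.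

(** If e and y are in B(r), both e + y and e - y are in B(2r): up to this
    enlargement, the left-hand side is the double integral of a product that
    [convolution_product_le] decouples. *)
Lemma average_bilinear_average r z : (0 <= r)%R ->
  \int[bl]_e ((\1_(box r) e)%:E * bilinear_average r f1 f2 (affine 1 z e)) <=
  box_integral (2 * r) f1 z * box_integral (2 * r) f2 z.
Proof.
move=> r0; pose h f u := (\1_(box (2 * r) : set T) u)%:E * f (affine 1 z u).
have mh f : measurable_fun setT f -> measurable_fun setT (h f).
  move=> mf; apply: emeasurable_funM; first exact: measurable_box_indic.
  by apply: measurable_comp_affine => //; exact: measurable_cst.
have h0 f : (forall x, 0 <= f x) -> forall u, 0 <= h f u.
  by move=> f0 u; rewrite mule_ge0// box_indic_ge0.
apply: le_trans (convolution_product_le (mh _ mf1) (h0 _ f10) (mh _ mf2) (h0 _ f20)).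
apply: ge0_le_integral => //.
- by move=> e _; rewrite mule_ge0 ?box_indic_ge0// bilinear_average_ge0.
- apply: emeasurable_funM; first exact: measurable_box_indic.
  apply: measurable_comp_affine => //;
    first [exact: measurable_bilinear_average|exact: measurable_cst].
- apply: (@measurable_integral2 _ _
    (fun z => h f1 (affine 1 z.1 z.2) * h f2 (affine (-1) z.1 z.2))).
    by apply: emeasurable_funM; apply: measurable_comp_affine => //; exact: mh.
  by move=> u; rewrite mule_ge0 ?h0.
move=> e _; have [er|ne] := pselect (box r e); last first.
  by rewrite (indic_notin ne) mul0e integral_ge0// => y _; rewrite mule_ge0 ?h0.
rewrite (indic_in er) mul1e; apply: ge0_le_integral => //.
- by move=> y _; exact: (integrand_ge0 r (affine 1 z e, y)).
- exact: (measurableT_comp (measurable_integrand r) (measurable_pair1 (affine 1 z e))).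
- by apply: emeasurable_funM; apply: measurable_comp_affine => //;
    (exact: mh || exact: measurable_cst).
move=> y _; have [yr|ny] := pselect (box r y); last first.
  by rewrite (indic_notin ny) mul0e mule_ge0 ?h0.
rewrite (indic_in yr) mul1e.
have yi i : (`|(1 * tnth y i + tnth e i)%R : R| < 2 * r)%R.
  by rewrite mul1r mulrDl !mul1r (le_lt_trans (ler_normD _ _))// ltrD.
have yi' i : (`|(- 1 * tnth y i + tnth e i)%R : R| < 2 * r)%R.
  by rewrite mulN1r mulrDl !mul1r (le_lt_trans (ler_normD _ _))// ltrD ?normrN.
rewrite /h !indic_in; [|by move=> i; rewrite tnth_mktuple..].
rewrite !mul1e le_eqVlt; apply/orP; left; apply/eqP.
by congr (f1 _ * f2 _); apply: eq_from_tnth => i; rewrite !tnth_mktuple; ring.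
Qed.

(** Averaging the t-th power of D_r over z + B(r) reproduces its integral,
    because r <= l keeps all centers z that matter within distance 2 l of c.  On
    each box concavity moves the power outside of the integral, and there
    [average_bilinear_average] gives the level. *)
Lemma integral_bilinear_average_powR (r l t : R) (c : T) (E : set T) (lam : T -> R) :
  (0 < r)%R -> (r <= l)%R -> (0 < t)%R -> (t <= 1)%R ->
  measurable E -> E `<=` cbox c l ->
  measurable_fun setT lam -> (forall z, 0 <= lam z)%R ->
  (forall z, cbox c (2 * l) z ->
    box_integral (2 * r) f1 z * box_integral (2 * r) f2 z <= (lam z * (2 * r) ^+ n)%:E) ->
  \int[bl]_(x in E) (bilinear_average r f1 f2 x `^ t) <=
  2%:E * \int[bl]_(z in cbox c (2 * l)) (lam z `^ t)%:E.
Proof.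
move=> r0 rl t0 t1 mE Ec mlam lam0 hlam.
have V0 : (0 < (2 * r) ^+ n)%R by rewrite exprn_gt0// mulr_gt0.
have mBt : measurable_fun setT (fun x => bilinear_average r f1 f2 x `^ t).
  by apply: measurable_poweR_comp; exact: measurable_bilinear_average.
have mlt : measurable_fun setT (fun z => (lam z `^ t)%:E).
  by apply/measurable_EFinP; exact: measurable_powR_comp.
pose F x := (\1_E x)%:E * bilinear_average r f1 f2 x `^ t.
have mF : measurable_fun setT F.
  by apply: emeasurable_funM => //; apply/measurable_EFinP; exact: measurable_indic.
have F0 x : 0 <= F x by rewrite mule_ge0 ?lee_fin ?poweR_ge0.
rewrite integral_indicM -(@lee_pmul2l _ ((2 * r) ^+ n)%:E) ?lte_fin//.
rewrite -(integral_box_integral (ltW _) mF F0)//.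
rewrite (integral_indicM _ (cbox c (2 * l))).
have mI : measurable_fun setT (fun z : T => (\1_(cbox c (2 * l)) z)%:E * (lam z `^ t)%:E).
  apply: emeasurable_funM => //; apply/measurable_EFinP; apply: measurable_indic.
  exact: measurable_cbox.
have I0 z : 0 <= (\1_(cbox c (2 * l)) z)%:E * (lam z `^ t)%:E :> \bar R.
  by rewrite mule_ge0// lee_fin// powR_ge0.
rewrite -ge0_integralZl_EFin// -ge0_integralZl_EFin ?(ltW V0)//; last 2 first.
- by move=> z _; rewrite mule_ge0.
- by apply: measurable_funeM.
apply: ge0_le_integral => //.
- by move=> z _; apply: box_integral_ge0.
- by apply: measurable_box_integral.
- by apply: measurable_funeM; apply: measurable_funeM.
move=> z _; have [hz|hz] := pselect (cbox c (2 * l) z).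
- rewrite (indic_in hz) mul1e; 
  apply: (@le_trans _ _ (\int[bl]_(u in box r)
      (bilinear_average r f1 f2 (affine 1 z u) `^ t))).
    rewrite (integral_indicM _ (box r)); apply: ge0_le_integral => //.
    + by move=> u _; rewrite mule_ge0 ?box_indic_ge0.
    + apply: emeasurable_funM; first exact: measurable_box_indic.
      by apply: measurable_comp_affine => //; exact: measurable_cst.
    + apply: emeasurable_funM; first exact: measurable_box_indic.
      by apply: (measurable_comp_affine 1 mBt) => //; exact: measurable_cst.
    + move=> u _; apply: lee_wpmul2l; first exact: box_indic_ge0.
      by rewrite /F -[leRHS]mul1e lee_wpmul2r ?poweR_ge0// indic_le1.
  rewrite -!EFinM.
  have -> : ((2 * r) ^+ n * (2 * lam z `^ t) = 2 * lam z `^ t * (2 * r) ^+ n)%R by ring.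
  apply: (concave_integral_le (measurable_box r)) => //.
  + rewrite le_eqVlt; apply/orP; left; apply/eqP; exact: borel_lebesgue_box (ltW r0).
  + apply: measurable_funTS; apply: measurable_comp_affine => //;
    first [exact: measurable_bilinear_average|exact: measurable_cst].
  + by move=> u; exact: bilinear_average_ge0.
  + rewrite integral_indicM; apply: le_trans (hlam z hz).
    by apply: average_bilinear_average; exact: ltW.
- rewrite (indic_notin hz) mul0e !mule0 /box_integral integral0_eq// => u _.
  have [ur|nu] := pselect (box r u); last by rewrite (indic_notin nu) mul0e.
  have [/Ec zuc|nE] := pselect (E (affine 1 z u)); last first.
    by rewrite /F (indic_notin nE) mul0e mule0.
  exfalso; apply: hz => i.
  have := zuc i; rewrite tnth_mktuple mul1r => h1; have h2 := ur i.
  have -> : (tnth z i - tnth c i = (tnth u i + tnth z i - tnth c i) - tnth u i :> R)%R by ring.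
  rewrite mulrDl mul1r (le_lt_trans (ler_normB _ _))// ltrD//.
  exact: lt_le_trans h2 rl.
Qed.

End fixed_functions.

(** At scales below l, near c, only the values of f within distance 4 l of c
    matter; the Morrey condition then bounds the total mass of f^k that enters. *)
Lemma box_integral_local r l c z f : (0 <= r)%R -> (r <= l)%R -> cbox c (2 * l) z ->
  box_integral (2 * r) f z = box_integral (2 * r) (fun x => (\1_(cbox c (4 * l)) x)%:E * f x) z.
Proof.
move=> r0 rl zc; apply: eq_integral => u _.
have [ur|nu] := pselect (box (2 * r) u); last by rewrite !(indic_notin nu) !mul0e.
rewrite [X in _ * (X * _)]indic_in ?mul1e// => i.
rewrite tnth_mktuple mul1r.
have -> : (tnth u i + tnth z i - tnth c i = tnth u i + (tnth z i - tnth c i) :> R)%R by ring.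
rewrite (le_lt_trans (ler_normD _ _))//.
have := zc i; have := ur i; lra.
Qed.

End bilinear.

(** * Adams' argument for sums over scales *)

Section adams.
Context {R : realType} (n : nat).
Local Notation mR := (measurableTypeR R).
Local Notation T := (n.-tuple mR).
Local Notation bl := (borel_lebesgue R n).

(** The majorant in Adams' argument: if a mean is at most K th, its tau-th power
    is at most a multiple of the mean of x^tau where x is at most th, and of a
    linear function where x exceeds th. *)
Definition truncated_powR (K th tau : R) (x : R) : R :=
  if x <= th then x `^ tau else (K * th) `^ (tau - 1) * x.

Lemma truncated_powR_ge0 K th tau x : 0 <= x -> 0 <= truncated_powR K th tau x.
Proof. by move=> x0; rewrite /truncated_powR; case: ifP; rewrite ?mulr_ge0 ?powR_ge0. Qed.

Lemma measurable_truncated_powR K th tau (f : T -> R) : measurable_fun setT f ->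
  measurable_fun setT (fun x => truncated_powR K th tau (f x)).
Proof.
move=> mf; apply: measurable_fun_ifT.
- by apply: measurable_fun_ler => //; exact: measurable_cst.
- exact: measurable_powR_comp.
- by apply: measurable_funM => //; exact: measurable_cst.
Qed.

(** Below th this is [le_affine_powR]; above th, the condition l <= K th makes
    the last term at least x. *)
Lemma le_truncated_powR (K th tau l x : R) : 1 < tau -> 0 < l -> l <= K * th -> 0 <= x ->
  x <= l + l `^ (1 - tau) * truncated_powR K th tau x.
Proof.
move=> t1 l0 lK x0; rewrite /truncated_powR; case: ifP => [_|_].
  by apply: le_affine_powR => //; exact: ltW.
apply: (@le_trans _ _ (l `^ (1 - tau) * ((K * th) `^ (tau - 1) * x))); last by rewrite lerDr ltW.
rewrite mulrA ler_peMl// -opprB powRN ler_pdivlMl ?powR_gt0// mulr1.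
apply: ge0_ler_powR; rewrite ?nnegrE ?subr_ge0 ?(ltW t1) ?(ltW l0)//.
exact: le_trans (ltW l0) lK.
Qed.

(** For fixed x, the levels above x contribute x^tau times a decreasing geometric
    series that starts at about x^(k - tau), and the levels below x contribute x
    times an increasing one that ends at about x^(k - 1).  Both are multiples of
    x^k, because 1 < k < tau. *)
Lemma truncated_powR_sum (K c rho k tau x : R) N : 1 < rho -> 0 < K -> 1 < k -> k < tau ->
  0 < c -> 0 <= x ->
  \sum_(m < N) (c * rho ^+ m) `^ (k - tau) * truncated_powR K (c * rho ^+ m) tau x
  <= ((1 - rho `^ (- (tau - k)))^-1 + K `^ (tau - 1) * (1 - rho `^ (- (k - 1)))^-1) * x `^ k.
Proof.
move=> r1 K0 k1 kt c0 x0.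
have r0 : 0 < rho by exact: lt_trans r1.
have th0 m : 0 < c * rho ^+ m by rewrite mulr_gt0// exprn_gt0.
have [->|xn0] := eqVneq x 0.
  have kn0 : k != 0 by rewrite gt_eqF// (lt_trans ltr01).
  have tn0 : tau != 0 by rewrite gt_eqF// (lt_trans _ kt)// (lt_trans ltr01).
  by rewrite powR0// mulr0 big1// => m _; rewrite /truncated_powR ltW// powR0// mulr0.
have xp : 0 < x by rewrite lt_neqAle eq_sym xn0.
apply: (@le_trans _ _ (\sum_(m < N) (x `^ tau *
    ((x <= c * rho ^+ m)%R%:R * (c * rho ^+ m) `^ (- (tau - k))) +
    K `^ (tau - 1) * x * ((c * rho ^+ m < x)%R%:R * (c * rho ^+ m) `^ (k - 1))))).
  apply: ler_sum => m _; rewrite /truncated_powR opprB; have [xt|tx] := leP x (c * rho ^+ m).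
    by rewrite mul1r mul0r mulr0 addr0 mulrC.
  rewrite mul0r mulr0 add0r mul1r (powRM (tau - 1) (ltW K0) (ltW (th0 m))).
  have -> : k - 1 = (k - tau) + (tau - 1) by ring.
  rewrite (@powRD _ _ (k - tau) (tau - 1)) ?(gt_eqF (th0 m)) ?implybT//.
  by rewrite le_eqVlt; apply/orP; left; apply/eqP; ring.
rewrite big_split/= -!mulr_sumr mulrDl; apply: lerD.
  apply: (@le_trans _ _ (x `^ tau * ((1 - rho `^ (- (tau - k)))^-1 * x `^ (- (tau - k))))).
    by rewrite ler_wpM2l ?powR_ge0// geometric_tail_sum// subr_gt0.
  rewrite mulrCA ler_wpM2l//.
    rewrite invr_ge0 subr_ge0 ltW// powRN invf_lt1 ?powR_gt0// gt1_powR// subr_gt0//.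
  by rewrite -powRD ?xn0 ?implybT//; have -> : tau + - (tau - k) = k by ring.
apply: (@le_trans _ _ (K `^ (tau - 1) * x * ((1 - rho `^ (- (k - 1)))^-1 * x `^ (k - 1)))).
  rewrite ler_wpM2l ?geometric_head_sum ?subr_gt0// mulr_ge0 ?powR_ge0//.
rewrite -(mulr_powRB1 (ltW xp) (lt_trans ltr01 k1)).
by rewrite le_eqVlt; apply/orP; left; apply/eqP; ring.
Qed.

Local Open Scope ereal_scope.

Lemma box_integral_mono (f g : T -> \bar R) r z :
  measurable_fun setT f -> measurable_fun setT g -> (forall x, 0 <= f x) ->
  (forall x, f x <= g x) -> box_integral r f z <= box_integral r g z.
Proof.
move=> mf mg f0 fg; apply: ge0_le_integral => //.
- by move=> u _; rewrite mule_ge0 ?box_indic_ge0.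
- apply: emeasurable_funM; first exact: measurable_box_indic.
  by apply: measurable_comp_affine.
- apply: emeasurable_funM; first exact: measurable_box_indic.
  by apply: measurable_comp_affine.
- by move=> u _; rewrite lee_wpmul2l ?box_indic_ge0.
Qed.

(** Apply [le_truncated_powR] with l a small multiple of the mean a, so small that
    the constant term is absorbed in the left-hand side. *)
Lemma average_powR_le (K th tau r a : R) (f : T -> R) z :
  (0 < K)%R -> (0 < th)%R -> (1 < tau)%R -> (0 < r)%R ->
  measurable_fun setT f -> (forall x, 0 <= f x)%R ->
  box_integral (2 * r) (EFin \o f) z = (a * r ^+ n)%:E -> (a <= K * th)%R ->
  (a `^ tau)%:E <= (((2 * 4 ^+ n) `^ tau) / r ^+ n)%:E *
    box_integral (2 * r) (EFin \o (truncated_powR K th tau \o f)) z.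
Proof.
move=> K0 th0 t1 r0 mf f0 fa aK.
have rn0 : (0 < r ^+ n)%R by rewrite exprn_gt0.
have c0 : (1 <= 4 ^+ n :> R)%R by rewrite exprn_ege1// ler1n.
have mtf := measurable_truncated_powR K th tau mf.
have htf u : (0 <= truncated_powR K th tau (f u))%R by exact: truncated_powR_ge0.
have a0 : (0 <= a)%R.
  rewrite -(pmulr_lge0 _ rn0) -lee_fin -fa box_integral_ge0// => x; exact: f0.
have [->|an0] := eqVneq a 0%R.
  rewrite powR0 ?gt_eqF ?(lt_trans ltr01 t1)// mule_ge0 ?box_integral_ge0//.
  by rewrite lee_fin divr_ge0 ?powR_ge0// ltW.
have ap : (0 < a)%R by rewrite lt_neqAle eq_sym an0.
(* The level l makes l times the volume (4 r)^n of the box half of a r^n. *)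
pose l : R := (a / (2 * 4 ^+ n))%R.
have cp : (0 < 2 * 4 ^+ n :> R)%R by rewrite mulr_gt0// exprn_gt0.
have l0 : (0 < l)%R by rewrite divr_gt0.
have lK : (l <= K * th)%R.
  apply: le_trans aK; rewrite /l ler_pdivrMr// ler_peMr//; nra.
set B := box_integral _ (EFin \o (_ \o f)) z.
have key : (a * r ^+ n)%:E <= (l * (4 * r) ^+ n)%:E + (l `^ (1 - tau))%:E * B.
  rewrite -fa /B /box_integral -!integral_indicM.
  have mfz (g : T -> R) : measurable_fun setT g ->
      measurable_fun (box (2 * r)) (fun u => (g (affine 1 z u))%:E).
    move=> mg; apply: measurable_funTS.
    by apply: (@measurable_comp_affine _ _ _ _ _ (EFin \o g)) => //; exact/measurable_EFinP.
  apply: (@le_trans _ _ (\int[bl]_(u in box (2 * r)) (l%:E + (l `^ (1 - tau))%:E *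
      (truncated_powR K th tau (f (affine 1 z u)))%:E))).
    apply: ge0_le_integral => //.
    - exact: measurable_box.
    - by move=> u _; rewrite lee_fin f0.
    - exact: mfz.
    - apply: emeasurable_funD; first exact: measurable_cst.
      by apply: measurable_funeM; exact: (mfz _ mtf).
    - by move=> u _; rewrite -EFinM -EFinD lee_fin le_truncated_powR.
  rewrite ge0_integralD; first last.
  - by apply: measurable_funeM; exact: (mfz _ mtf).
  - by move=> u _; rewrite mule_ge0 ?lee_fin ?powR_ge0.
  - exact: measurable_cst.
  - by move=> u _; rewrite lee_fin ltW.
  - exact: measurable_box.
  apply: leeD.
    rewrite integral_cst; last exact: measurable_box.
    rewrite (EFinM l); apply: lee_wpmul2l; first by rewrite lee_fin ltW.
    rewrite (_ : 4 * r = 2 * (2 * r))%R; last by ring.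
    rewrite le_eqVlt; apply/orP; left; apply/eqP; apply: borel_lebesgue_box.
    by rewrite mulr_ge0// ltW.
  rewrite ge0_integralZl_EFin ?powR_ge0//.
  - exact: measurable_box.
  - by move=> u _; rewrite lee_fin.
  - exact: (mfz _ mtf).
have B0 : 0 <= B by apply: box_integral_ge0 => x; rewrite /= lee_fin.
have la : (a = 2 * 4 ^+ n * l)%R by rewrite /l; field; rewrite ?gt_eqF.
have ltau : (0 < l `^ (tau - 1))%R by rewrite powR_gt0.
have lB : (l `^ tau * (4 * r) ^+ n)%:E <= B.
  move: key B0; case: B => [b| |] key B0; rewrite ?leey//.
  rewrite -EFinM -EFinD lee_fin in key; rewrite lee_fin.
  rewrite -(mulr_powRB1 (ltW l0) (lt_trans ltr01 t1)).
  have -> : (l * l `^ (tau - 1) * (4 * r) ^+ n = (l * (4 * r) ^+ n) * l `^ (tau - 1))%R by ring.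
  rewrite -ler_pdivlMr// -powRN opprB mulrC.
  by rewrite la exprMn in key; rewrite exprMn; lra.
rewrite la powRM ?(ltW cp) ?(ltW l0)//.
rewrite EFinM (EFinM (_ `^ tau) (r ^+ n)^-1) -muleA.
apply: lee_wpmul2l; first by rewrite lee_fin powR_ge0.
rewrite lee_pdivlMl// -EFinM; apply: le_trans lB; rewrite lee_fin exprMn.
rewrite mulrC ler_wpM2l ?powR_ge0// ler_peMl// ltW//.
Qed.

(** Sum [average_powR_le] over the scales and integrate: the integral of a mean is
    the integral of the function, and the scales are summed pointwise by
    [truncated_powR_sum].  The levels th m stand for r_m^(-n / P), where P is the
    Morrey exponent; the functions a m are the normalized integrals over boxes. *)
Lemma adams_estimate (rho K k tau : R) : (1 < rho)%R -> (0 < K)%R -> (1 < k)%R -> (k < tau)%R ->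
  exists2 C : R, (0 < C)%R & forall (c : R) (th r : nat -> R) (f : T -> R) (a : nat -> T -> R),
    (0 < c)%R -> (forall m, th m = c * rho ^+ m)%R -> (forall m, 0 < r m)%R ->
    measurable_fun setT f -> (forall x, 0 <= f x)%R ->
    (forall m z, box_integral (2 * r m) (EFin \o f) z = (a m z * r m ^+ n)%:E) ->
    (forall m z, a m z <= K * th m)%R ->
    \sum_(0 <= m <oo) \int[bl]_z (th m `^ (k - tau) * a m z `^ tau)%:E <=
    C%:E * \int[bl]_x (f x `^ k)%:E.
Proof.
move=> r1 K0 k1 kt; have t1 := lt_trans k1 kt.
pose C1 : R := ((2 * 4 ^+ n) `^ tau * 4 ^+ n)%R.
pose C2 : R := ((1 - rho `^ (- (tau - k)))^-1 + K `^ (tau - 1) * (1 - rho `^ (- (k - 1)))^-1)%R.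
have C10 : (0 < C1)%R by rewrite mulr_gt0 ?powR_gt0 ?mulr_gt0 ?exprn_gt0.
have q1 b : (0 < b)%R -> (0 < (1 - rho `^ (- b))^-1)%R.
  by move=> b0; rewrite invr_gt0 subr_gt0 powRN invf_lt1 ?powR_gt0 ?gt1_powR// (lt_trans _ r1).
have C20 : (0 < C2)%R by rewrite addr_gt0 ?mulr_gt0 ?q1 ?powR_gt0 ?subr_gt0.
exists (C1 * C2)%R; first exact: mulr_gt0.
move=> c _ r f a c0 /funext -> r0 mf f0 fa aK.
pose th m := (c * rho ^+ m)%R.
have th0 m : (0 < th m)%R by rewrite mulr_gt0// exprn_gt0// (lt_trans _ r1).
pose h m x : R := truncated_powR K (th m) tau (f x).
have h0 m x : (0 <= h m x)%R by exact: truncated_powR_ge0.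
have mh m : measurable_fun setT (EFin \o h m).
  by apply/measurable_EFinP; exact: measurable_truncated_powR.
have mfk : measurable_fun setT (fun x => (f x `^ k)%:E).
  by apply/measurable_EFinP; exact: measurable_powR_comp.
have step m : \int[bl]_z (th m `^ (k - tau) * a m z `^ tau)%:E <=
    C1%:E * \int[bl]_x (th m `^ (k - tau) * h m x)%:E.
  have ma : measurable_fun setT (a m).
    have -> : a m = (fun z => fine (box_integral (2 * r m) (EFin \o f) z) / r m ^+ n)%R.
      by apply/funext => z; rewrite fa/= mulfK// gt_eqF// exprn_gt0.
    apply: measurable_funM; last exact: measurable_cst.
    apply: (measurableT_comp (fine_measurable measurableT)).
    by apply: measurable_box_integral => //; exact/measurable_EFinP.
  under eq_integral do rewrite EFinM.
  under [in leRHS]eq_integral do rewrite EFinM.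
  have mat : measurable_fun setT (fun z => (a m z `^ tau)%:E).
    by apply/measurable_EFinP; exact: measurable_powR_comp.
  have at0 z : [set: T] z -> 0 <= (a m z `^ tau)%:E by rewrite lee_fin powR_ge0.
  have hm0 z : [set: T] z -> 0 <= (h m z)%:E by rewrite lee_fin.
  rewrite (ge0_integralZl_EFin _ measurableT at0 mat) ?powR_ge0//.
  rewrite (ge0_integralZl_EFin _ measurableT hm0 (mh m)) ?powR_ge0//.
  rewrite muleCA; apply: lee_wpmul2l; first by rewrite lee_fin powR_ge0.
  apply: (@le_trans _ _ (\int[bl]_z ((((2 * 4 ^+ n) `^ tau) / r m ^+ n)%:E *
      box_integral (2 * r m) (EFin \o h m) z))).
    apply: ge0_le_integral => //.
    - by apply: measurable_funeM; apply: measurable_box_integral => // x; rewrite /= lee_fin.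
    - by move=> z _; exact: (average_powR_le K0 (th0 m) t1 (r0 m) mf f0 (fa m z) (aK m z)).
  rewrite ge0_integralZl_EFin//; last 3 first.
  - by move=> z _; apply: box_integral_ge0 => x; rewrite /= lee_fin.
  - by apply: measurable_box_integral => // x; rewrite /= lee_fin.
  - by rewrite divr_ge0 ?powR_ge0// exprn_ge0// ltW.
  rewrite integral_box_integral//; last 2 first.
  - by rewrite mulr_ge0// ltW.
  - by move=> x; rewrite /= lee_fin.
  rewrite muleA -EFinM le_eqVlt; apply/orP; left; apply/eqP; congr (_%:E * _).
  rewrite /C1 mulrA -natrM exprMn mulrA mulrAC; congr (_ * _)%R.
  by rewrite divfK// gt_eqF// exprn_gt0.
apply: (@le_trans _ _ (\sum_(0 <= m <oo) C1%:E * \int[bl]_x (th m `^ (k - tau) * h m x)%:E)).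
  apply: lee_nneseries => [m _ _|m _]; last exact: step.
  by apply: integral_ge0 => z _; rewrite lee_fin mulr_ge0 ?powR_ge0.
have thh0 m x : 0 <= (th m `^ (k - tau) * h m x)%:E by rewrite lee_fin mulr_ge0 ?powR_ge0.
rewrite nneseriesZl//; last by move=> m _; apply: integral_ge0.
rewrite [in leRHS]EFinM -muleA; apply: lee_wpmul2l; first by rewrite lee_fin ltW.
rewrite -integral_nneseries//; last first.
  by move=> m; under eq_fun do rewrite EFinM; apply: measurable_funeM; exact: mh.
rewrite -ge0_integralZl_EFin ?(ltW C20)//; last by move=> x _; rewrite lee_fin powR_ge0.
apply: ge0_le_integral => //.
- by move=> x _; apply: nneseries_ge0 => *.
- apply: ge0_emeasurable_sum => // m _; under eq_fun do rewrite EFinM.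
  by apply: measurable_funeM; exact: mh.
- by apply: measurable_funeM.
move=> x _; apply: nneseries_le_bound => // N.
by rewrite sumEFin -EFinM lee_fin; exact: truncated_powR_sum.
Qed.

End adams.

(** * Dyadic cubes and the Morrey condition *)

Section dyadic.
Context {R : realType} (n : nat).
Local Notation mR := (measurableTypeR R).
Local Notation T := (n.-tuple mR).
Local Notation bl := (borel_lebesgue R n).
Implicit Types (j : int).

Definition side j : R := 2 ^ (- j).

Lemma side_gt0 j : 0 < side j. Proof. exact: exprz_gt0. Qed.

Lemma dyadic_cube_box j k : dyadic_cube j k =
  [set x : T | forall i,
    (`[(k i)%:~R * side j, (k i + 1)%:~R * side j[%classic : set mR) (tnth x i)].
Proof. by apply/seteqP; split => x h i; have := h i; rewrite /= in_itv. Qed.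

Lemma measurable_dyadic_cube j k : measurable (dyadic_cube j k : set T).
Proof.
rewrite dyadic_cube_box.
by have [] := @borel_box R n (fun i => `[(k i)%:~R * side j, (k i + 1)%:~R * side j[%classic).
Qed.

Lemma lebesgue_dyadic_cube j k : lebesgue R n (dyadic_cube j k) = (side j ^+ n)%:E.
Proof.
rewrite dyadic_cube_box.
rewrite (@lebesgue_box R n (fun i => `[(k i)%:~R * side j, (k i + 1)%:~R * side j[%classic))//.
rewrite (eq_bigr (fun=> (side j)%:E)).
  elim: n => [|m IH]; first by rewrite big_ord0 expr0.
  by rewrite big_ord_recl IH -EFinM exprS.
move=> i _; have s0 := side_gt0 j; rewrite lebesgue_measure_itv/= lte_fin ltr_pM2r// ltr_int.
rewrite ltrDl ltr01 -EFinD; congr (_%:E); rewrite intrD; ring.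
Qed.

Lemma borel_lebesgue_dyadic_cube j (k : 'I_n -> int) :
  bl (dyadic_cube j k) = (side j ^+ n)%:E.
Proof.
rewrite -(lebesgue_dyadic_cube j k); apply/esym/lebesgue_borel.
exact: measurable_dyadic_cube.
Qed.

Lemma dyadic_cube_cbox j (k : 'I_n -> int) :
  dyadic_cube j k `<=` cbox [tuple ((k i)%:~R * side j)%R : mR | i < n] (side j).
Proof.
move=> x xQ i; have /andP[h1 h2] := xQ i; rewrite tnth_mktuple.
move: h1 h2; rewrite /Rn_coord -/(side j) intrD mulrDl mul1r => h1 h2.
by rewrite ger0_norm; lra.
Qed.

(** A point within 4 sides of z in each coordinate is in a cube whose index
    differs from that of z by at most 4, so that nine values for each coordinate
    are enough. *)
Definition grid_index (j : int) (z : T) (k : {ffun 'I_n -> 'I_9}) (i : 'I_n) : int :=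
  Num.floor (tnth z i / side j : R) - 4 + (k i : nat)%:Z.

(** The floors of two real numbers at distance less than 4 differ by at most 4. *)
Lemma cover_grid j (z x : T) : (forall i, `|tnth x i - tnth z i : R| < 4 * side j) ->
  exists k, dyadic_cube j (grid_index j z k) x.
Proof.
move=> xz; have s0 := side_gt0 j.
(* The offset of the index of x from that of z, shifted to be a number between
   0 and 8. *)
pose m i : int := Num.floor (tnth x i / side j : R) - Num.floor (tnth z i / side j : R) + 4.
have m09 i : 0 <= m i < 9.
  have := xz i; rewrite ltr_norml -[X in X - _](@divfK _ (side j)) ?gt_eqF//.
  rewrite -[X in _ - X](@divfK _ (side j)) ?gt_eqF//.
  rewrite -mulrBl -mulNr !ltr_pM2r//.
  have := floor_itv (tnth x i / side j : R); have := floor_itv (tnth z i / side j : R).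
  rewrite /m; set a := Num.floor _; set b := Num.floor _; rewrite !intrD.
  move=> /andP[h1 h2] /andP[h3 h4] /andP[h5 h6].
  have e1 : (a - b)%:~R < 5%:~R :> R by rewrite intrB; lra.
  have e2 : (- 5)%:~R < (a - b)%:~R :> R by rewrite intrB; lra.
  rewrite ltr_int in e1; rewrite ltr_int in e2; lia.
exists [ffun i => inord `|m i|%N] => i; rewrite /Rn_coord /grid_index ffunE -/(side j).
have mi := m09 i; rewrite inordK; last by lia.
have -> : Num.floor (tnth z i / side j : R) - 4 + `|m i|%N%:Z = Num.floor (tnth x i / side j : R).
  by rewrite gez0_abs; [rewrite /m; ring|lia].
by have := floor_itv (tnth x i / side j : R); rewrite ler_pdivlMr// ltr_pdivrMr.
Qed.

Local Open Scope ereal_scope.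

Lemma box_integral_cover j z (F : T -> \bar R) : measurable_fun setT F -> (forall x, 0 <= F x) ->
  box_integral (4 * side j) F z <=
  \sum_(k : {ffun 'I_n -> 'I_9}) \int[bl]_(x in dyadic_cube j (grid_index j z k)) F x.
Proof.
move=> mF F0; have mI D : measurable D -> measurable_fun setT (fun x : T => (\1_D x)%:E * F x).
  by move=> mD; apply: emeasurable_funM => //; apply/measurable_EFinP; exact: measurable_indic.
have I0 (D : set T) x : 0 <= (\1_D x)%:E * F x by rewrite mule_ge0// lee_fin.
under eq_bigr do rewrite integral_indicM.
rewrite -ge0_integral_sum//; last by move=> k; apply: mI; exact: measurable_dyadic_cube.
rewrite (integral_shift z); last 2 first.
- by apply: emeasurable_sum => k; apply: mI; exact: measurable_dyadic_cube.
- by move=> x; apply: sume_ge0 => k _.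
apply: ge0_le_integral => //.
- by move=> u _; rewrite mule_ge0 ?box_indic_ge0.
- apply: emeasurable_funM; first exact: measurable_box_indic.
  by apply: measurable_comp_affine.
- apply: (@measurable_comp_affine _ _ _ _ 1%R
    (fun x => \sum_k (\1_(dyadic_cube j (grid_index j z k)) x)%:E * F x)) => //.
  by apply: emeasurable_sum => k; apply: mI; exact: measurable_dyadic_cube.
move=> u _; have [ur|nu] := pselect (box (4 * side j) u); last first.
  by rewrite (indic_notin nu) mul0e; apply: sume_ge0.
rewrite (indic_in ur) mul1e.
have [|k Dk] := @cover_grid j z (affine 1 z u).
  by move=> i; rewrite tnth_mktuple mul1r addrK.
by rewrite (bigD1 k)//= (indic_in Dk) mul1e leeDl// sume_ge0.
Qed.

(** The Morrey condition with norm at most 1, raised to the power k: for a cube of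
    volume l^n the normalizing factor l^(n / P - n / k) becomes l^(n - n k / P). *)
Definition morrey_bound (P k : R) (f : T -> R) := forall j l,
  \int[bl]_(x in dyadic_cube j l) (f x `^ k)%:E <= (side j `^ (n%:R - n%:R * k / P))%:E.

Lemma morrey_box_powR P k f j z : morrey_bound P k f -> measurable_fun setT f ->
  (forall x, 0 <= f x)%R ->
  box_integral (4 * side j) (fun x => (f x `^ k)%:E) z <=
    (9 ^+ n * side j `^ (n%:R - n%:R * k / P))%:E.
Proof.
move=> fM mf f0; apply: (le_trans (@box_integral_cover j z _ _ _)).
- by apply/measurable_EFinP; exact: measurable_powR_comp.
- by move=> x; rewrite lee_fin powR_ge0.
apply: (@le_trans _ _ (\sum_(k0 : {ffun 'I_n -> 'I_9}) (side j `^ (n%:R - n%:R * k / P))%:E)).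
  by apply: lee_sum => l _; exact: fM.
rewrite sumEFin sumr_const card_ffun !card_ord lee_fin.
by rewrite -[leLHS]mulr_natl natrX.
Qed.

Lemma box_integral_le_radius (f : T -> \bar R) r r' z : (r <= r')%R ->
  measurable_fun setT f -> (forall x, 0 <= f x) ->
  box_integral r f z <= box_integral r' f z.
Proof.
move=> rr mf f0; apply: ge0_le_integral => //.
- by move=> u _; rewrite mule_ge0 ?box_indic_ge0.
- apply: emeasurable_funM; first exact: measurable_box_indic.
  by apply: measurable_comp_affine.
- apply: emeasurable_funM; first exact: measurable_box_indic.
  by apply: measurable_comp_affine.
move=> u _; apply: lee_wpmul2r => //.
have [ur|nu] := pselect (box r u); last by rewrite (indic_notin nu) box_indic_ge0.
by rewrite !indic_in// => i; exact: lt_le_trans (ur i) rr.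
Qed.

(** Take [le_affine_powR] at the level l^(-n / P), the size that the Morrey
    condition allows for a mean.  The constants are the volume 8^n of the box of
    radius 4 sides, and the number 9^n of the cubes that cover it. *)
Lemma morrey_box P k f j z : morrey_bound P k f -> measurable_fun setT f ->
  (forall x, 0 <= f x)%R -> (1 <= k)%R ->
  box_integral (2 * side j) (EFin \o f) z <=
    ((8 ^+ n + 9 ^+ n) * (side j `^ (- (n%:R / P)) * side j ^+ n))%:E.
Proof.
move=> fM mf f0 k1; have s0 := side_gt0 j.
apply: (@le_trans _ _ (box_integral (4 * side j) (EFin \o f) z)).
  apply: box_integral_le_radius; last by move=> x; exact: f0.
  - by rewrite ler_pM2r// ler_nat.
  - exact/measurable_EFinP.
pose lam := (side j `^ (- (n%:R / P)))%R.
rewrite /box_integral -integral_indicM.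
apply: (le_trans (@integral_le_powR _ _ _ bl _ (measurable_box _) ((2 * (4 * side j)) ^+ n)%R _
   (f \o affine 1 z) lam k _ _ _ k1)).
- rewrite le_eqVlt; apply/orP; left; apply/eqP; apply: borel_lebesgue_box.
  by rewrite mulr_ge0// ltW.
- apply: measurable_funTS; apply: (measurableT_comp mf).
  by apply: measurable_affine; [exact: measurable_cst|exact: measurable_id].
- by move=> x; exact: f0.
- by rewrite powR_gt0.
rewrite [X in _ + _ * X]integral_indicM.
apply: (@le_trans _ _ ((lam * (2 * (4 * side j)) ^+ n)%:E + (lam `^ (1 - k))%:E *
   (9 ^+ n * side j `^ (n%:R - n%:R * k / P))%:E)).
  rewrite leeD2l// lee_wpmul2l ?lee_fin ?powR_ge0//.
  exact: (@morrey_box_powR P k f j z).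
rewrite -EFinM -EFinD lee_fin /lam -powRrM le_eqVlt; apply/orP; left; apply/eqP.
have e : (side j `^ (- (n%:R / P) * (1 - k)) * side j `^ (n%:R - n%:R * k / P) =
    side j `^ (- (n%:R / P)) * side j ^+ n)%R.
  rewrite -(powR_mulrn n (ltW s0)) -!powRD ?(gt_eqF s0) ?implybT//.
  by congr (powR _ _); ring.
have -> : (2 * (4 * side j) = 8 * side j)%R by ring.
rewrite exprMn [X in (_ + X)%R]mulrCA e; ring.
Qed.

End dyadic.

(** * Dyadic decomposition of the Riesz kernel *)

Section scales.
Context {R : realType} (n : nat).
Local Notation mR := (measurableTypeR R).
Local Notation T := (n.-tuple mR).
Local Notation bl := (borel_lebesgue R n).

Lemma sideD (j i : int) : side (j + i) = side j * 2 ^ (- i) :> R.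
Proof. by rewrite /side opprD expfzDr// pnatr_eq0. Qed.

Lemma side_fine (j : int) m : side (j + m%:Z) = side j * 2^-1 ^+ m :> R.
Proof. by rewrite sideD exprVn -exprnN. Qed.

Lemma side_fine_le (j : int) m : side (j + m%:Z) <= side j :> R.
Proof.
rewrite side_fine ler_piMr ?(ltW (side_gt0 j))// exprVn invf_le1 ?exprn_gt0//.
by rewrite exprn_ege1// ler1n.
Qed.

Lemma side_coarse (j : int) m : side (j - m.+1%:Z) = side j * 2 ^+ m.+1 :> R.
Proof. by rewrite sideD opprK. Qed.

(** The scales are counted from j, downwards for N below the side and upwards
    for the others, as the two ranges are summed by different estimates. *)
Lemma dyadic_scale (j : int) (N : R) : 0 < N ->
  (exists m : nat, side (j + m%:Z) / 2 <= N < side (j + m%:Z)) \/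
  (exists m : nat, side (j - m.+1%:Z) / 2 <= N < side (j - m.+1%:Z)).
Proof.
move=> N0; have s0 : 0 < side j :> R := side_gt0 j.
have arch (x : R) : exists m : nat, x < 2 ^+ m.
  have [m /ltW h] : exists m : nat, x < m%:R.
    exists (Num.truncn `|x|).+1; apply: le_lt_trans (ler_norm x) _; exact: truncnS_gt.
  exists m; apply: le_lt_trans h _; rewrite -natrX ltr_nat; exact: ltn_expl.
have [Ns|sN] := ltP N (side j); [left|right].
  have ex : exists m : nat, side j * 2^-1 ^+ m <= N.
    have [m hm] := arch (side j / N); exists m.
    by rewrite exprVn ler_pdivrMr ?exprn_gt0// mulrC -ler_pdivrMr// ltW.
  case: (ex_minnP ex) => -[|m]; first by rewrite expr0 mulr1 leNgt Ns.
  move=> h /(_ m) hm; exists m; rewrite side_fine; apply/andP; split.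
    by move: h; rewrite exprSr mulrA.
  by rewrite ltNge; apply/negP => /hm; rewrite ltnn.
have ex : exists m : nat, N < side j * 2 ^+ m.
  have [m hm] := arch (N / side j); exists m.
  by rewrite mulrC -ltr_pdivrMr.
case: (ex_minnP ex) => -[|m]; first by rewrite expr0 mulr1 ltNge sN.
move=> h /(_ m) hm; exists m; rewrite side_coarse h andbT.
rewrite exprSr mulrA mulfK// leNgt; apply/negP => /hm; by rewrite ltnn.
Qed.

Lemma riesz_kernel_scale (alpha r : R) (y : Rn R n) (i : 'I_n) :
  alpha < n%:R -> 0 < alpha -> 0 < r ->
  r / 2 <= `|Rn_coord y i| -> riesz_kernel alpha y <= 2 ^+ n * r `^ (alpha - n%:R).
Proof.
move=> an a0 r0 ry; rewrite /riesz_kernel.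
have r20 : 0 < r / 2 by rewrite divr_gt0.
have yn : r / 2 <= Rn_norm y.
  apply: le_trans ry _; rewrite /Rn_norm -sqrtr_sqr ler_sqrt; last first.
    by apply: sumr_ge0 => *; exact: sqr_ge0.
  by rewrite (bigD1 i)//= lerDl; apply: sumr_ge0 => *; exact: sqr_ge0.
apply: (@le_trans _ _ ((r / 2) `^ (n%:R - alpha))^-1).
  rewrite lef_pV2 ?posrE ?powR_gt0//; last exact: lt_le_trans yn.
  by apply: ge0_ler_powR; rewrite ?nnegrE ?subr_ge0 ?(ltW an) ?(ltW r20)// sqrtr_ge0.
rewrite -powRN opprB powRM ?invr_ge0 ?(ltW r0)// mulrC ler_wpM2r ?powR_ge0//.
rewrite -powR_inv1// -powRrM -powR_mulrn//; apply: ler_powR; first by rewrite ler1n.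
by rewrite mulN1r opprB gerBl ltW.
Qed.

Local Open Scope ereal_scope.

(** A nonzero y lies in B(r) and outside B(r/2) for exactly one dyadic r, and the
    term of that scale alone dominates the kernel.  At y = 0 the kernel is 0. *)
Lemma riesz_kernel_le (alpha : R) (j : int) (y : T) : (0 < alpha)%R -> (alpha < n%:R)%R ->
  (riesz_kernel alpha y)%:E <= (2 ^+ n)%:E *
    (\sum_(0 <= m <oo) ((side (j + m%:Z) `^ (alpha - n%:R))%:E *
       (\1_(box (side (j + m%:Z))) y)%:E) +
     \sum_(0 <= m <oo) ((side (j - m.+1%:Z) `^ (alpha - n%:R))%:E *
       (\1_(box (side (j - m.+1%:Z))) y)%:E)).
Proof.
move=> a0 an.
have t0 (u : nat -> R) m : 0 <= (u m `^ (alpha - n%:R))%:E * (\1_(box (u m)) y)%:E.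
  by rewrite mule_ge0 ?box_indic_ge0// lee_fin powR_ge0.
have S0 (u : nat -> R) :
    0 <= \sum_(0 <= m <oo) ((u m `^ (alpha - n%:R))%:E * (\1_(box (u m)) y)%:E).
  by apply: nneseries_ge0 => *; exact: t0.
have Sm (u : nat -> R) m : (u m `^ (alpha - n%:R))%:E * (\1_(box (u m)) y)%:E <=
    \sum_(0 <= m <oo) ((u m `^ (alpha - n%:R))%:E * (\1_(box (u m)) y)%:E).
  apply: le_trans (nneseries_lim_ge m.+1 _) => [|i _ _]; last exact: t0.
  by rewrite big_mkord big_ord_recr/= leeDr// sume_ge0// => i _; exact: t0.
have bound (u : nat -> R) m (N : R) (i : 'I_n) : (forall l, `|Rn_coord y l| <= N)%R ->
    `|Rn_coord y i|%R = N -> (0 < u m)%R -> (u m / 2 <= N < u m)%R ->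
    (riesz_kernel alpha y)%:E <= (2 ^+ n)%:E *
    \sum_(0 <= m <oo) ((u m `^ (alpha - n%:R))%:E * (\1_(box (u m)) y)%:E).
  move=> yN yi u0 /andP[h1 h2].
  apply: (@le_trans _ _ ((2 ^+ n)%:E *
      ((u m `^ (alpha - n%:R))%:E * (\1_(box (u m)) y)%:E))); last first.
    by rewrite lee_wpmul2l.
  rewrite indic_in; last by move=> l; exact: le_lt_trans (yN l) h2.
  by rewrite mule1 -EFinM lee_fin (@riesz_kernel_scale _ _ _ i)// yi.
have [y0|] := pselect (forall i, Rn_coord y i = 0%R).
  rewrite /riesz_kernel /Rn_norm big1; last by move=> i _; rewrite y0 expr0n.
  rewrite sqrtr0 powR0 ?invr0; last by rewrite gt_eqF// subr_gt0.
  by rewrite mule_ge0// adde_ge0.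
move=> /existsNP[i0 /eqP yi0].
have [i yi] : exists i, forall l, (`|Rn_coord y l| <= `|Rn_coord y i|)%R.
  case: (@Order.TotalTheory.arg_maxP _ _ _ i0 xpredT (fun i => `|Rn_coord y i|%R) isT).
  by move=> i _ h; exists i => l; exact: h.
have N0 : (0 < `|Rn_coord y i|)%R by apply: lt_le_trans (yi i0); rewrite normr_gt0.
have [[m hm]|[m hm]] := dyadic_scale j N0.
  apply: le_trans (bound (fun m => side (j + m%:Z)) m _ i yi erefl (side_gt0 _) hm) _.
  by rewrite lee_wpmul2l// leeDl//; exact: (S0 (fun m => side (j - m.+1%:Z))).
apply: le_trans (bound (fun m => side (j - m.+1%:Z)) m _ i yi erefl (side_gt0 _) hm) _.
by rewrite lee_wpmul2l// leeDr//; exact: (S0 (fun m => side (j + m%:Z))).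
Qed.

(** The operator with respect to the Borel measure, for which Tonelli's theorem is
    available. *)
Definition borel_J (alpha : R) (f1 f2 : T -> \bar R) (x : T) : \bar R :=
  \int[bl]_y (f1 (affine 1 x y) * f2 (affine (-1) x y) * (riesz_kernel alpha y)%:E).

Lemma measurable_riesz_kernel (alpha : R) : measurable_fun setT (riesz_kernel alpha : T -> R).
Proof.
have mnorm : measurable_fun setT (Rn_norm : T -> R).
  apply: (@measurableT_comp _ _ _ _ _ _ (@Num.sqrt R)).
    by apply: continuous_measurable_fun; exact: sqrt_continuous.
  apply: measurable_sum => i; apply: measurable_funX; exact: measurable_tnth.
rewrite (_ : riesz_kernel alpha = fun y : T => (Rn_norm y : R) `^ (- (n%:R - alpha)))%R; last first.
  by apply/funext => y; rewrite powRN.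
exact: measurable_powR_comp.
Qed.

Lemma measurable_borel_J (alpha : R) (F1 F2 : T -> \bar R) :
  measurable_fun setT F1 -> measurable_fun setT F2 ->
  (forall x, 0 <= F1 x) -> (forall x, 0 <= F2 x) ->
  measurable_fun setT (borel_J alpha F1 F2).
Proof.
move=> mF1 mF2 F10 F20.
apply: (@measurable_integral2 _ _ (fun z => F1 (affine 1 z.1 z.2) *
     F2 (affine (-1) z.1 z.2) * (riesz_kernel alpha z.2)%:E)).
  apply: emeasurable_funM.
    by apply: emeasurable_funM; apply: measurable_comp_affine.
  apply/measurable_EFinP; exact: measurableT_comp (measurable_riesz_kernel alpha) measurable_snd.
by move=> z; rewrite !mule_ge0// lee_fin invr_ge0 powR_ge0.
Qed.

Lemma borel_J_ge0 (alpha : R) (F1 F2 : T -> \bar R) x :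
  (forall x, 0 <= F1 x) -> (forall x, 0 <= F2 x) -> 0 <= borel_J alpha F1 F2 x.
Proof.
by move=> F10 F20; apply: integral_ge0 => y _; rewrite !mule_ge0// lee_fin invr_ge0 powR_ge0.
Qed.

Lemma borel_J_le (alpha : R) (j : int) (f1 f2 : T -> R) (x : T) :
  (0 < alpha)%R -> (alpha < n%:R)%R ->
  measurable_fun setT f1 -> (forall x, 0 <= f1 x)%R ->
  measurable_fun setT f2 -> (forall x, 0 <= f2 x)%R ->
  borel_J alpha (EFin \o f1) (EFin \o f2) x <= (2 ^+ n)%:E *
   (\sum_(0 <= m <oo) ((side (j + m%:Z) `^ (alpha - n%:R))%:E *
      bilinear_average (side (j + m%:Z)) (EFin \o f1) (EFin \o f2) x) +
    \sum_(0 <= m <oo) ((side (j - m.+1%:Z) `^ (alpha - n%:R))%:E *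
      bilinear_average (side (j - m.+1%:Z)) (EFin \o f1) (EFin \o f2) x)).
Proof.
move=> a0 an mf1 f10 mf2 f20.
pose B u := bilinear_average u (EFin \o f1) (EFin \o f2) x.
pose F y := (EFin \o f1) (affine 1 x y) * (EFin \o f2) (affine (-1) x y).
have mF : measurable_fun setT F.
  apply: emeasurable_funM; apply: measurable_comp_affine => //;
  first [exact: measurable_cst|exact/measurable_EFinP].
have F0 y : 0 <= F y by rewrite mule_ge0//= lee_fin.
pose G (u : nat -> R) (y : T) :=
  \sum_(0 <= m <oo) ((u m `^ (alpha - n%:R))%:E * (\1_(box (u m)) y)%:E).
have mt (u : nat -> R) m :
    measurable_fun setT (fun y : T => (u m `^ (alpha - n%:R))%:E * (\1_(box (u m)) y)%:E).
  by apply: measurable_funeM; exact: measurable_box_indic.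
have t0 (u : nat -> R) m (y : T) : 0 <= (u m `^ (alpha - n%:R))%:E * (\1_(box (u m)) y)%:E.
  by rewrite mule_ge0 ?box_indic_ge0// lee_fin powR_ge0.
have mG u : measurable_fun setT (G u).
  by apply: ge0_emeasurable_sum => *; [exact: t0|exact: mt].
have G0 u y : 0 <= G u y by apply: nneseries_ge0 => *; exact: t0.
have IG u : \int[bl]_y (F y * G u y) =
    \sum_(0 <= m <oo) ((u m `^ (alpha - n%:R))%:E * B (u m)).
  transitivity (\int[bl]_y \sum_(0 <= m <oo)
      (F y * ((u m `^ (alpha - n%:R))%:E * (\1_(box (u m)) y)%:E))).
    by apply: eq_integral => y _; rewrite /F/= -EFinM nneseriesZl.
  rewrite integral_nneseries//; last 2 first.
  - by move=> m; apply: emeasurable_funM => //; exact: mt.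
  - by move=> m y _; rewrite mule_ge0.
  apply: eq_eseriesr => m _; rewrite -ge0_integralZl_EFin ?powR_ge0//.
  - by apply: eq_integral => y _; rewrite muleCA; congr (_ * _); rewrite muleC.
  - by move=> y _; rewrite mule_ge0 ?box_indic_ge0//; exact: F0.
  - by apply: emeasurable_funM; [exact: measurable_box_indic|exact: mF].
rewrite -(IG (fun m => side (j + m%:Z))) -(IG (fun m => side (j - m.+1%:Z))).
rewrite -ge0_integralD//; last 4 first.
- by move=> y _; rewrite mule_ge0.
- by apply: emeasurable_funM.
- by move=> y _; rewrite mule_ge0.
- by apply: emeasurable_funM.
rewrite -ge0_integralZl_EFin//; last 2 first.
- by move=> y _; rewrite adde_ge0// mule_ge0.
- by apply: emeasurable_funD; apply: emeasurable_funM.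
apply: ge0_le_integral => //.
- move=> y _; rewrite mule_ge0//; first exact: F0.
  by rewrite lee_fin invr_ge0 powR_ge0.
- by apply: emeasurable_funM => //; apply/measurable_EFinP; exact: measurable_riesz_kernel.
- by apply: measurable_funeM; apply: emeasurable_funD; apply: emeasurable_funM.
move=> y _; rewrite -ge0_muleDr// muleCA.
by rewrite lee_wpmul2l//; [exact: F0|exact: riesz_kernel_le].
Qed.

End scales.

(** * Young's inequality, and scales above the size of the cube *)

Section young.
Context {R : realType}.
Variables (d alpha p1 p2 q1 q2 p q s t : R).
Hypotheses (d0 : 0 < d) (p10 : 0 < p1) (p20 : 0 < p2) (q10 : 0 < q1) (q20 : 0 < q2)
  (p0 : 0 < p) (q0 : 0 < q) (s0 : 0 < s)
  (hp12 : p^-1 = p1^-1 + p2^-1) (hq12 : q^-1 = q1^-1 + q2^-1)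
  (hsp : s^-1 = p^-1 - alpha / d) (hts : q / p = t / s).

Lemma exponent_t : t = q * s / p.
Proof. by apply: (mulIf (invr_neq0 (lt0r_neq0 s0))); rewrite -hts; field; rewrite !gt_eqF. Qed.

Lemma exponent_alpha : alpha = d * (p^-1 - s^-1).
Proof. by rewrite hsp; field; rewrite !gt_eqF. Qed.

(** The terms in Young's inequality: the weight in r is the one that
    [adams_estimate] asks for with k = qi, tau = qi s / p and levels r^(-d / pi),
    and the power of l is the inverse of what that estimate produces. *)
Let summand r l a pi qi :=
  (r `^ (- (d / pi))) `^ (qi - qi * s / p) * a `^ (qi * s / p) * l `^ (- (d - d * qi / pi)).

Let summand_powR r l a pi qi : 0 < r -> 0 < l -> 0 <= a -> 0 < qi -> 0 < pi ->
  summand r l a pi qi `^ (q / qi) =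
  r `^ (d / pi * (t - q)) * a `^ t * l `^ (- (d * q / qi - d * q / pi)).
Proof.
move=> r0 l0 a0 qi0 pi0; rewrite /summand.
rewrite !powRM ?mulr_ge0 ?powR_ge0// -!powRrM exponent_t.
by congr (_ `^ _ * _ `^ _ * _ `^ _); field; rewrite !gt_eqF.
Qed.

(** By definition the weighted geometric mean of the two summands has the same
    power of a1 and of a2 as the left-hand side.  That of r agrees because
    alpha = d (1/p - 1/s), and those of l cancel because q / p = t / s. *)
Lemma young_scaled r l a1 a2 : 0 < r -> 0 < l -> 0 <= a1 -> 0 <= a2 ->
  (r `^ alpha * a1 * a2) `^ t <=
  l `^ (d - d * t / s) * (summand r l a1 p1 q1 + summand r l a2 p2 q2).
Proof.
move=> r0 l0 a10 a20.
have S0 a pi qi : 0 <= a -> 0 <= summand r l a pi qi by move=> ?; rewrite !mulr_ge0 ?powR_ge0.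
have qq : q / q1 + q / q2 = 1 by rewrite -mulrDr -hq12 mulfV// gt_eqF.
apply: (@le_trans _ _ (l `^ (d - d * t / s) *
   (summand r l a1 p1 q1 `^ (q / q1) * summand r l a2 p2 q2 `^ (q / q2)))); last first.
  by rewrite ler_wpM2l ?powR_ge0// powR_geomean ?S0// divr_ge0// ltW.
rewrite !summand_powR// !powRM ?mulr_ge0 ?powR_ge0// -powRrM.
have er : r `^ (alpha * t) = r `^ (d / p1 * (t - q)) * r `^ (d / p2 * (t - q)).
  rewrite -powRD ?(gt_eqF r0) ?implybT//; congr (_ `^ _).
  rewrite -mulrDl -mulrDr -hp12 exponent_alpha exponent_t; field.
  by rewrite !gt_eqF.
have el : l `^ (d - d * t / s) * (l `^ (- (d * q / q1 - d * q / p1)) *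
    l `^ (- (d * q / q2 - d * q / p2))) = 1.
  rewrite -!powRD ?(gt_eqF l0) ?implybT// -[RHS](powRr0 l); congr (_ `^ _).
  have -> : d - d * t / s + (- (d * q / q1 - d * q / p1) - (d * q / q2 - d * q / p2)) =
    d - d * (t / s) - d * (q / q1 + q / q2) + d * q * (p1^-1 + p2^-1) by ring.
  by rewrite qq -hp12 -hts; ring.
rewrite er le_eqVlt; apply/orP; left; apply/eqP.
rewrite -[LHS]mulr1 -el; ring.
Qed.

End young.

Section large_scales.
Context {R : realType} (n : nat).
Local Notation mR := (measurableTypeR R).
Local Notation T := (n.-tuple mR).
Local Notation bl := (borel_lebesgue R n).
Local Open Scope ereal_scope.

(** With u = x + y, the second factor is f2(2 x - u).  For fixed u, as x runs
    through the box of radius l about c, the point 2 x - u runs through the box of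
    radius 2 l about 2 c - u, and u stays within 2 r of c because l <= r. *)
Lemma integral_bilinear_average_large (f1 f2 : T -> \bar R) (r l M : R) (c : T) (E : set T) :
  measurable_fun setT f1 -> (forall x, 0 <= f1 x) ->
  measurable_fun setT f2 -> (forall x, 0 <= f2 x) ->
  (l <= r)%R -> measurable E -> E `<=` cbox c l ->
  (forall w, box_integral (2 * l) f2 w <= M%:E) ->
  \int[bl]_(x in E) bilinear_average r f1 f2 x <= box_integral (2 * r) f1 c * M%:E.
Proof.
move=> mf1 f10 mf2 f20 lr mE Ec hM.
(* The integrand in the variables z.1 = u = x + y and z.2 = x. *)
pose H (z : T * T) := (\1_(cbox c (2 * r)) z.1)%:E * f1 z.1 *
   ((\1_(cbox c l) z.2)%:E * f2 (affine 2 (neg z.1) z.2)).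
have mInd (D : set T) : measurable D -> measurable_fun setT (fun u : T => (\1_D u)%:E : \bar R).
  by move=> mD; apply/measurable_EFinP; exact: measurable_indic.
have Ind0 (D : set T) u : 0 <= (\1_D u)%:E :> \bar R by rewrite lee_fin.
have mH : measurable_fun setT H.
  apply: emeasurable_funM; apply: emeasurable_funM.
  - exact: measurableT_comp (mInd _ (measurable_cbox _ _)) measurable_fst.
  - exact: measurableT_comp mf1 measurable_fst.
  - exact: measurableT_comp (mInd _ (measurable_cbox _ _)) measurable_snd.
  - apply: measurable_comp_affine => //.
    exact: (measurable_affine (-1) (measurable_cst _) measurable_fst).
have H0 z : 0 <= H z by rewrite !mule_ge0.
have mHs : measurable_fun setT (fun z => H (z.2, z.1)).
  apply: (measurableT_comp mH); apply: measurable_fun_pair.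
  + exact: measurable_snd.
  + exact: measurable_fst.
rewrite integral_indicM.
apply: (@le_trans _ _ (\int[bl]_x \int[bl]_u H (u, x))).
  apply: ge0_le_integral => //.
  - by move=> x _; rewrite mule_ge0// bilinear_average_ge0.
  - by apply: emeasurable_funM; [exact: mInd|exact: measurable_bilinear_average].
  - by apply: (@measurable_integral2 _ _ (fun z => H (z.2, z.1))) => // z; exact: H0.
  move=> x _; have [Ex|nE] := pselect (E x); last first.
    by rewrite (indic_notin nE) mul0e integral_ge0// => u _; exact: H0.
  rewrite (indic_in Ex) mul1e /bilinear_average (integral_shift (neg x)); last 2 first.
  - apply: emeasurable_funM; first exact: measurable_box_indic.
    by apply: emeasurable_funM; apply: measurable_comp_affine => //; exact: measurable_cst.
  - by move=> y; rewrite !mule_ge0 ?box_indic_ge0.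
  apply: ge0_le_integral => //.
  - by move=> u _; rewrite !mule_ge0 ?box_indic_ge0.
  - apply: (@measurable_comp_affine _ _ _ _ 1%R
      (fun u => (\1_(box r) u)%:E * (f1 (affine 1 x u) * f2 (affine (-1) x u)))) => //.
    apply: emeasurable_funM; first exact: measurable_box_indic.
    by apply: emeasurable_funM; apply: measurable_comp_affine => //; exact: measurable_cst.
  - exact: (measurableT_comp mHs (measurable_pair1 x)).
  move=> u _; have [ur|nu] := pselect (box r (affine 1 (neg x) u)); last first.
    by rewrite (indic_notin nu) mul0e H0.
  have uc : cbox c (2 * r) u.
    move=> i; have := ur i; have := Ec _ Ex i.
    rewrite !tnth_mktuple mul1r mulN1r addr0 => h1 h2.
    have -> : (tnth u i - tnth c i =
        (tnth u i + - tnth x i) + (tnth x i - tnth c i) :> R)%R by ring.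
    by apply: (le_lt_trans (ler_normD _ _)); lra.
  rewrite /H/= !indic_in//; last exact: Ec.
  rewrite !mul1e le_eqVlt; apply/orP; left; apply/eqP.
  by congr (f1 _ * f2 _); apply: eq_from_tnth => i; rewrite !tnth_mktuple; ring.
rewrite (integral_swap mHs (fun z => H0 _))/=.
apply: (@le_trans _ _ (\int[bl]_u ((\1_(cbox c (2 * r)) u)%:E * f1 u * M%:E))).
  apply: ge0_le_integral => //.
  - by move=> u _; apply: integral_ge0 => x _; exact: H0.
  - exact: (measurable_integral2 mH H0).
  - apply: emeasurable_funM; last exact: measurable_cst.
    by apply: emeasurable_funM => //; exact: mInd _ (measurable_cbox _ _).
  move=> u _; rewrite /H/=.
  have mg : measurable_fun setT (fun x : T => (\1_(cbox c l) x)%:E * f2 (affine 2 (neg u) x)).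
    apply: emeasurable_funM; first exact: mInd _ (measurable_cbox _ _).
    by apply: measurable_comp_affine => //; exact: measurable_cst.
  have g0 x : 0 <= (\1_(cbox c l) x)%:E * f2 (affine 2 (neg u) x) by rewrite mule_ge0.
  rewrite ge0_integralZl//; last by rewrite mule_ge0.
  apply: lee_wpmul2l; first by rewrite mule_ge0.
  pose w := affine 2 (neg u) c.
  apply: le_trans (hM w).
    (* The substitution v = 2 x - u costs a Jacobian 2^-n <= 1. *)
pose G v := (\1_(cbox w (2 * l)) v)%:E * f2 v.
  have mG : measurable_fun setT G.
    by apply: emeasurable_funM => //; exact: mInd _ (measurable_cbox _ _).
  have G0 v : 0 <= G v by rewrite mule_ge0.
  have -> : box_integral (2 * l) f2 w = \int[bl]_v G v.
    rewrite [RHS](integral_shift w)//; apply: eq_integral => v _; rewrite /G.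
    have e i : (tnth (affine 1 w v) i - tnth w i = tnth v i :> R)%R.
      by rewrite tnth_mktuple; ring.
    have [h|h] := pselect (box (2 * l) v).
      by rewrite (indic_in h) indic_in// => i; rewrite e.
    by rewrite (indic_notin h) indic_notin// => h'; apply: h => i; rewrite -e.
  rewrite (integral_affine (neg u) (_ : 2 != 0)%R mG G0) ?pnatr_eq0// normr_nat.
  have mGa : measurable_fun setT (fun x : T => G (affine 2 (neg u) x)).
    by apply: measurable_comp_affine => //; exact: measurable_cst.
  apply: (@le_trans _ _ (\int[bl]_x G (affine 2 (neg u) x))); last first.
    rewrite -[leLHS]mul1e lee_wpmul2r ?integral_ge0// lee_fin.
    by rewrite exprn_ege1// ler1n.
  apply: ge0_le_integral => //.
  move=> x _; have [xc|nx] := pselect (cbox c l x); last first.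
    by rewrite (indic_notin nx) mul0e.
  rewrite (indic_in xc) /G indic_in// => i; have := xc i; rewrite !tnth_mktuple.
  have -> : (2 * tnth x i + (-1 * tnth u i + 0) - (2 * tnth c i + (-1 * tnth u i + 0)) =
     2 * (tnth x i - tnth c i) :> R)%R by ring.
  by rewrite normrM normr_nat ltr_pM2l.
have M0 : 0 <= M%:E by apply: le_trans (hM c); exact: box_integral_ge0.
rewrite ge0_integralZr//; last 2 first.
- by apply: emeasurable_funM => //; exact: mInd _ (measurable_cbox _ _).
- by move=> u _; rewrite mule_ge0.
apply: lee_wpmul2r => //; rewrite (integral_shift c); last 2 first.
- by apply: emeasurable_funM => //; exact: mInd _ (measurable_cbox _ _).
- by move=> u; rewrite mule_ge0.
rewrite le_eqVlt; apply/orP; left; apply/eqP; apply: eq_integral => v _.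
have e i : (tnth (affine 1 c v) i - tnth c i = tnth v i :> R)%R.
  by rewrite tnth_mktuple; ring.
have [h|h] := pselect (box (2 * r) v).
  by rewrite (indic_in h) indic_in// => i; rewrite e.
by rewrite (indic_notin h) indic_notin// => h'; apply: h => i; rewrite -e.
Qed.

End large_scales.

(** * The estimate for Borel functions *)

Section local_averages.
Context {R : realType} (n : nat).
Local Notation mR := (measurableTypeR R).
Local Notation T := (n.-tuple mR).
Local Notation bl := (borel_lebesgue R n).
Local Open Scope ereal_scope.

Lemma side_fine_powR (j : int) m (b : R) :
  (side j `^ (- b) * (2 `^ b) ^+ m = side (j + m%:Z) `^ (- b))%R.
Proof.
rewrite side_fine powR_geometric ?side_gt0 ?invr_gt0//; congr (_ * _ ^+ _)%R.
by rewrite -powR_inv1// -powRrM mulN1r opprK.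
Qed.

(** [adams_estimate] for f restricted to the box of radius 4 sides about c.  There
    the Morrey condition provides both hypotheses: the size of the means, and the
    mass of f^k that is left on the right-hand side. *)
Lemma local_average (P k tau : R) : (0 < n)%N -> (0 < P)%R -> (1 < k)%R -> (k < tau)%R ->
  exists2 C : R, (0 < C)%R & forall (f : T -> R) (j : int) (c : T),
    measurable_fun setT f -> (forall x, 0 <= f x)%R -> morrey_bound P k f ->
    exists a : nat -> T -> R, [/\ forall m, measurable_fun setT (a m),
      forall m z, (0 <= a m z)%R,
      forall m z, cbox c (2 * side j) z ->
        box_integral (2 * side (j + m%:Z)) (EFin \o f) z = (a m z * side (j + m%:Z) ^+ n)%:E &
      \sum_(0 <= m <oo) \int[bl]_z
        ((side (j + m%:Z) `^ (- (n%:R / P))) `^ (k - tau) * a m z `^ tau)%:E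
      <= (C * side j `^ (n%:R - n%:R * k / P))%:E].
Proof.
move=> n0 P0 k1 kt.
pose K : R := (8 ^+ n + 9 ^+ n)%R.
have K0 : (0 < K)%R by rewrite addr_gt0// exprn_gt0.
have rho1 : (1 < 2 `^ (n%:R / P) :> R)%R by rewrite gt1_powR ?ltr1n// divr_gt0// ltr0n.
have [C C0 HC] := @adams_estimate R n _ _ _ _ rho1 K0 k1 kt.
exists (C * 9 ^+ n)%R; first by rewrite mulr_gt0// exprn_gt0.
move=> f j c mf f0 fM.
pose l : R := side j; have l0 : (0 < l)%R := side_gt0 j.
pose r m : R := side (j + m%:Z); have r0 m : (0 < r m)%R := side_gt0 _.
have rl m : (r m <= l)%R := side_fine_le j m.
pose D := cbox c (4 * l).
have mD : measurable D := measurable_cbox _ _.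
(* The means are those of g: they agree with the means of f near c, and are
   finite everywhere. *)
pose g x : R := (\1_D x * f x)%R.
have mg : measurable_fun setT g by apply: measurable_funM => //; exact: measurable_indic.
have g0 x : (0 <= g x)%R by rewrite mulr_ge0.
have gf x : (g x <= f x)%R.
  by rewrite ler_piMl//; rewrite -lee_fin; exact: indic_le1.
have bg m z : box_integral (2 * r m) (EFin \o g) z <= (K * (r m `^ (- (n%:R / P)) * r m ^+ n))%:E.
  apply: le_trans (@morrey_box R n P k f (j + m%:Z) z fM mf f0 (ltW k1)).
  apply: box_integral_mono; [exact/measurable_EFinP|exact/measurable_EFinP| |].
  - by move=> x; rewrite lee_fin.
  - by move=> x; rewrite lee_fin.
have bg0 m z : 0 <= box_integral (2 * r m) (EFin \o g) z.
  by apply: box_integral_ge0 => x; rewrite lee_fin.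
have bgfin m z : box_integral (2 * r m) (EFin \o g) z \is a fin_num.
  by rewrite ge0_fin_numE//; exact: le_lt_trans (bg m z) (ltry _).
pose a m z : R := (fine (box_integral (2 * r m) (EFin \o g) z) / r m ^+ n)%R.
have aE m z : box_integral (2 * r m) (EFin \o g) z = (a m z * r m ^+ n)%:E.
  by rewrite /a divfK ?fineK// gt_eqF// exprn_gt0.
exists a; split.
- move=> m; apply: measurable_funM; last exact: measurable_cst.
  apply: (measurableT_comp (fine_measurable measurableT)).
  by apply: measurable_box_integral; [exact/measurable_EFinP|move=> x; rewrite lee_fin].
- by move=> m z; rewrite divr_ge0 ?fine_ge0// exprn_ge0// ltW.
- move=> m z zc; rewrite -aE (box_integral_local (EFin \o f) (ltW (r0 m)) (rl m) zc).
  by apply: eq_integral => u _; rewrite /= -EFinM.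
have aK m z : (a m z <= K * r m `^ (- (n%:R / P)))%R.
  have h := bg m z.
  by rewrite aE lee_fin (mulrA K) (ler_pM2r (exprn_gt0 n (r0 m))) in h.
have lp : (0 < l `^ (- (n%:R / P)))%R by rewrite powR_gt0.
have thE m : (r m `^ (- (n%:R / P)) = l `^ (- (n%:R / P)) * (2 `^ (n%:R / P)) ^+ m)%R.
  by rewrite side_fine_powR.
apply: (le_trans (HC _ _ _ _ _ lp thE r0 mg g0 aE aK)).
rewrite -[(C * 9 ^+ n * _)%R]mulrA (EFinM C); apply: lee_wpmul2l; first by rewrite lee_fin ltW.
apply: le_trans (@morrey_box_powR R n P k f j c fM mf f0).
rewrite (integral_shift c); last 2 first.
- by apply/measurable_EFinP; exact: measurable_powR_comp.
- by move=> x; rewrite lee_fin powR_ge0.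
apply: ge0_le_integral => //.
- by move=> x _; rewrite lee_fin powR_ge0.
- apply: (@measurable_comp_affine _ _ _ _ 1%R (fun x => (g x `^ k)%:E)) => //.
  by apply/measurable_EFinP; exact: measurable_powR_comp.
- apply: emeasurable_funM; first exact: measurable_box_indic.
  apply: (@measurable_comp_affine _ _ _ _ 1%R (fun x => (f x `^ k)%:E)) => //.
  by apply/measurable_EFinP; exact: measurable_powR_comp.
move=> u _; have k0 : k != 0%R by rewrite gt_eqF// (lt_trans ltr01).
have e i : (tnth (affine 1 c u) i - tnth c i = tnth u i :> R)%R.
  by rewrite tnth_mktuple; ring.
have [h4|h4] := pselect (box (4 * side j) u).
  rewrite (indic_in h4) mul1e lee_fin; apply: ge0_ler_powR; rewrite ?nnegrE//.
  by rewrite ltW// (lt_trans ltr01).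
rewrite (indic_notin h4) mul0e /g indicE memNset ?mul0r ?powR0//.
by move=> h'; apply: h4 => i; rewrite -e; exact: h'.
Qed.

End local_averages.

Section borel_estimate.
Context {R : realType} (n : nat).
Local Notation mR := (measurableTypeR R).
Local Notation T := (n.-tuple mR).
Local Notation bl := (borel_lebesgue R n).
Variables (alpha p1 p2 q1 q2 p q s t : R).
Hypotheses (n0 : (0 < n)%N) (a0 : 0 < alpha) (an : alpha < n%:R)
  (q11 : 1 < q1) (qp1 : q1 <= p1) (q21 : 1 < q2) (qp2 : q2 <= p2)
  (q0 : 0 < q) (qp : q <= p) (t0 : 0 < t) (t1 : t <= 1) (s1 : 1 <= s)
  (hp12 : p^-1 = p1^-1 + p2^-1) (hq12 : q^-1 = q1^-1 + q2^-1)
  (hsp : s^-1 = p^-1 - alpha / n%:R) (hts : q / p = t / s) (sq2 : s < q2).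

Let d0 : 0 < n%:R :> R. Proof. by rewrite ltr0n. Qed.
Let q10 : 0 < q1. Proof. exact: lt_trans q11. Qed.
Let q20 : 0 < q2. Proof. exact: lt_trans q21. Qed.
Let p10 : 0 < p1. Proof. exact: lt_le_trans qp1. Qed.
Let p20 : 0 < p2. Proof. exact: lt_le_trans qp2. Qed.
Let p0 : 0 < p. Proof. exact: lt_le_trans qp. Qed.
Let s0 : 0 < s. Proof. exact: lt_le_trans s1. Qed.

Let ps : p < s.
Proof. by rewrite -ltf_pV2 ?posrE// hsp gtrBl divr_gt0. Qed.

Let lt_scaled q' : 0 < q' -> q' < q' * s / p.
Proof. by move=> q'0; rewrite ltr_pdivlMr// ltr_pM2l. Qed.

Local Open Scope ereal_scope.

(** At each scale, concavity and Young's inequality leave two integrals, one for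
    each function; their sums over the scales are those of [local_average]. *)
Lemma fine_scales_estimate : exists2 C : R, (0 < C)%R &
  forall (f1 f2 : T -> R) (j : int) (k : 'I_n -> int),
  measurable_fun setT f1 -> (forall x, 0 <= f1 x)%R -> morrey_bound p1 q1 f1 ->
  measurable_fun setT f2 -> (forall x, 0 <= f2 x)%R -> morrey_bound p2 q2 f2 ->
  \sum_(0 <= m <oo) \int[bl]_(x in dyadic_cube j k)
    (((side (j + m%:Z) `^ (alpha - n%:R))%:E *
       bilinear_average (side (j + m%:Z)) (EFin \o f1) (EFin \o f2) x) `^ t)
  <= (C * side j `^ (n%:R - n%:R * t / s))%:E.
Proof.
have [C1 C10 H1] := @local_average R n p1 q1 _ n0 p10 q11 (lt_scaled q10).
have [C2 C20 H2] := @local_average R n p2 q2 _ n0 p20 q21 (lt_scaled q20).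
exists (2 * (C1 + C2))%R; first by rewrite mulr_gt0// addr_gt0.
move=> f1 f2 j k mf1 f10 fM1 mf2 f20 fM2.
(* c is the lower corner of the cube. *)
pose c : T := [tuple ((k i)%:~R * side j)%R : mR | i < n].
have Qc : dyadic_cube j k `<=` cbox c (side j) := @dyadic_cube_cbox R n j k.
have [x1 [mx1 x10 x1E x1S]] := H1 f1 j c mf1 f10 fM1.
have [x2 [mx2 x20 x2E x2S]] := H2 f2 j c mf2 f20 fM2.
pose l : R := side j; have l0 : (0 < l)%R := side_gt0 j.
pose r m : R := side (j + m%:Z); have r0 m : (0 < r m)%R := side_gt0 _.
have rl m : (r m <= l)%R := side_fine_le j m.
pose w (a : nat -> T -> R) (pi qi : R) m z : R :=
  ((r m `^ (- (n%:R / pi))) `^ (qi - qi * s / p) * a m z `^ (qi * s / p))%R.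
have w0 a pi qi m z : (0 <= w a pi qi m z)%R by rewrite mulr_ge0 ?powR_ge0.
have mw a pi qi m : (forall m, measurable_fun setT (a m)) ->
    measurable_fun setT (fun z => (w a pi qi m z)%:E).
  move=> ma; apply/measurable_EFinP; apply: measurable_funM; first exact: measurable_cst.
  exact: measurable_powR_comp.
pose e (pi qi : R) : R := (n%:R - n%:R * qi / pi)%R.
pose M : R := (l `^ (n%:R - n%:R * t / s))%R.
have step m : \int[bl]_(x in dyadic_cube j k) (((r m `^ (alpha - n%:R))%:E *
       bilinear_average (r m) (EFin \o f1) (EFin \o f2) x) `^ t) <=
    (2 * M)%:E * ((l `^ (- e p1 q1))%:E * \int[bl]_z (w x1 p1 q1 m z)%:E +
                  (l `^ (- e p2 q2))%:E * \int[bl]_z (w x2 p2 q2 m z)%:E).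
  have mF1 : measurable_fun setT (EFin \o f1) by exact/measurable_EFinP.
  have mF2 : measurable_fun setT (EFin \o f2) by exact/measurable_EFinP.
  have F10 x : 0 <= (EFin \o f1) x by rewrite lee_fin.
  have F20 x : 0 <= (EFin \o f2) x by rewrite lee_fin.
    (* The level of the bilinear mean at z: A_1 A_2 / r^n = a_1 a_2 r^n. *)
pose lam z : R := (x1 m z * x2 m z * r m ^+ n)%R.
  have mlam : measurable_fun setT lam.
    by apply: measurable_funM; [exact: measurable_funM|exact: measurable_cst].
  have lam0 z : (0 <= lam z)%R by rewrite !mulr_ge0 ?exprn_ge0 ?x10 ?x20 ?ltW.
  have h := integral_bilinear_average_powR mF1 F10 mF2 F20 (r0 m) (rl m) t0 t1
    (measurable_dyadic_cube j k) Qc mlam lam0.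
  have {}h := h _.
  have mB : measurable_fun setT (bilinear_average (r m) (EFin \o f1) (EFin \o f2)).
    exact: measurable_bilinear_average.
  have B0 x : 0 <= bilinear_average (r m) (EFin \o f1) (EFin \o f2) x.
    exact: bilinear_average_ge0.
  under eq_integral do rewrite poweRM ?lee_fin ?powR_ge0// poweR_EFin.
  rewrite ge0_integralZl_EFin ?powR_ge0//; last 3 first.
  - exact: measurable_dyadic_cube.
  - by move=> x _; exact: poweR_ge0.
  - by apply: measurable_funTS; exact: measurable_poweR_comp.
  apply: (@le_trans _ _ (((r m `^ (alpha - n%:R)) `^ t)%:E *
      (2%:E * \int[bl]_(z in cbox c (2 * l)) (lam z `^ t)%:E))).
    rewrite lee_wpmul2l ?lee_fin ?powR_ge0// h// => z zc.
    rewrite x1E// x2E// -EFinM lee_fin /lam exprMn.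
    rewrite -/(r m).
    have -> : (x1 m z * r m ^+ n * (x2 m z * r m ^+ n) =
        x1 m z * x2 m z * r m ^+ n * (1 * r m ^+ n))%R by ring.
    rewrite ler_wpM2l ?lam0// ler_wpM2r ?exprn_ge0 ?(ltW (r0 m))//.
    by rewrite exprn_ege1// ler1n.
  rewrite muleCA (EFinM 2 M) -muleA; apply: lee_wpmul2l; first by rewrite lee_fin.
  have ex1 z : [set: T] z -> 0 <= (w x1 p1 q1 m z)%:E by rewrite lee_fin.
  have ex2 z : [set: T] z -> 0 <= (w x2 p2 q2 m z)%:E by rewrite lee_fin.
  rewrite -(ge0_integralZl_EFin _ measurableT ex1 (mw _ _ _ _ mx1)) ?powR_ge0//.
  rewrite -(ge0_integralZl_EFin _ measurableT ex2 (mw _ _ _ _ mx2)) ?powR_ge0//.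
  rewrite -ge0_integralD//; last 4 first.
  - by move=> z _; rewrite mule_ge0 ?lee_fin ?powR_ge0.
  - by apply: measurable_funeM; exact: mw.
  - by move=> z _; rewrite mule_ge0 ?lee_fin ?powR_ge0.
  - by apply: measurable_funeM; exact: mw.
  pose Y z : \bar R := (l `^ (- e p1 q1))%:E * (w x1 p1 q1 m z)%:E +
    (l `^ (- e p2 q2))%:E * (w x2 p2 q2 m z)%:E.
  have Y0 z : [set: T] z -> 0 <= Y z by rewrite adde_ge0// mule_ge0 ?lee_fin ?powR_ge0.
  have mY : measurable_fun setT Y.
    by apply: emeasurable_funD; apply: measurable_funeM; exact: mw.
  rewrite -(ge0_integralZl_EFin _ measurableT Y0 mY) ?powR_ge0//.
  pose Z z : \bar R := (\1_(cbox c (2 * l)) z)%:E * (lam z `^ t)%:E.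
  have Z0 z : [set: T] z -> 0 <= Z z by rewrite mule_ge0 ?lee_fin ?powR_ge0.
  have mZ : measurable_fun setT Z.
    apply: emeasurable_funM; last by apply/measurable_EFinP; exact: measurable_powR_comp.
    by apply/measurable_EFinP; apply: measurable_indic; exact: measurable_cbox.
  rewrite (integral_indicM _ (cbox c (2 * l))).
  rewrite -(ge0_integralZl_EFin _ measurableT Z0 mZ) ?powR_ge0//.
  apply: ge0_le_integral => //.
  - move=> z zT; apply: mule_ge0; [by rewrite lee_fin powR_ge0|exact: Z0 zT].
  - exact: measurable_funeM.
  - exact: measurable_funeM.
  move=> z _; apply: (@le_trans _ _ (((r m `^ (alpha - n%:R)) `^ t)%:E * (lam z `^ t)%:E)).
    apply: lee_wpmul2l; first by rewrite lee_fin powR_ge0.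
    rewrite /Z -[leRHS]mul1e; apply: lee_wpmul2r; first by rewrite lee_fin powR_ge0.
    exact: indic_le1.
  have -> : Y z = (l `^ (- e p1 q1) * w x1 p1 q1 m z + l `^ (- e p2 q2) * w x2 p2 q2 m z)%R%:E.
    by rewrite EFinD !EFinM.
  rewrite -!EFinM lee_fin -powRM ?powR_ge0//.
  have -> : (r m `^ (alpha - n%:R) * lam z = r m `^ alpha * x1 m z * x2 m z)%R.
    have -> : (r m `^ alpha = r m `^ (alpha - n%:R) * r m ^+ n)%R.
      by rewrite -(powR_mulrn n (ltW (r0 m))) -powRD ?(gt_eqF (r0 m)) ?implybT// subrK.
    by rewrite /lam; ring.
  apply: le_trans (young_scaled d0 p10 p20 q10 q20 p0 q0 s0 hp12 hq12 hsp hts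
    (r0 m) l0 (x10 m z) (x20 m z)) _.
  rewrite ler_wpM2l ?powR_ge0// le_eqVlt; apply/orP; left; apply/eqP.
  by rewrite /w /e; congr (_ + _)%R; rewrite mulrC.
have Iw0 a pi qi m : 0 <= \int[bl]_z (w a pi qi m z)%:E.
  by apply: integral_ge0 => z _; rewrite lee_fin.
have lw0 a pi qi m : 0 <= (l `^ (- e pi qi))%:E * \int[bl]_z (w a pi qi m z)%:E.
  by rewrite mule_ge0// lee_fin powR_ge0.
apply: (@le_trans _ _ (\sum_(0 <= m <oo) ((2 * M)%:E *
    ((l `^ (- e p1 q1))%:E * \int[bl]_z (w x1 p1 q1 m z)%:E +
     (l `^ (- e p2 q2))%:E * \int[bl]_z (w x2 p2 q2 m z)%:E)))).
  apply: lee_nneseries => [m _ _|m _]; last exact: step.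
  by apply: integral_ge0 => x _; exact: poweR_ge0.
rewrite nneseriesZl; last by move=> m _; rewrite adde_ge0.
rewrite nneseriesD; [|by move=> *; exact: lw0|by move=> *; exact: lw0].
have pull (C : R) (u : nat -> \bar R) : (forall m, 0 <= u m) ->
    \sum_(0 <= m <oo) (C%:E * u m) = C%:E * \sum_(0 <= m <oo) u m.
  by move=> u0; rewrite nneseriesZl.
have Sw a pi qi := pull (l `^ (- e pi qi))%R _ (Iw0 a pi qi).
rewrite [X in _ * (X + _)]Sw [X in _ * (_ + X)]Sw.
have -> : (2 * (C1 + C2) * side j `^ (n%:R - n%:R * t / s) = 2 * M * (C1 + C2))%R.
  by rewrite /M /l; ring.
rewrite (EFinM (2 * M)); apply: lee_wpmul2l; first by rewrite lee_fin mulr_ge0 ?powR_ge0.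
have cancel (C b : R) (S : \bar R) : S <= (C * side j `^ b)%:E -> (l `^ (- b))%:E * S <= C%:E.
  move=> hS; apply: (@le_trans _ _ ((l `^ (- b))%:E * (C * side j `^ b)%:E)).
    by rewrite lee_wpmul2l// lee_fin powR_ge0.
  rewrite -EFinM lee_fin mulrCA /l -powRD ?(gt_eqF l0) ?implybT// addNr powRr0 mulr1//.
by rewrite EFinD; apply: leeD; apply: cancel.
Qed.

(** The exponent is n (1/s - 1/p2), and s < q2 <= p2. *)
Let beta_gt0 : (0 < n%:R / p1 - alpha)%R.
Proof.
rewrite (exponent_alpha d0 p0 hsp) subr_gt0 ltr_pM2l// hp12 ltrBlDr ltrD2l.
by rewrite ltf_pV2 ?posrE//; exact: lt_le_trans sq2 qp2.
Qed.

Let coarse (f1 f2 : T -> R) (j : int) x := \sum_(0 <= m <oo)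
  ((side (j - m.+1%:Z) `^ (alpha - n%:R))%:E *
   bilinear_average (side (j - m.+1%:Z)) (EFin \o f1) (EFin \o f2) x).

(** The function is integrated first and raised to the power t afterwards.  The
    integrals over Q decay like 2^-(m beta) with beta = n / p1 - alpha, and the sum
    is a level C l^(-n / s) times the volume of Q, since
    n / s = beta + n / p2. *)
Lemma coarse_scales_estimate : exists2 C : R, (0 < C)%R &
  forall (f1 f2 : T -> R) (j : int) (k : 'I_n -> int),
  measurable_fun setT f1 -> (forall x, 0 <= f1 x)%R -> morrey_bound p1 q1 f1 ->
  measurable_fun setT f2 -> (forall x, 0 <= f2 x)%R -> morrey_bound p2 q2 f2 ->
  \int[bl]_(x in dyadic_cube j k) (coarse f1 f2 j x `^ t)
  <= (C * side j `^ (n%:R - n%:R * t / s))%:E.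
Proof.
pose K : R := (8 ^+ n + 9 ^+ n)%R.
have K0 : (0 < K)%R by rewrite addr_gt0// exprn_gt0.
pose beta : R := (n%:R / p1 - alpha)%R.
have rho1 : (2 `^ (- beta) < 1 :> R)%R.
  by rewrite powRN invf_lt1 ?powR_gt0// gt1_powR ?ltr1n//; exact: beta_gt0.
have rhoc : (0 < (1 - 2 `^ (- beta))^-1 :> R)%R by rewrite invr_gt0 subr_gt0.
pose C' : R := (K * K * (1 - 2 `^ (- beta))^-1)%R.
have C'0 : (0 < C')%R by rewrite !mulr_gt0.
exists (2 * C' `^ t)%R; first by rewrite mulr_gt0// powR_gt0.
move=> f1 f2 j k mf1 f10 fM1 mf2 f20 fM2.
pose l : R := side j; have l0 : (0 < l)%R := side_gt0 j.
pose r m : R := side (j - m.+1%:Z); have r0 m : (0 < r m)%R := side_gt0 _.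
have rl m : (l <= r m)%R.
  by rewrite /r side_coarse ler_peMr ?(ltW l0)// exprn_ege1// ler1n.
have mF1 : measurable_fun setT (EFin \o f1) by exact/measurable_EFinP.
have mF2 : measurable_fun setT (EFin \o f2) by exact/measurable_EFinP.
have F10 x : 0 <= (EFin \o f1) x by rewrite lee_fin.
have F20 x : 0 <= (EFin \o f2) x by rewrite lee_fin.
pose B m := bilinear_average (r m) (EFin \o f1) (EFin \o f2).
have mB m : measurable_fun setT (B m) by exact: measurable_bilinear_average.
have B0 m x : 0 <= B m x by exact: bilinear_average_ge0.
have mQ := @measurable_dyadic_cube R n j k.
pose M2 : R := (K * (l `^ (- (n%:R / p2)) * l ^+ n))%R.
have M20 : (0 <= M2)%R by rewrite !mulr_ge0 ?powR_ge0 ?exprn_ge0 ?ltW.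
have hM2 w : box_integral (2 * l) (EFin \o f2) w <= M2%:E.
  by apply: morrey_box => //; exact: ltW.
(* The bound at scale r = 2^(m+1) l is r^(-beta) K M2, at most the m-th term of
   a geometric progression. *)
pose D (m : nat) : R := (l `^ (- beta) * (2 `^ (- beta)) ^+ m * (K * M2))%R.
have step m : \int[bl]_(x in dyadic_cube j k) ((r m `^ (alpha - n%:R))%:E * B m x) <= (D m)%:E.
  rewrite ge0_integralZl_EFin ?powR_ge0//; last exact: measurable_funTS.
  apply: (@le_trans _ _ ((r m `^ (alpha - n%:R))%:E *
      ((K * (r m `^ (- (n%:R / p1)) * r m ^+ n))%:E * M2%:E))).
    rewrite lee_wpmul2l ?lee_fin ?powR_ge0//.
    apply: (le_trans (integral_bilinear_average_large mF1 F10 mF2 F20 (rl m) mQ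
      (@dyadic_cube_cbox R n j k) hM2)).
    by rewrite lee_wpmul2r ?lee_fin//; apply: morrey_box => //; exact: ltW.
  rewrite -!EFinM lee_fin.
  have -> : (r m `^ (alpha - n%:R) * (K * (r m `^ (- (n%:R / p1)) * r m ^+ n) * M2) =
      r m `^ (- beta) * (K * M2))%R.
    rewrite -(powR_mulrn n (ltW (r0 m))).
    have -> : (- beta = (alpha - n%:R) + (- (n%:R / p1) + n%:R))%R by rewrite /beta; ring.
    rewrite (@powRD _ _ (alpha - n%:R)) ?(gt_eqF (r0 m)) ?implybT//.
    by rewrite (@powRD _ _ (- (n%:R / p1))) ?(gt_eqF (r0 m)) ?implybT//; ring.
  rewrite /D; apply: (ler_wpM2r (mulr_ge0 (ltW K0) M20)).
  rewrite /r side_coarse powR_geometric// ler_wpM2l ?powR_ge0//.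
  by rewrite exprS ler_piMl ?exprn_ge0 ?powR_ge0// ltW.
have rB0 m x : 0 <= (r m `^ (alpha - n%:R))%:E * B m x.
  by rewrite mule_ge0 ?lee_fin ?powR_ge0.
have mrB m : measurable_fun setT (fun x => (r m `^ (alpha - n%:R))%:E * B m x).
  exact: measurable_funeM.
have mS : measurable_fun setT (coarse f1 f2 j).
  rewrite (_ : coarse f1 f2 j = fun x => \sum_(0 <= m <oo) ((r m `^ (alpha - n%:R))%:E * B m x))//.
  by apply: ge0_emeasurable_sum => *; [exact: rB0|exact: mrB].
pose lam : R := (C' * l `^ (- (n%:R / s)))%R.
have lam0 : (0 <= lam)%R by rewrite mulr_ge0 ?powR_ge0// ltW.
have hS : \int[bl]_(x in dyadic_cube j k) coarse f1 f2 j x <= (lam * l ^+ n)%:E.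
  rewrite integral_nneseries//;
    [|by move=> m; first [exact: measurable_funTS (mrB m)|move=> *; exact: rB0]..].
  apply: nneseries_le_bound => [m|N]; first by apply: integral_ge0 => x _; exact: rB0.
  apply: (@le_trans _ _ (\sum_(m < N) (D m)%:E)); first by apply: lee_sum => m _; exact: step.
  rewrite sumEFin lee_fin -mulr_suml -mulr_sumr.
  apply: (@le_trans _ _ (l `^ (- beta) * (1 - 2 `^ (- beta))^-1 * (K * M2))%R).
    apply: (ler_wpM2r (mulr_ge0 (ltW K0) M20)); rewrite ler_wpM2l ?powR_ge0//.
    by apply: geometric_sum_le; rewrite ?powR_ge0.
  rewrite /lam /C' /M2 le_eqVlt; apply/orP; left; apply/eqP.
  have -> : (- (n%:R / s) = - beta + - (n%:R / p2))%R.
    by rewrite hsp hp12 /beta; field; rewrite ?gt_eqF.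
  rewrite powRD ?(gt_eqF l0) ?implybT//; ring.
have bQ : (bl : {measure set T -> \bar R}) (dyadic_cube j k) <= (l ^+ n)%:E.
  by rewrite le_eqVlt; apply/orP; left; apply/eqP; exact: borel_lebesgue_dyadic_cube.
apply: (le_trans (concave_integral_le mQ bQ (measurable_funTS mS) _ lam0 t0 t1 hS)).
  by move=> x; apply: nneseries_ge0 => *; exact: rB0.
rewrite lee_fin /lam powRM ?powR_ge0 ?(ltW C'0)// -powRrM le_eqVlt; apply/orP; left; apply/eqP.
rewrite -(powR_mulrn n (ltW l0)) -mulrA -[in LHS]mulrA -powRD ?(gt_eqF l0) ?implybT//.
rewrite mulrA; congr (_ * powR _ _)%R; field; rewrite ?gt_eqF//.
Qed.

Lemma borel_morrey_estimate : exists2 C : R, (0 < C)%R &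
  forall (f1 f2 : T -> R) (j : int) (k : 'I_n -> int),
  measurable_fun setT f1 -> (forall x, 0 <= f1 x)%R -> morrey_bound p1 q1 f1 ->
  measurable_fun setT f2 -> (forall x, 0 <= f2 x)%R -> morrey_bound p2 q2 f2 ->
  \int[bl]_(x in dyadic_cube j k) (borel_J alpha (EFin \o f1) (EFin \o f2) x `^ t)
  <= (C * side j `^ (n%:R - n%:R * t / s))%:E.
Proof.
have [C1 C10 H1] := fine_scales_estimate; have [C2 C20 H2] := coarse_scales_estimate.
exists ((2 ^+ n) `^ t * (C1 + C2))%R; first by rewrite mulr_gt0 ?addr_gt0 ?powR_gt0 ?exprn_gt0.
move=> f1 f2 j k mf1 f10 fM1 mf2 f20 fM2.
have mF1 : measurable_fun setT (EFin \o f1) by exact/measurable_EFinP.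
have mF2 : measurable_fun setT (EFin \o f2) by exact/measurable_EFinP.
have F10 x : 0 <= (EFin \o f1) x by rewrite lee_fin.
have F20 x : 0 <= (EFin \o f2) x by rewrite lee_fin.
have mQ := @measurable_dyadic_cube R n j k.
pose u (r : nat -> R) m x := (r m `^ (alpha - n%:R))%:E *
   bilinear_average (r m) (EFin \o f1) (EFin \o f2) x.
have mu r m : measurable_fun setT (u r m).
  by apply: measurable_funeM; exact: measurable_bilinear_average.
have u0 r m x : 0 <= u r m x.
  by rewrite mule_ge0 ?lee_fin ?powR_ge0// bilinear_average_ge0.
pose r1 m : R := side (j + m%:Z); pose r2 m : R := side (j - m.+1%:Z).
have S0 r x : 0 <= \sum_(0 <= m <oo) u r m x by apply: nneseries_ge0 => *; exact: u0.
have St0 r x : 0 <= \sum_(0 <= m <oo) (u r m x `^ t).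
  by apply: nneseries_ge0 => *; exact: poweR_ge0.
have mut r m : measurable_fun setT (fun x => u r m x `^ t) by exact: measurable_poweR_comp.
have mS1 : measurable_fun setT (fun x => \sum_(0 <= m <oo) (u r1 m x `^ t)).
  by apply: ge0_emeasurable_sum => *; [exact: poweR_ge0|exact: mut].
have mS2 : measurable_fun setT (fun x => coarse f1 f2 j x `^ t).
  have mc : measurable_fun setT (fun x => \sum_(0 <= m <oo) u r2 m x).
    by apply: ge0_emeasurable_sum => *; [exact: u0|exact: mu].
  exact: (measurable_poweR_comp t mc).
have mJ := measurable_borel_J alpha mF1 mF2 F10 F20.
apply: (@le_trans _ _ (\int[bl]_(x in dyadic_cube j k) (((2 ^+ n) `^ t)%:E *
    (\sum_(0 <= m <oo) (u r1 m x `^ t) + coarse f1 f2 j x `^ t)))).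
  apply: ge0_le_integral => //.
  - by move=> x _; exact: poweR_ge0.
  - by apply: measurable_funTS; exact: measurable_poweR_comp.
  - by apply: measurable_funTS; apply: measurable_funeM; exact: emeasurable_funD.
  move=> x _.
  have hJ := borel_J_le j x a0 an mf1 f10 mf2 f20.
  have J0 := borel_J_ge0 alpha x F10 F20.
  apply: (@le_trans _ _ (((2 ^+ n)%:E * (\sum_(0 <= m <oo) u r1 m x + coarse f1 f2 j x)) `^ t)).
    apply: gt0_ler_poweR; rewrite ?in_itv/= ?leey ?andbT ?(ltW t0)//.
    by rewrite mule_ge0 ?adde_ge0 ?lee_fin ?exprn_ge0//; exact: (S0 r2).
  rewrite poweRM ?poweR_EFin ?lee_fin ?exprn_ge0// ?adde_ge0//; last exact: (S0 r2).
  rewrite lee_wpmul2l ?lee_fin ?powR_ge0//.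
  apply: (le_trans (poweR_sub_add (S0 r1 x) (S0 r2 x) t0 t1)).
  by rewrite leeD2r// poweR_nneseries_le// => m; exact: u0.
have Sc0 x : 0 <= \sum_(0 <= m <oo) (u r1 m x `^ t) + coarse f1 f2 j x `^ t.
  by rewrite adde_ge0// poweR_ge0.
have mSc : measurable_fun (dyadic_cube j k : set T)
    (fun x => \sum_(0 <= m <oo) (u r1 m x `^ t) + coarse f1 f2 j x `^ t).
  by apply: measurable_funTS; exact: emeasurable_funD.
rewrite (ge0_integralZl_EFin _ mQ (fun x _ => Sc0 x) mSc) ?powR_ge0//.
rewrite -mulrA (EFinM ((2 ^+ n) `^ t)) lee_wpmul2l ?lee_fin ?powR_ge0//.
rewrite ge0_integralD//; last 3 first.
- exact: measurable_funTS.
- by move=> x _; exact: poweR_ge0.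
- exact: measurable_funTS.
rewrite mulrDl EFinD; apply: leeD; last exact: H2.
rewrite integral_nneseries//; last 2 first.
- by move=> m; exact: measurable_funTS.
- by move=> m x _; exact: poweR_ge0.
exact: H1.
Qed.

End borel_estimate.

(** * The estimate for Lebesgue measurable functions *)

Section morrey_norms.
Context {R : realType} (n : nat).
Local Notation mR := (measurableTypeR R).
Local Notation T := (n.-tuple mR).
Local Notation bl := (borel_lebesgue R n).
Local Notation mu := (lebesgue R n).
Implicit Types (f : Rn R n -> \bar R) (p k A : R).
Local Open Scope ereal_scope.

Lemma measurable_Rn_dyadic_cube (j : int) l : measurable (dyadic_cube j l : set (Rn R n)).
Proof. by apply: borel_measurable; exact: measurable_dyadic_cube. Qed.

(** Taking the k-th power turns the supremum of roots into bounds for integrals,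
    one for each cube; [morrey_norm_le] is the way back. *)
Lemma cube_integral_le p k A f (j : int) (l : 'I_n -> int) : (0 < p)%R -> (0 < k)%R -> (0 <= A)%R ->
  morrey_norm p k f <= A%:E ->
  \int[mu]_(x in dyadic_cube j l) (`|f x| `^ k) <=
    (A `^ k * side j `^ (n%:R - n%:R * k / p))%:E.
Proof.
move=> p0 k0 A0 fA; have l0 : (0 < side j :> R)%R := side_gt0 j.
have kn0 : k != 0%R by rewrite gt_eqF.
have V0 : (0 < side j ^+ n :> R)%R by rewrite exprn_gt0.
set I := \int[mu]_(x in _) _.
have I0 : 0 <= I by apply: integral_ge0 => x _; exact: poweR_ge0.
have : mu (dyadic_cube j l) `^ (p^-1 - k^-1) * I `^ k^-1 <= A%:E.
  apply: le_trans fA; apply: ereal_sup_ubound; exists (dyadic_cube j l) => //.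
  by exists j, l.
rewrite lebesgue_dyadic_cube poweR_EFin.
case: I I0 => [i| |]// i0; last first.
  by rewrite poweRyr ?invr_neq0// gt0_muley ?lte_fin ?powR_gt0// leye_eq.
rewrite poweR_EFin -EFinM !lee_fin => h.
have ik : (i = (i `^ k^-1) `^ k)%R by rewrite -powRrM mulVf// powRr1.
rewrite ik.
apply: (@le_trans _ _ ((A * (side j ^+ n) `^ (k^-1 - p^-1)) `^ k)%R).
  apply: ge0_ler_powR; rewrite ?nnegrE ?mulr_ge0 ?powR_ge0 ?(ltW k0)//.
  rewrite -[(k^-1 - _)%R]opprB powRN ler_pdivlMr ?powR_gt0// mulrC.
  exact: h.
rewrite powRM ?powR_ge0// -powR_mulrn ?(ltW l0)// -!powRrM le_eqVlt; apply/orP; left; apply/eqP.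
by congr (_ * powR _ _)%R; field; rewrite !gt_eqF.
Qed.

Lemma morrey_norm_le p k A f : (0 < p)%R -> (0 < k)%R -> (0 <= A)%R ->
  (forall (j : int) (l : 'I_n -> int), \int[mu]_(x in dyadic_cube j l) (`|f x| `^ k) <=
    (A `^ k * side j `^ (n%:R - n%:R * k / p))%:E) ->
  morrey_norm p k f <= A%:E.
Proof.
move=> p0 k0 A0 h; apply: ge_ereal_sup => _ [_ [j [l ->]] <-].
have l0 : (0 < side j :> R)%R := side_gt0 j.
rewrite lebesgue_dyadic_cube poweR_EFin.
apply: (@le_trans _ _ (((side j ^+ n) `^ (p^-1 - k^-1))%:E *
   (A `^ k * side j `^ (n%:R - n%:R * k / p))%:E `^ k^-1)).
  rewrite lee_wpmul2l ?lee_fin ?powR_ge0//.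
  apply: gt0_ler_poweR; rewrite ?in_itv/= ?leey ?andbT ?invr_ge0 ?(ltW k0)//.
  - by apply: integral_ge0 => x _; exact: poweR_ge0.
  - by rewrite lee_fin mulr_ge0 ?powR_ge0.
rewrite poweR_EFin -EFinM lee_fin powRM ?powR_ge0// -powR_mulrn ?(ltW l0)// -!powRrM.
rewrite mulfV ?gt_eqF// powRr1// mulrCA -powRD ?(gt_eqF l0) ?implybT//.
have -> : (n%:R * (p^-1 - k^-1) + (n%:R - n%:R * k / p) / k = 0)%R.
  by field; rewrite !gt_eqF.
by rewrite powRr0 mulr1.
Qed.

Lemma morrey_norm_fin p k f : morrey_norm p k f < +oo ->
  exists2 A : R, (0 <= A)%R & morrey_norm p k f = A%:E.
Proof.
have : 0 <= morrey_norm p k f.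
  apply: le_ereal_sup_tmp.
  exists (mu (dyadic_cube 0 (fun=> 0%R)) `^ (p^-1 - k^-1) *
    (\int[mu]_(x in dyadic_cube 0 (fun=> 0%R)) (`|f x| `^ k)) `^ k^-1) => //.
    by exists (dyadic_cube 0 (fun=> 0%R)) => //; exists 0%R, (fun=> 0%R).
  by rewrite mule_ge0 ?poweR_ge0.
case: (morrey_norm p k f) => [x| |]//; rewrite lee_fin => x0 _.
by exists x.
Qed.

Lemma grid_cover (j : int) (x : T) : exists l : {ffun 'I_n -> int}, dyadic_cube j l x.
Proof.
exists [ffun i => Num.floor (tnth x i / side j : R)] => i.
have s0 := side_gt0 j (R := R); rewrite ffunE /Rn_coord -/(side j).
by have := floor_itv (tnth x i / side j : R); rewrite ler_pdivlMr// ltr_pdivrMr.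
Qed.

(** On each cube of side 1 the integral of |f|^k is finite, and countably many of
    these cubes cover the space. *)
Lemma morrey_ae_fin p k f : (0 < p)%R -> (0 < k)%R -> morrey p k f ->
  {ae mu, forall x, f x \is a fin_num}.
Proof.
move=> p0 k0 [mf foo]; have kn0 : k != 0%R by rewrite gt_eqF.
have [A A0 fA] : exists2 A : R, (0 <= A)%R & morrey_norm p k f <= A%:E.
  move: foo; case: (morrey_norm p k f) => [a| |]// _; [exists `|a|%R|exists 0%R] => //.
  - by rewrite lee_fin ler_norm.
  - by rewrite leNye.
have mfk : measurable_fun setT (fun x => `|f x| `^ k).
  by apply: measurable_poweR_comp; exact: measurableT_comp.
(* An integrable function is finite almost everywhere; f and |f|^k are infinite
   at the same points. *)
have aeQ l : {ae mu, forall x, dyadic_cube 0 l x -> `|f x| `^ k \is a fin_num}.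
  apply: integrable_ae; first exact: measurable_Rn_dyadic_cube.
  apply/integrableP; split; first exact: measurable_funTS.
  under eq_integral do rewrite gee0_abs ?poweR_ge0//.
  exact: le_lt_trans (cube_integral_le 0 l p0 k0 A0 fA) (ltry _).
have : {ae mu, forall x, forall m : nat, forall l : {ffun 'I_n -> int}, unpickle m = Some l ->
    dyadic_cube 0 l x -> `|f x| `^ k \is a fin_num}.
  apply: ae_foralln => m; case: (unpickle m) => [l|]; last first.
    by apply: aeW => x l.
  by have := aeQ l; apply: filterS => x hx _ [<-].
apply: filterS => x hx; have [l xl] := grid_cover 0 x.
have := hx (pickle l) l (pickleK l) xl.
by case: (f x) => [a| |]// h; have : (+oo : \bar R) `^ k \is a fin_num by []; rewrite poweRyr.
Qed.

Lemma ae_and (P Q S : Rn R n -> Prop) : (forall x, P x -> Q x -> S x) ->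
  {ae mu, forall x, P x} -> {ae mu, forall x, Q x} -> {ae mu, forall x, S x}.
Proof.
move=> PQS aeP aeQ; apply: (negligibleS _ (negligibleU aeP aeQ)) => x nS.
apply: contrapT => /not_orP[/contrapT Px /contrapT Qx]; exact/nS/PQS.
Qed.

Lemma ae_imply (P S : Rn R n -> Prop) : (forall x, P x -> S x) ->
  {ae mu, forall x, P x} -> {ae mu, forall x, S x}.
Proof. by move=> PS aeP; apply: (negligibleS _ aeP) => x nS Px; exact/nS/PS. Qed.

Lemma morrey_representative p k f : (0 < p)%R -> (0 < k)%R ->
  (forall x, 0 <= f x) -> morrey p k f ->
  exists g : T -> R, [/\ measurable_fun setT g, (forall x, 0 <= g x)%R &
    {ae mu, forall x, f x = (g x)%:E}].
Proof.
move=> p0 k0 f0 fM.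
have mf : measurable_fun setT (fine \o f).
  by apply: (measurableT_comp (fine_measurable measurableT)); exact: fM.1.
have [g [N [mg mN N0 gN gE]]] := borel_representative mf.
exists g; split => //.
  move=> x; have [Nx|nN] := pselect (N x); first by rewrite gN.
  by rewrite gE//= fine_ge0.
have aeN : {ae mu, forall x, ~ N x}.
  exists (N : set (Rn R n)); split; first exact: borel_measurable.
  - by rewrite lebesgue_borel.
  - by move=> x /= /contrapT.
apply: ae_and aeN (morrey_ae_fin p0 k0 fM) => x nN fx.
by rewrite gE//= fineK.
Qed.

Lemma Rn_add_affine (x y : Rn R n) : Rn_add x y = affine 1 x y.
Proof. by apply: eq_from_tnth => i; rewrite !tnth_mktuple mul1r addrC. Qed.

Lemma Rn_sub_affine (x y : Rn R n) : Rn_sub x y = affine (-1) x y.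
Proof. by apply: eq_from_tnth => i; rewrite !tnth_mktuple mulN1r addrC. Qed.

Lemma lebesgue_complete : measure_is_complete mu.
Proof. exact: measure_is_complete_caratheodory. Qed.

(** The two integrands agree for almost every y, for every x; completeness of
    Lebesgue measure makes the first one measurable. *)
Lemma borel_J_eq (alpha : R) f1 f2 (g1 g2 : T -> R) :
  measurable_fun setT g1 -> (forall x, 0 <= g1 x)%R -> {ae mu, forall x, f1 x = (g1 x)%:E} ->
  measurable_fun setT g2 -> (forall x, 0 <= g2 x)%R -> {ae mu, forall x, f2 x = (g2 x)%:E} ->
  (forall x, 0 <= f1 x) -> (forall x, 0 <= f2 x) ->
  forall x, J alpha f1 f2 x = borel_J alpha (EFin \o g1) (EFin \o g2) x.
Proof.
move=> mg1 g10 fg1 mg2 g20 fg2 f10 f20 x.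
pose G (y : T) := (EFin \o g1) (affine 1 x y) * (EFin \o g2) (affine (-1) x y) *
  (riesz_kernel alpha y)%:E.
have mG : measurable_fun setT G.
  apply: emeasurable_funM; last by apply/measurable_EFinP; exact: measurable_riesz_kernel.
  apply: emeasurable_funM; apply: measurable_comp_affine => //; exact/measurable_EFinP.
have k0 y : (0 <= riesz_kernel alpha y)%R by rewrite invr_ge0 powR_ge0.
have G0 y : 0 <= G y by rewrite !mule_ge0//= lee_fin.
rewrite /borel_J -(integral_lebesgue_borel measurableT mG G0) /J.
pose F (y : Rn R n) := f1 (Rn_add x y) * f2 (Rn_sub x y) * (riesz_kernel alpha y)%:E.
have N1 : (-1 != 0 :> R)%R by rewrite oppr_eq0 oner_eq0.
have FG : ae_eq mu setT F G.
  apply: ae_and (ae_affine x (oner_neq0 R) fg1) (ae_affine x N1 fg2) => y e1 e2 _.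
  by rewrite /F Rn_add_affine Rn_sub_affine e1 e2.
have mG' : measurable_fun setT (G : Rn R n -> \bar R) by exact: borel_measurable_fun.
have mF : measurable_fun setT F.
  apply: (ae_measurable_fun lebesgue_complete _ mG').
  by apply: ae_imply FG => y h yT; rewrite h.
apply: ge0_ae_eq_integral => //.
by move=> y _; rewrite !mule_ge0// lee_fin.
Qed.

Lemma borel_J_scale (alpha a1 a2 : R) (g1 g2 : T -> R) x :
  measurable_fun setT g1 -> measurable_fun setT g2 ->
  (forall x, 0 <= g1 x)%R -> (forall x, 0 <= g2 x)%R -> (0 <= a1)%R -> (0 <= a2)%R ->
  borel_J alpha (EFin \o (fun x => a1 * g1 x)%R) (EFin \o (fun x => a2 * g2 x)%R) x =
  (a1 * a2)%:E * borel_J alpha (EFin \o g1) (EFin \o g2) x.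
Proof.
move=> mg1 mg2 g10 g20 a10 a20.
rewrite /borel_J -ge0_integralZl_EFin ?mulr_ge0//; last 2 first.
- by move=> y _; rewrite !mule_ge0//= lee_fin// invr_ge0 powR_ge0.
- apply: emeasurable_funM; last by apply/measurable_EFinP; exact: measurable_riesz_kernel.
  apply: emeasurable_funM; apply: measurable_comp_affine => //;
  first [exact: measurable_cst|exact/measurable_EFinP].
apply: eq_integral => y _; rewrite /= -!EFinM; congr (_%:E); ring.
Qed.

Lemma morrey_bound_scale (p k A : R) f (g : T -> R) : (0 < p)%R -> (0 < k)%R -> (0 < A)%R ->
  measurable_fun setT g -> (forall x, 0 <= g x)%R -> {ae mu, forall x, f x = (g x)%:E} ->
  measurable_fun setT f ->
  morrey_norm p k f <= A%:E -> morrey_bound p k (fun x => A^-1 * g x)%R.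
Proof.
move=> p0 k0 A0 mg g0 fg mf fA j l.
have mgk : measurable_fun setT (fun x => (g x `^ k)%:E).
  by apply/measurable_EFinP; exact: measurable_powR_comp.
have mQ := @measurable_dyadic_cube R n j l.
have := cube_integral_le j l p0 k0 (ltW A0) fA.
rewrite (_ : \int[mu]_(x in _) _ = \int[bl]_(x in dyadic_cube j l) (g x `^ k)%:E); last first.
  rewrite -(integral_lebesgue_borel mQ); last 2 first.
  - exact: measurable_funTS.
  - by move=> x; rewrite lee_fin powR_ge0.
  apply: ge0_ae_eq_integral.
  - exact: measurable_Rn_dyadic_cube.
  - by apply: measurable_funTS; apply: measurable_poweR_comp; exact: measurableT_comp.
  - by apply: measurable_funTS; exact: borel_measurable_fun.
  - by move=> x _; exact: poweR_ge0.
  - by move=> x _; rewrite lee_fin powR_ge0.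
  - by apply: ae_imply fg => x -> _; rewrite gee0_abs ?lee_fin// poweR_EFin.
move=> h; under eq_integral do rewrite powRM ?invr_ge0 ?(ltW A0)// EFinM.
rewrite ge0_integralZl_EFin ?powR_ge0//; last 2 first.
- by move=> x _; rewrite lee_fin powR_ge0.
- exact: measurable_funTS.
apply: (@le_trans _ _ ((A^-1 `^ k)%:E * (A `^ k * side j `^ (n%:R - n%:R * k / p))%:E)).
  by rewrite lee_wpmul2l ?lee_fin ?powR_ge0.
rewrite -EFinM lee_fin mulrA -powRM ?invr_ge0 ?(ltW A0)// mulVf ?gt_eqF//.
by rewrite powR1 mul1r.
Qed.

End morrey_norms.

Section main_estimate.
Context {R : realType} (n : nat).
Local Notation mR := (measurableTypeR R).
Local Notation T := (n.-tuple mR).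
Local Notation bl := (borel_lebesgue R n).
Local Notation mu := (lebesgue R n).
Variables (alpha p1 p2 q1 q2 p q s t : R).
Hypotheses (n0 : (0 < n)%N) (a0 : 0 < alpha) (an : alpha < n%:R)
  (q11 : 1 < q1) (qp1 : q1 <= p1) (q21 : 1 < q2) (qp2 : q2 <= p2)
  (q0 : 0 < q) (qp : q <= p) (t0 : 0 < t) (t1 : t <= 1) (s1 : 1 <= s)
  (hp12 : p^-1 = p1^-1 + p2^-1) (hq12 : q^-1 = q1^-1 + q2^-1)
  (hsp : s^-1 = p^-1 - alpha / n%:R) (hts : q / p = t / s) (sq2 : s < q2).

Let q10 : 0 < q1. Proof. exact: lt_trans q11. Qed.
Let q20 : 0 < q2. Proof. exact: lt_trans q21. Qed.
Let p10 : 0 < p1. Proof. exact: lt_le_trans qp1. Qed.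
Let p20 : 0 < p2. Proof. exact: lt_le_trans qp2. Qed.
Let s0 : 0 < s. Proof. exact: lt_le_trans s1. Qed.

Local Open Scope ereal_scope.

(** Homogeneity reduces to norms at most 1.  A norm may vanish, so the scaling is
    done with bounds A1 and A2 that exceed the norms by a small e, which tends
    to 0 at the end. *)
Lemma morrey_J_estimate : exists2 C : R, (0 < C)%R &
  forall f1 f2 : Rn R n -> \bar R,
    (forall x, 0 <= f1 x) -> (forall x, 0 <= f2 x) ->
    morrey p1 q1 f1 -> morrey p2 q2 f2 ->
    measurable_fun setT (J alpha f1 f2) /\
    morrey_norm s t (J alpha f1 f2) <=
      C%:E * morrey_norm p1 q1 f1 * morrey_norm p2 q2 f2.
Proof.
have [C C0 HC] := borel_morrey_estimate n0 a0 an q11 qp1 q21 qp2 q0 qp t0 t1 s1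
  hp12 hq12 hsp hts sq2.
exists (C `^ t^-1)%R; first exact: powR_gt0.
move=> f1 f2 f10 f20 fM1 fM2.
have [g1 [mg1 g10 fg1]] := morrey_representative p10 q10 f10 fM1.
have [g2 [mg2 g20 fg2]] := morrey_representative p20 q20 f20 fM2.
have JE := borel_J_eq alpha mg1 g10 fg1 mg2 g20 fg2 f10 f20.
have mF1 : measurable_fun setT (EFin \o g1) by exact/measurable_EFinP.
have mF2 : measurable_fun setT (EFin \o g2) by exact/measurable_EFinP.
have F10 x : 0 <= (EFin \o g1) x by rewrite lee_fin.
have F20 x : 0 <= (EFin \o g2) x by rewrite lee_fin.
have mJ : measurable_fun setT (J alpha f1 f2).
  rewrite (_ : J alpha f1 f2 = borel_J alpha (EFin \o g1) (EFin \o g2)); last exact/funext.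
  by apply: borel_measurable_fun; exact: measurable_borel_J.
split => //.
have key A1 A2 : (0 < A1)%R -> (0 < A2)%R -> morrey_norm p1 q1 f1 <= A1%:E ->
    morrey_norm p2 q2 f2 <= A2%:E ->
    morrey_norm s t (J alpha f1 f2) <= (C `^ t^-1 * A1 * A2)%:E.
  move=> A10 A20 fA1 fA2.
  have hM1 := morrey_bound_scale p10 q10 A10 mg1 g10 fg1 fM1.1 fA1.
  have hM2 := morrey_bound_scale p20 q20 A20 mg2 g20 fg2 fM2.1 fA2.
  apply: morrey_norm_le => // [|j l].
    by rewrite !mulr_ge0 ?powR_ge0 ?ltW.
  have mQ := @measurable_dyadic_cube R n j l.
  have hg (g : T -> R) A : (0 < A)%R -> measurable_fun setT g -> (forall x, 0 <= g x)%R ->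
      measurable_fun setT (fun x => A^-1 * g x)%R /\ (forall x, 0 <= A^-1 * g x)%R.
    move=> Ap mg g0; split; last by move=> x; rewrite mulr_ge0// invr_ge0 ltW.
    by apply: measurable_funM => //; exact: measurable_cst.
  have [mh1 h10] := hg _ _ A10 mg1 g10; have [mh2 h20] := hg _ _ A20 mg2 g20.
  have := HC _ _ j l mh1 h10 hM1 mh2 h20 hM2.
  set h1 := (fun x => A1^-1 * g1 x)%R; set h2 := (fun x => A2^-1 * g2 x)%R => hC.
  have B0 x : 0 <= borel_J alpha (EFin \o h1) (EFin \o h2) x.
    by apply: borel_J_ge0 => y; rewrite lee_fin; first [exact: h10|exact: h20].
  have mB : measurable_fun setT (borel_J alpha (EFin \o h1) (EFin \o h2)).
    apply: measurable_borel_J => //; first [exact/measurable_EFinP|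
      by move=> y; rewrite lee_fin; first [exact: h10|exact: h20]].
  have JB x : J alpha f1 f2 x = (A1 * A2)%:E * borel_J alpha (EFin \o h1) (EFin \o h2) x.
    rewrite JE -borel_J_scale ?(ltW A10) ?(ltW A20)//.
    by congr (borel_J _ _ _ _); apply/funext => y;
      rewrite /= /h1 /h2 mulrA mulfV ?mul1r// gt_eqF.
  rewrite (_ : \int[mu]_(x in _) _ = \int[bl]_(x in dyadic_cube j l)
      (((A1 * A2) `^ t)%:E * borel_J alpha (EFin \o h1) (EFin \o h2) x `^ t)); last first.
    rewrite -(integral_lebesgue_borel mQ).
    - apply: eq_integral => x _; rewrite JB gee0_abs ?poweRM ?poweR_EFin//.
      + by rewrite lee_fin mulr_ge0// ltW.
      + by rewrite mule_ge0// lee_fin mulr_ge0// ltW.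
    - by apply: measurable_funTS; apply: measurable_funeM; exact: measurable_poweR_comp.
    - by move=> x; rewrite mule_ge0 ?poweR_ge0 ?lee_fin ?powR_ge0.
  have Bt0 x : dyadic_cube j l x -> 0 <= borel_J alpha (EFin \o h1) (EFin \o h2) x `^ t.
    by rewrite poweR_ge0.
  have mBt : measurable_fun (dyadic_cube j l : set T)
      (fun x => borel_J alpha (EFin \o h1) (EFin \o h2) x `^ t).
    by apply: measurable_funTS; exact: measurable_poweR_comp.
  rewrite (ge0_integralZl_EFin _ mQ Bt0 mBt) ?powR_ge0//.
  apply: (@le_trans _ _ (((A1 * A2) `^ t)%:E * (C * side j `^ (n%:R - n%:R * t / s))%:E)).
    by rewrite lee_wpmul2l ?lee_fin ?powR_ge0.
  rewrite -EFinM lee_fin.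
  have -> : ((C `^ t^-1 * A1 * A2) `^ t = (A1 * A2) `^ t * C)%R.
    rewrite -(mulrA (C `^ t^-1)%R) powRM ?powR_ge0 ?mulr_ge0 ?(ltW A10) ?(ltW A20)//.
    by rewrite -powRrM mulVf ?gt_eqF// powRr1 ?(ltW C0)// mulrC.
  by rewrite mulrA.
have [N1 N10 E1] := morrey_norm_fin fM1.2.
have [N2 N20 E2] := morrey_norm_fin fM2.2.
rewrite E1 E2; apply/lee_addgt0Pr => d d0.
(* (N1 + e) (N2 + e) exceeds N1 N2 by at most e (N1 + N2 + 1) when e <= 1. *)
pose D : R := (C `^ t^-1 * (N1 + N2 + 1))%R.
have C'0 : (0 < C `^ t^-1)%R by exact: powR_gt0.
have D0 : (0 < D)%R by rewrite mulr_gt0// ltr_wpDl// addr_ge0.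
pose e : R := Num.min 1%R (d / D)%R.
have e0 : (0 < e)%R by rewrite lt_min ltr01 divr_gt0.
have e1 : (e <= 1)%R by rewrite ge_min lexx.
have eD : (D * e <= d)%R by rewrite mulrC -ler_pdivlMr// ge_min lexx orbT.
have := key (N1 + e)%R (N2 + e)%R.
rewrite E1 E2 !ltr_wpDl// !lee_fin !lerDl (ltW e0) => /(_ isT isT isT isT) h.
apply: (le_trans h); rewrite -!EFinM -EFinD lee_fin.
apply: le_trans (lerD (lexx _) eD).
have -> : (C `^ t^-1 * (N1 + e) * (N2 + e) =
  C `^ t^-1 * N1 * N2 + C `^ t^-1 * (N1 + N2 + e) * e)%R by ring.
rewrite lerD2l ler_wpM2r ?(ltW e0)// ler_wpM2l ?(ltW C'0)//.
by rewrite lerD2l.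
Qed.

End main_estimate.

(** * Complex-valued functions *)

Section complex_modulus.
Context {R : rcfType}.
Local Open Scope complex_scope.
Implicit Types (z : R[i]).
Local Notation normc := ComplexField.Normc.normc.

Lemma normc_ge0 z : 0 <= normc z.
Proof. by case: z => a b; exact: sqrtr_ge0. Qed.

Lemma normr_Re_le z : `|complex.Re z| <= normc z.
Proof. by case: z => a b /=; rewrite -sqrtr_sqr ler_wsqrtr// lerDl sqr_ge0. Qed.

Lemma normr_Im_le z : `|complex.Im z| <= normc z.
Proof. by case: z => a b /=; rewrite -sqrtr_sqr ler_wsqrtr// lerDr sqr_ge0. Qed.

Lemma normc_le_normrD z : normc z <= `|complex.Re z| + `|complex.Im z|.
Proof.
case: z => a b /=; rewrite -[leRHS]ger0_norm ?addr_ge0// -[leRHS]sqrtr_sqr ler_wsqrtr//.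
by rewrite sqrrD !real_normK ?num_real// lerD2r lerDl mulrn_wge0 ?mulr_ge0.
Qed.

Lemma normc_realM z k : 0 <= k -> normc (z * k%:C) = normc z * k.
Proof. by move=> k0; rewrite ComplexField.Normc.normcM /= expr0n addr0 sqrtr_sqr ger0_norm. Qed.

End complex_modulus.

Section complex_estimate.
Context {R : realType} (n : nat).
Local Notation mR := (measurableTypeR R).
Local Notation T := (n.-tuple mR).
Local Notation bl := (borel_lebesgue R n).
Local Notation mu := (lebesgue R n).
Local Notation normc := ComplexField.Normc.normc.
Local Open Scope ereal_scope.

Lemma morrey_norm_dominated p k c A (f g : Rn R n -> \bar R) :
  (0 < p)%R -> (0 < k)%R -> (0 <= c)%R -> (0 <= A)%R ->
  measurable_fun setT f -> measurable_fun setT g -> (forall x, 0 <= g x) ->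
  (forall x, `|f x| <= c%:E * g x) ->
  morrey_norm p k g <= A%:E -> morrey_norm p k f <= (c * A)%:E.
Proof.
move=> p0 k0 c0 A0 mf mg g0 fg gA; have k0' := ltW k0.
apply: morrey_norm_le => // [|j l]; first by rewrite mulr_ge0.
have mQ := @measurable_Rn_dyadic_cube R n j l.
have mgk : measurable_fun (dyadic_cube j l) (fun x => `|g x| `^ k).
  by apply: measurable_funTS; apply: measurable_poweR_comp; exact: measurableT_comp.
have gk0 x : dyadic_cube j l x -> 0 <= `|g x| `^ k by move=> _; exact: poweR_ge0.
apply: (@le_trans _ _ (\int[mu]_(x in dyadic_cube j l) ((c `^ k)%:E * `|g x| `^ k))).
  apply: (@ge0_le_integral _ _ _ mu _ mQ).
  - by move=> x _; exact: poweR_ge0.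
  - by apply: measurable_funTS; apply: measurable_poweR_comp; exact: measurableT_comp.
  - exact: measurable_funeM.
  - move=> x _; rewrite -poweR_EFin -poweRM ?lee_fin ?abse_ge0//.
    rewrite gt0_ler_poweR// ?in_itv/= ?leey ?andbT ?abse_ge0 ?mule_ge0 ?lee_fin ?abse_ge0//.
    by rewrite (gee0_abs (g0 x)).
rewrite (ge0_integralZl_EFin _ mQ gk0 mgk) ?powR_ge0//.
apply: le_trans (lee_wpmul2l _ (cube_integral_le j l p0 k0 A0 gA)) _.
  by rewrite lee_fin powR_ge0.
by rewrite -EFinM lee_fin mulrA powRM.
Qed.

Lemma measurable_normc (f : Rn R n -> R[i]) :
  measurable_fun setT (fun x => complex.Re (f x)) ->
  measurable_fun setT (fun x => complex.Im (f x)) ->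
  measurable_fun setT (fun x => normc (f x)).
Proof.
move=> mRe mIm.
rewrite (_ : (fun x => _) = (fun x => (complex.Re (f x) ^+ 2 + complex.Im (f x) ^+ 2) `^ 2^-1)%R).
  by apply: measurable_powR_comp; apply: measurable_funD; exact: measurable_funX.
apply/funext => x; case: (f x) => a b /=.
by rewrite powR12_sqrt// addr_ge0// sqr_ge0.
Qed.

(** Joint measurability in (x, y) is available for the Borel function h only.  The
    integral of F x is that of h (x, -) for every x, and it depends on x in a Borel
    way by Tonelli's theorem for the positive and negative parts. *)
Lemma measurable_parametric_integral (h : T * T -> R) (F : Rn R n -> Rn R n -> R) :
  measurable_fun setT h ->
  (forall x, {ae mu, forall y, F x y = h (x, y)}) ->
  (forall x, measurable_fun setT (F x)) /\
  measurable_fun setT (fun x => (\int[mu]_y F x y)%R).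
Proof.
move=> mh Fh.
have mh2 x : measurable_fun setT (fun y : T => (h (x, y))%:E).
  apply/measurable_EFinP; exact: measurableT_comp mh (measurable_pair1 x).
have mF x : measurable_fun setT (fun y => (F x y)%:E).
  have mG : measurable_fun setT (fun y : Rn R n => (h (x, y))%:E) by exact: borel_measurable_fun.
  apply: (ae_measurable_fun (@lebesgue_complete R n) _ mG).
  by apply: ae_imply (Fh x) => y -> _.
split; first by move=> x; apply/measurable_EFinP; exact: mF.
have mpos : measurable_fun setT (fun x => \int[bl]_y (fun z => (h z)%:E)^\+ (x, y)).
  apply: measurable_integral2 => //.
  by apply: measurable_funepos; exact/measurable_EFinP.
have mneg : measurable_fun setT (fun x => \int[bl]_y (fun z => (h z)%:E)^\- (x, y)).
  apply: measurable_integral2 => //.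
  by apply: measurable_funeneg; exact/measurable_EFinP.
rewrite (_ : (fun x => _) = (fun x => fine (\int[bl]_y (fun z => (h z)%:E)^\+ (x, y) -
    \int[bl]_y (fun z => (h z)%:E)^\- (x, y)))).
  apply: borel_measurable_fun; apply: (measurableT_comp (fine_measurable measurableT)).
  exact: emeasurable_funB.
apply/funext => x; rewrite /Rintegral; congr fine.
have mG : measurable_fun setT (fun y : Rn R n => (h (x, y))%:E) by exact: borel_measurable_fun.
rewrite (_ : \int[mu]_y (F x y)%:E = \int[mu]_y (h (x, y))%:E); last first.
  apply: (ae_eq_integral _ _ measurableT (mF x) mG).
  by apply: ae_imply (Fh x) => y -> _.
rewrite integralE; congr (_ - _).
  rewrite (integral_lebesgue_borel measurableT (measurable_funepos (mh2 x)) (funepos_ge0 _)).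
  by apply: eq_integral => y _; rewrite !funeposE.
rewrite (integral_lebesgue_borel measurableT (measurable_funeneg (mh2 x)) (funeneg_ge0 _)).
by apply: eq_integral => y _; rewrite !funenegE.
Qed.

Lemma complex_representative (f : Rn R n -> R[i]) :
  measurable_fun setT (fun x => complex.Re (f x)) ->
  measurable_fun setT (fun x => complex.Im (f x)) ->
  exists g : (T -> R) * (T -> R), [/\ measurable_fun setT g.1,
    measurable_fun setT g.2 & {ae mu, forall x, f x = (g.1 x +i* g.2 x)%C}].
Proof.
have aux (h : Rn R n -> R) : measurable_fun setT h ->
    exists2 g : T -> R, measurable_fun setT g & {ae mu, forall x, h x = g x}.
  move=> mh; have [g [N [mg mN N0 gN gE]]] := borel_representative mh.
  exists g => //; exists (N : set (Rn R n)); split; first exact: borel_measurable.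
  - by rewrite lebesgue_borel.
  - by move=> x /= hg; apply: contrapT => Nx; apply: hg; rewrite gE.
move=> /aux[u mu_ fu] /aux[v mv fv]; exists (u, v); split => //=.
by apply: ae_and fu fv => x; case: (f x) => a b /= -> ->.
Qed.

Section bilinear.
Variables (alpha : R) (f1 f2 : Rn R n -> R[i]).
Hypotheses (mRe1 : measurable_fun setT (fun x => complex.Re (f1 x)))
  (mIm1 : measurable_fun setT (fun x => complex.Im (f1 x)))
  (mRe2 : measurable_fun setT (fun x => complex.Re (f2 x)))
  (mIm2 : measurable_fun setT (fun x => complex.Im (f2 x))).

(** Replace the four real and imaginary parts by Borel representatives: this
    changes the integrand only on a null set of y, for each x. *)
Lemma measurable_cJ :
  [/\ forall x, measurable_fun setT (fun y => complex.Re (cJ_integrand alpha f1 f2 x y)),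
      forall x, measurable_fun setT (fun y => complex.Im (cJ_integrand alpha f1 f2 x y)),
      measurable_fun setT (fun x => complex.Re (cJ alpha f1 f2 x)) &
      measurable_fun setT (fun x => complex.Im (cJ alpha f1 f2 x))].
Proof.
have [[u1 v1] /= [mu1 mv1 e1]] := complex_representative mRe1 mIm1.
have [[u2 v2] /= [mu2 mv2 e2]] := complex_representative mRe2 mIm2.
have mc (a : R) (g : T -> R) : measurable_fun setT g ->
    measurable_fun setT (fun z : T * T => g (affine a z.1 z.2)).
  move=> mg; apply/measurable_EFinP.
  apply: (@measurable_comp_affine R n _ (T * T)%type a (EFin \o g) fst snd) => //.
  exact/measurable_EFinP.
have mk : measurable_fun setT (fun z : T * T => riesz_kernel alpha z.2).
  exact: measurableT_comp (measurable_riesz_kernel alpha) measurable_snd.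
have E x : {ae mu, forall y, cJ_integrand alpha f1 f2 x y =
    ((u1 (affine 1 x y) +i* v1 (affine 1 x y))%C *
     (u2 (affine (-1) x y) +i* v2 (affine (-1) x y))%C * (riesz_kernel alpha y)%:C%C)%R}.
  have N1 : (-1 != 0 :> R)%R by rewrite oppr_eq0 oner_eq0.
  apply: ae_and (ae_affine x (oner_neq0 R) e1) (ae_affine x N1 e2) => y a1 a2.
  by rewrite /cJ_integrand Rn_add_affine Rn_sub_affine a1 a2.
pose hRe (z : T * T) := ((u1 (affine 1 z.1 z.2) * u2 (affine (-1) z.1 z.2) -
  v1 (affine 1 z.1 z.2) * v2 (affine (-1) z.1 z.2)) * riesz_kernel alpha z.2)%R.
pose hIm (z : T * T) := ((u1 (affine 1 z.1 z.2) * v2 (affine (-1) z.1 z.2) +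
  v1 (affine 1 z.1 z.2) * u2 (affine (-1) z.1 z.2)) * riesz_kernel alpha z.2)%R.
have mhRe : measurable_fun setT hRe.
  by apply: measurable_funM mk; apply: measurable_funB; apply: measurable_funM; exact: mc.
have mhIm : measurable_fun setT hIm.
  by apply: measurable_funM mk; apply: measurable_funD; apply: measurable_funM; exact: mc.
have ReE (a b c d k : R) :
    complex.Re ((a +i* b)%C * (c +i* d)%C * k%:C%C)%R = ((a * c - b * d) * k)%R.
  by rewrite /= mulr0 subr0.
have ImE (a b c d k : R) :
    complex.Im ((a +i* b)%C * (c +i* d)%C * k%:C%C)%R = ((a * d + b * c) * k)%R.
  by rewrite /= mulr0 add0r.
have [] := @measurable_parametric_integral hRe
  (fun x y => complex.Re (cJ_integrand alpha f1 f2 x y)) mhRe.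
  by move=> x; apply: ae_imply (E x) => y ->; exact: ReE.
move=> mReI mReJ.
have [] := @measurable_parametric_integral hIm
  (fun x y => complex.Im (cJ_integrand alpha f1 f2 x y)) mhIm.
  by move=> x; apply: ae_imply (E x) => y ->; exact: ImE.
move=> mImI mImJ; split; [exact: mReI|exact: mImI|exact: mReJ|exact: mImJ].
Qed.

Let F1 x := (normc (f1 x))%:E.
Let F2 x := (normc (f2 x))%:E.

Lemma normc_cJ_integrand x y :
  (normc (cJ_integrand alpha f1 f2 x y))%:E =
  F1 (Rn_add x y) * F2 (Rn_sub x y) * (riesz_kernel alpha y)%:E.
Proof.
rewrite /cJ_integrand normc_realM ?invr_ge0 ?powR_ge0//.
by rewrite ComplexField.Normc.normcM !EFinM.
Qed.

Let mnorm x : measurable_fun setT (fun y => (normc (cJ_integrand alpha f1 f2 x y))%:E).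
Proof.
have [mRe mIm _ _] := measurable_cJ.
by apply/measurable_EFinP; exact: measurable_normc.
Qed.

Let normE x : \int[mu]_y (normc (cJ_integrand alpha f1 f2 x y))%:E = J alpha F1 F2 x.
Proof. by apply: eq_integral => y _; exact: normc_cJ_integrand. Qed.

Let le_abs_J x (h : Rn R n -> R) : measurable_fun setT h ->
  (forall y, `|h y| <= normc (cJ_integrand alpha f1 f2 x y))%R ->
  \int[mu]_y `|(h y)%:E| <= J alpha F1 F2 x.
Proof.
move=> mh hle; rewrite -normE.
have mh' : measurable_fun setT (fun y => `|(h y)%:E|).
  apply: (measurableT_comp (@abse_measurable R setT)); exact/measurable_EFinP.
apply: (@ge0_le_integral _ _ _ mu setT measurableT _ _ _ mh' (mnorm x)).
- by move=> y _; exact: abse_ge0.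
- by move=> y _; rewrite abse_EFin lee_fin; exact: hle.
Qed.

Lemma cJ_converges_J x : J alpha F1 F2 x < +oo -> cJ_converges alpha f1 f2 x.
Proof.
have [mRe mIm _ _] := measurable_cJ; move=> Jx.
split; apply/integrableP; split; try exact/measurable_EFinP.
- by apply: le_lt_trans Jx; apply: le_abs_J => // y; exact: normr_Re_le.
- by apply: le_lt_trans Jx; apply: le_abs_J => // y; exact: normr_Im_le.
Qed.

(** Each of the real and imaginary parts of the integral is at most the integral
    of the modulus, whence the factor 2. *)
Lemma normc_cJ_le x : (normc (cJ alpha f1 f2 x))%:E <= 2%:E * J alpha F1 F2 x.
Proof.
have [mRe mIm _ _] := measurable_cJ.
have [Jx|] := ltP (J alpha F1 F2 x) +oo; last first.
  by rewrite leye_eq => /eqP ->; rewrite gt0_muley ?lte_fin// leey.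
have le_R (h : Rn R n -> R) : measurable_fun setT h ->
    (forall y, `|h y| <= normc (cJ_integrand alpha f1 f2 x y))%R ->
    (`|\int[mu]_y h y|%R)%:E <= J alpha F1 F2 x.
  move=> mh hle; have mh' : measurable_fun setT (EFin \o h) by exact/measurable_EFinP.
  have ih : mu.-integrable setT (EFin \o h).
    by apply/integrableP; split => //; apply: le_lt_trans Jx; exact: le_abs_J.
  rewrite -abse_EFin /Rintegral fineK ?integrable_fin_num//.
  by apply: le_trans (le_abse_integral mu measurableT mh') _; exact: le_abs_J.
apply: (@le_trans _ _ ((`|complex.Re (cJ alpha f1 f2 x)|%R)%:E +
    (`|complex.Im (cJ alpha f1 f2 x)|%R)%:E)).
  by rewrite -EFinD lee_fin; exact: normc_le_normrD.
rewrite (_ : 2%:E * J alpha F1 F2 x = J alpha F1 F2 x + J alpha F1 F2 x); last first.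
  by rewrite -mule2n mule_natl.
by apply: leeD; apply: le_R => // y; [exact: normr_Re_le|exact: normr_Im_le].
Qed.

End bilinear.
End complex_estimate.
Local Open Scope complex_scope.

Theorem theorem1p4 (R : realType) (n : nat)
    (alpha p1 p2 q1 q2 p q s t : R)
    (hn : (1 <= n)%N)
    (halpha : 0 < alpha < n%:R)
    (hq1 : 1 < q1) (hqp1 : q1 <= p1)
    (hq2 : 1 < q2) (hqp2 : q2 <= p2)
    (hq : 0 < q) (hqp : q <= p)
    (ht : 0 < t) (ht1 : t <= 1) (hs : 1 <= s)
    (hp12 : p^-1 = p1^-1 + p2^-1)
    (hq12 : q^-1 = q1^-1 + q2^-1)
    (hsp : s^-1 = p^-1 - alpha / n%:R)
    (hts : q / p = t / s)
    (hsq : s < Num.min q1 q2) :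
  exists2 C : R, 0 < C &
    (forall f1 f2 : Rn R n -> \bar R,
        (forall x, (0 <= f1 x)%E) -> (forall x, (0 <= f2 x)%E) ->
        morrey p1 q1 f1 -> morrey p2 q2 f2 ->
        morrey s t (J alpha f1 f2) /\
        (morrey_norm s t (J alpha f1 f2) <=
           C%:E * morrey_norm p1 q1 f1 * morrey_norm p2 q2 f2)%E) /\
    (forall f1 f2 : Rn R n -> R[i],
        cmorrey p1 q1 f1 -> cmorrey p2 q2 f2 ->
        [/\ {ae lebesgue R n, forall x, cJ_converges alpha f1 f2 x},
            cmorrey s t (cJ alpha f1 f2) &
            (cmorrey_norm s t (cJ alpha f1 f2) <=
               C%:E * cmorrey_norm p1 q1 f1 * cmorrey_norm p2 q2 f2)%E]).
Proof.
have /andP[a0 an] := halpha.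
have sq2 : s < q2 by move: hsq; rewrite lt_min => /andP[].
have s0 : 0 < s by exact: lt_le_trans hs.
have [C C0 HC] := morrey_J_estimate hn a0 an hq1 hqp1 hq2 hqp2 hq hqp ht ht1 hs
  hp12 hq12 hsp hts sq2.
(* The factor 2 is the cost of adding real and imaginary parts. *)
exists (2 * C); first by rewrite mulr_gt0.
have fin_prod (c N1 N2 : R) : (c%:E * N1%:E * N2%:E < +oo)%E by rewrite -!EFinM ltry.
split=> [f1 f2 f10 f20 fM1 fM2|f1 f2 [mRe1 mIm1 foo1] [mRe2 mIm2 foo2]].
  have [mJ Jle] := HC f1 f2 f10 f20 fM1 fM2.
  have [N1 N10 E1] := morrey_norm_fin fM1.2.
  have [N2 N20 E2] := morrey_norm_fin fM2.2.
  rewrite E1 E2 in Jle *; split; first by split => //; exact: le_lt_trans Jle _.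
  apply: le_trans Jle _; rewrite -!EFinM lee_fin !ler_wpM2r//.
  by rewrite ler_peMl ?(ltW C0)// ler1n.
pose F1 x := (ComplexField.Normc.normc (f1 x))%:E.
pose F2 x := (ComplexField.Normc.normc (f2 x))%:E.
have F10 x : (0 <= F1 x)%E by rewrite lee_fin normc_ge0.
have F20 x : (0 <= F2 x)%E by rewrite lee_fin normc_ge0.
have FM1 : morrey p1 q1 F1.
  by split; [apply/measurable_EFinP; exact: measurable_normc|exact: foo1].
have FM2 : morrey p2 q2 F2.
  by split; [apply/measurable_EFinP; exact: measurable_normc|exact: foo2].
have [N1 N10 E1] := morrey_norm_fin foo1.
have [N2 N20 E2] := morrey_norm_fin foo2.
have [mJ] := HC F1 F2 F10 F20 FM1 FM2.
rewrite (E1 : morrey_norm p1 q1 F1 = _) (E2 : morrey_norm p2 q2 F2 = _) -!EFinM => Jle.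
have A0 : 0 <= C * N1 * N2 by rewrite !mulr_ge0 ?(ltW C0).
have JM : morrey s t (J alpha F1 F2) by split => //; exact: le_lt_trans Jle (ltry _).
have [_ _ mReJ mImJ] := measurable_cJ alpha mRe1 mIm1 mRe2 mIm2.
have cJle : (cmorrey_norm s t (cJ alpha f1 f2) <= (2 * C)%:E * N1%:E * N2%:E)%E.
  rewrite -!EFinM -(mulrA 2 C) -(mulrA 2 (C * N1)).
  rewrite /cmorrey_norm; apply: (morrey_norm_dominated s0 ht (ler0n R 2) A0 _ mJ _ _ Jle).
  - by apply/measurable_EFinP; exact: measurable_normc.
  - move=> x; apply: integral_ge0 => y _; rewrite !mule_ge0// lee_fin.
    by rewrite invr_ge0 powR_ge0.
  - by move=> x; rewrite gee0_abs ?lee_fin ?normc_ge0//; exact: normc_cJ_le.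
rewrite (E1 : cmorrey_norm p1 q1 f1 = _) (E2 : cmorrey_norm p2 q2 f2 = _).
split; last exact: cJle.
- apply: ae_imply (morrey_ae_fin s0 ht JM) => x Jx.
  by apply: cJ_converges_J => //; rewrite ltey_eq Jx.
- by split; [exact: mReJ|exact: mImJ|exact: le_lt_trans cJle (fin_prod _ _ _)].
Qed.
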